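(* Consider the second order non-autonomous impulsive control system (IS), with mild solutions, the evolution operator $\mathcal{S}(t,s)$, $\mathcal{C}(t,s)=-\frac{\partial}{\partial s}\mathcal{S}(t,s)$ and the constants $M,\tilde M,M_B$ as defined in the context. Assume: (1) $\mathrm{S}_0(t)$ is compact for every $t\in J$. (2) $f:J_1\times\mathcal{D}\to\mathbb{X}$, $J_1=\bigcup_{i=0}^{N}[s_i,t_{i+1}]$, is such that $t\mapsto f(t,\psi)$ is strongly measurable for each $\psi\in\mathcal{D}$ and $\psi\mapsto f(t,\psi)$ is continuous for a.e. $t\in J_1$; and there is $\gamma\in \mathrm{L}^1(J_1;\mathbb{R}^+)$ with $\|f(t,\psi)\|_{\mathbb{X}}\le\gamma(t)$ for a.e. $t\in J_1$ and all $\psi\in\mathcal{D}$. (3) For $i=1,\dots,N$, the impulses $\rho_i:[t_i,s_i]\times\mathbb{X}\to\mathbb{X}$ satisfy: (i) $\rho_i(\cdot,x):[t_i,s_i]\to\mathbb{X}$ is continuously differentiable for each $x\in\mathbb{X}$, with derivative in $t$ denoted $\rho_i'(t,x)$; (ii) for all $t\in[t_i,s_i]$, $\rho_i(t,\cdot):\mathbb{X}\to\mathbb{X}$ is completely continuous and $\rho_i'(t,\cdot):\mathbb{X}\to\mathbb{X}$ is continuous; (iii) there are positive constants $d_i,e_i$ with $\|\rho_i(t,x)\|_{\mathbb{X}}\le d_i$ and $\|\rho_i'(t,x)\|_{\mathbb{X}}\le e_i$ for all $t\in[t_i,s_i]$, $x\in\mathbb{X}$. (4) $g,h:\mathrm{PC}(J_q;\mathbb{X})\to\mathbb{X}$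 are such that $g$ is completely continuous, $h$ is continuous, and there are constants $M_g,M_h$ with $\|g(x)\|_{\mathbb{X}}\le M_g(\|x\|_{\mathrm{PC}(J_q;\mathbb{X})}+1)$ and $\|h(x)\|_{\mathbb{X}}\le M_h(\|x\|_{\mathrm{PC}(J_q;\mathbb{X})}+1)$ for all $x\in\mathrm{PC}(J_q;\mathbb{X})$. Then for every $\lambda>0$ and every fixed $x_T\in\mathbb{X}$, the system (IS) with the feedback control $u=u_\lambda$ given by $$u_\lambda(t)=\sum_{i=0}^{N}u_{i,\lambda}(t)\,\chi_{[s_i,t_{i+1}]}(t),\quad t\in J,$$ $$u_{i,\lambda}(t)=\mathrm{B}^*\mathcal{S}(t_{i+1},t)^*\mathcal{J}\left[\mathrm{R}(\lambda,\Psi_{s_i}^{t_{i+1}})\,g_i(x(\cdot))\right],\quad t\in[s_i,t_{i+1}],\ i=0,1,\dots,N,$$ where $$g_0(x(\cdot))=x_T-\mathcal{C}(t_1,0)[\phi(0)+g(\tilde x)]-\mathcal{S}(t_1,0)[\eta+h(\tilde x)]-\int_0^{t_1}\mathcal{S}(t_1,s)f(s,\tilde x_s)\,\mathrm{d}s,$$ $$g_i(x(\cdot))=x_T-\mathcal{C}(t_{i+1},s_i)\rho_i(s_i,\tilde x(t_i^-))-\mathcal{S}(t_{i+1},s_i)\rho_i'(s_i,\tilde x(t_i^-))-\int_{s_i}^{t_{i+1}}\mathcal{S}(t_{i+1},s)f(s,\tilde x_s)\,\mathrm{d}s,\quad i=1,\dots,N,$$ and $\tilde x:J_q\to\mathbb{X}$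 is $\tilde x(t)=\phi(t)$ for $t\in[-q,0)$, $\tilde x(t)=x(t)$ for $t\in J$, has at least one mild solution on $J$ (that is, there is a function $x$ which is a mild solution of (IS) for the control $u_\lambda$ built from this same $x$), provided $$K\left[1+\frac{(\tilde M M_B)^2T}{\lambda}\right]<1,\qquad K=MM_g+\tilde M M_h.$$
   Context: **Spaces.** $\mathbb{X}$ is a separable reflexive Banach space with strictly convex dual $\mathbb{X}^*$ ($\mathbb{X}$ itself is also taken strictly convex); $\mathbb{U}$ is a separable Hilbert space, identified with its dual; $\mathcal{L}(\mathbb{X};\mathbb{Y})$ denotes bounded linear operators and $\mathcal{L}(\mathbb{X})=\mathcal{L}(\mathbb{X};\mathbb{X})$. $J=[0,T]$, $q>0$, $J_q=[-q,T]$. The points $0=t_0=s_0<t_1\le s_1\le t_2<\dots<t_N\le s_N\le t_{N+1}=T$ are fixed. $\mathrm{B}\in\mathcal{L}(\mathbb{U};\mathbb{X})$ with $\|\mathrm{B}\|_{\mathcal{L}(\mathbb{U};\mathbb{X})}\le M_B$. $\mathcal{D}$ is the space of piecewise continuous functions $\phi:[-q,0]\to\mathbb{X}$ with jump discontinuities, with $\|\phi\|_{\mathcal{D}}=\frac1q\int_{-q}^0\|\phi(s)\|_{\mathbb{X}}\,\mathrm{d}s$. $\mathrm{PC}(J;\mathbb{X})$ is the set of $x:J\to\mathbb{X}$ whose restriction to each $I_i=(t_i,t_{i+1}]$, $i=0,\dots,N$, is continuous and such that $x(t_i^+),x(t_i^-)$ exist with $x(t_i)=x(t_i^-)$ for $i=1,\dots,N$;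 norm $\|x\|_{\mathrm{PC}(J;\mathbb{X})}=\sup_{t\in J}\|x(t)\|_{\mathbb{X}}$. $\mathrm{PC}(J_q;\mathbb{X})$ is the set of $x:J_q\to\mathbb{X}$ with $x|_{[-q,0)}\in\mathcal{D}$ and $x|_J\in\mathrm{PC}(J;\mathbb{X})$, with norm $\frac1q\int_{-q}^0\|x(s)\|_{\mathbb{X}}\,\mathrm{d}s+\sup_{t\in J}\|x(t)\|_{\mathbb{X}}$. For $x:J_q\to\mathbb{X}$ and $t\in J$, $x_t\in\mathcal{D}$ is $x_t(s)=x(t+s)$, $-q\le s\le 0$. A map is completely continuous if it is continuous and maps bounded sets to relatively compact sets. **Evolution operator.** $\mathrm{A}:\mathrm{D}(\mathrm{A})\subseteq\mathbb{X}\to\mathbb{X}$ generates a strongly continuous cosine family $\{\mathrm{C}_0(t)\}_{t\in\mathbb{R}}$ on $\mathbb{X}$, with sine family $\mathrm{S}_0(t)x=\int_0^t\mathrm{C}_0(s)x\,\mathrm{d}s$. $\mathrm{E}$ is the Banach space of $x\in\mathbb{X}$ such that $t\mapsto\mathrm{C}_0(t)x$ is continuously differentiable, with norm $\|x\|_1=\|x\|_{\mathbb{X}}+\sup_{0\le t\le1}\|\mathrm{A}\mathrm{S}_0(t)x\|_{\mathbb{X}}$. For each $t$, $\mathrm{A}(t)=\mathrm{A}+\mathrm{F}(t)$ is closed and has dense domain $\mathrm{D}(\mathrm{A})$ independent of $t$; $t\mapsto\mathrm{A}(t)x$ is continuous for $x\in\mathrm{D}(\mathrm{A})$; and $\mathrm{F}:\mathbb{R}\to\mathcal{L}(\mathrm{E};\mathbb{X})$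 is such that $t\mapsto\mathrm{F}(t)x$ is continuously differentiable in $\mathbb{X}$ for each $x\in\mathrm{E}$. $\mathcal{S}:J\times J\to\mathcal{L}(\mathbb{X})$ is the associated evolution operator: for $w\in\mathrm{E}$, $\mathcal{S}(t,s)w=x(t,s)$ is the solution of $x(t,s)=\mathrm{S}_0(t-s)w+\int_s^t\mathrm{S}_0(t-\tau)\mathrm{F}(\tau)x(\tau,s)\,\mathrm{d}\tau$, extended by density to $\mathbb{X}$. It satisfies: (D1) $(t,s)\mapsto\mathcal{S}(t,s)x$ is continuously differentiable for $x\in\mathbb{X}$, $\mathcal{S}(t,t)=0$, $\frac{\partial}{\partial t}\mathcal{S}(t,s)x|_{t=s}=x$, $\frac{\partial}{\partial s}\mathcal{S}(t,s)x|_{t=s}=-x$; (D2) for $x\in\mathrm{D}(\mathrm{A})$, $\mathcal{S}(t,s)x\in\mathrm{D}(\mathrm{A})$, $(t,s)\mapsto\mathcal{S}(t,s)x$ is $C^2$, $\frac{\partial^2}{\partial t^2}\mathcal{S}(t,s)x=\mathrm{A}(t)\mathcal{S}(t,s)x$, $\frac{\partial^2}{\partial s^2}\mathcal{S}(t,s)x=\mathcal{S}(t,s)\mathrm{A}(s)x$, $\frac{\partial^2}{\partial s\partial t}\mathcal{S}(t,s)x|_{t=s}=0$; (D3) for $x\in\mathrm{D}(\mathrm{A})$, $\frac{\partial}{\partial s}\mathcal{S}(t,s)x\in\mathrm{D}(\mathrm{A})$, $\frac{\partial^3}{\partial t^2\partial s}\mathcal{S}(t,s)x=\mathrm{A}(t)\frac{\partial}{\partial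 s}\mathcal{S}(t,s)x$, $\frac{\partial^3}{\partial s^2\partial t}\mathcal{S}(t,s)x=\frac{\partial}{\partial t}\mathcal{S}(t,s)\mathrm{A}(s)x$ (these derivatives exist), and $(t,s)\mapsto\frac{\partial}{\partial s}\mathcal{S}(t,s)x$ is continuous. Put $\mathcal{C}(t,s)=-\frac{\partial}{\partial s}\mathcal{S}(t,s)$. There are positive constants $M,\tilde M$ with $\sup_{s,t\in J}\|\mathcal{C}(t,s)\|_{\mathcal{L}(\mathbb{X})}\le M$, $\sup_{s,t\in J}\|\mathcal{S}(t,s)\|_{\mathcal{L}(\mathbb{X})}\le\tilde M$, and $t\mapsto\mathcal{S}(t,s)$ is Lipschitz in $\mathcal{L}(\mathbb{X})$ on $J$ with a constant independent of $s$. When $\mathrm{S}_0(t)$ is compact for all $t\in J$, $\mathcal{S}(t,s)$ is compact for all $0\le s\le t\le T$ (known). **Resolvent operator.** $\mathcal{J}:\mathbb{X}\to\mathbb{X}^*$ is the (single-valued) duality mapping, $\langle x,\mathcal{J}[x]\rangle=\|x\|_{\mathbb{X}}^2=\|\mathcal{J}[x]\|_{\mathbb{X}^*}^2$. For $0\le a\le b\le T$, $\Psi_a^b=\int_a^b\mathcal{S}(b,t)\mathrm{B}\mathrm{B}^*\mathcal{S}(b,t)^*\,\mathrm{d}t:\mathbb{X}^*\to\mathbb{X}$, with $^*$ denoting adjoints. For $\lambda>0$, $\mathrm{R}(\lambda,\Psi_a^b)=(\lambda\mathrm{I}+\Psi_a^b\mathcal{J})^{-1}:\mathbb{X}\to\mathbb{X}$,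 which is well defined (for each $y\in\mathbb{X}$ the equation $\lambda z+\Psi_a^b\mathcal{J}[z]=\lambda y$ has a unique solution $z=\lambda\mathrm{R}(\lambda,\Psi_a^b)(y)$). **System (IS).** Given $\phi\in\mathcal{D}$, $\eta\in\mathbb{X}$, $u\in\mathrm{L}^2(J;\mathbb{U})$: $x''(t)=\mathrm{A}(t)x(t)+\mathrm{B}u(t)+f(t,x_t)$ for $t\in\bigcup_{i=0}^N(s_i,t_{i+1}]$; $x(t)=\rho_i(t,x(t_i^-))$ and $x'(t)=\rho_i'(t,x(t_i^-))$ for $t\in(t_i,s_i]$, $i=1,\dots,N$; $x(t)=\phi(t)$ for $t\in[-q,0)$; $x(0)=\phi(0)+g(x)$; $x'(0)=\eta+h(x)$. A *mild solution* of (IS) for the control $u$ is a function $x\in\mathrm{PC}(J_q;\mathbb{X})$ with $x(t)=\phi(t)$ for $t\in[-q,0)$ and - $x(t)=\mathcal{C}(t,0)[\phi(0)+g(x)]+\mathcal{S}(t,0)[\eta+h(x)]+\int_0^t\mathcal{S}(t,s)[\mathrm{B}u(s)+f(s,x_s)]\,\mathrm{d}s$ for $t\in[0,t_1]$; - $x(t)=\rho_i(t,x(t_i^-))$ for $t\in(t_i,s_i]$, $i=1,\dots,N$; - $x(t)=\mathcal{C}(t,s_i)\rho_i(s_i,x(t_i^-))+\mathcal{S}(t,s_i)\rho_i'(s_i,x(t_i^-))+\int_{s_i}^t\mathcal{S}(t,s)[\mathrm{B}u(s)+f(s,x_s)]\,\mathrm{d}s$ for $t\in(s_i,t_{i+1}]$,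 $i=1,\dots,N$. *)

(* Defs.v *)
From HB Require Import structures.
From mathcomp Require Export all_boot all_order all_algebra.
From mathcomp Require Export all_classical all_reals all_analysis.
Export Order.TTheory GRing.Theory Num.Theory.
Export numFieldNormedType.Exports.

Set Implicit Arguments.
Unset Strict Implicit.
Unset Printing Implicit Defensive.

Local Open Scope classical_set_scope.
Local Open Scope ring_scope.

Definition bounded_linear (R : realType) (V W : normedModType R)
    (L : V -> W) : Prop :=
  linear L /\ exists k : R, forall x, `|L x| <= k * `|x|.

(* Real-valued supremum: meaningful only for bounded [L]. *)
Definition opnorm (R : realType) (V W : normedModType R) (L : V -> W) : R :=
  sup [set `|L x| | x in [set x : V | `|x| <= 1]].

Definition compact_op (R : realType) (V W : normedModType R)
    (L : V -> W) : Prop :=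
  forall K : set V, bounded_set K -> precompact (L @` K).

Definition completely_continuous (R : realType) (V W : normedModType R)
    (G : V -> W) : Prop :=
  continuous G /\ forall K : set V, bounded_set K -> precompact (G @` K).

Definition dual (R : realType) (V : normedModType R) : set (V -> R^o) :=
  [set f | bounded_linear f].

Definition separable (V : topologicalType) : Prop :=
  exists2 K : set V, countable K & dense K.

Definition strictly_convex (R : realType) (V : normedModType R) : Prop :=
  forall x y : V, `|x| = 1 -> `|y| = 1 -> x != y -> `|2^-1 *: (x + y)| < 1.

Definition strictly_convex_dual (R : realType) (V : normedModType R) : Prop :=
  forall f g : V -> R^o, dual f -> dual g -> opnorm f = 1 -> opnorm g = 1 ->
    f <> g -> opnorm (fun x => 2^-1 * (f x + g x) : R^o) < 1.

(* Every bounded linear functional on the dual is evaluation at a point. *)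
Definition reflexive_space (R : realType) (V : normedModType R) : Prop :=
  forall Phi : (V -> R^o) -> R,
    (forall (a : R) f g, dual f -> dual g ->
       Phi (fun x => a * f x + g x) = a * Phi f + Phi g) ->
    (exists k : R, forall f, dual f -> `|Phi f| <= k * opnorm f) ->
  exists x : V, forall f, dual f -> Phi f = f x.

Definition duality_map (R : realType) (V : normedModType R)
    (J : V -> (V -> R^o)) : Prop :=
  forall x, [/\ dual (J x), J x x = `|x| ^+ 2 & opnorm (J x) ^+ 2 = `|x| ^+ 2].

(* The norm of [U] comes from the inner product [dot]. *)
Definition inner_product (R : realType) (U : normedModType R)
    (dot : U -> U -> R) : Prop :=
  [/\ forall v, scalar (dot ^~ v), forall u v, dot u v = dot v u &
      forall u, dot u u = `|u| ^+ 2].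

(* [Bs : V^* -> U] is the adjoint of [B : U -> V], with [U] identified with
   its dual through [dot]. *)
Definition adjoint_to (R : realType) (U V : normedModType R)
    (dot : U -> U -> R) (B : U -> V) (Bs : (V -> R^o) -> U) : Prop :=
  forall f, dual f -> forall u, dot (Bs f) u = f (B u).

Notation leb := (@lebesgue_measure _).

Definition simple (R : realType) (V : normedModType R) (s : R -> V) : Prop :=
  finite_set (range s) /\ forall v, measurable (s @^-1` [set v]).

(* The null set makes this insensitive to the choice between Borel and
   Lebesgue measurable sets in [simple]. *)
Definition strongly_measurable (R : realType) (V : normedModType R)
    (D : set R) (F : R -> V) : Prop :=
  exists s : nat -> R -> V, (forall n, simple (s n)) /\
    {ae leb, forall t : R, D t -> s n t @[n --> \oo] --> F t}.

Definition simple_integral (R : realType) (V : normedModType R) (a b : R)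
    (s : R -> V) : V :=
  \sum_(v \in range s) fine (leb (`[a, b] `&` s @^-1` [set v])) *: v.

Definition is_bochner (R : realType) (V : normedModType R) (a b : R)
    (F : R -> V) (I : V) : Prop :=
  strongly_measurable `[a, b] F /\
  exists s : nat -> R -> V,
    [/\ forall n, simple (s n),
        (\int[leb]_(t in `[a, b]) (`|F t - s n t|)%:E)%E @[n --> \oo] --> 0%E &
        simple_integral a b (s n) @[n --> \oo] --> I].

Definition bochner_integrable (R : realType) (V : normedModType R) (a b : R)
    (F : R -> V) : Prop :=
  exists I, is_bochner a b F I.

Definition bint (R : realType) (V : normedModType R) (a b : R)
    (F : R -> V) : V :=
  xget 0 [set I | is_bochner a b F I].

Definition obint (R : realType) (V : normedModType R) (a b : R)
    (F : R -> V) : V :=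
  if a <= b then bint a b F else - bint b a F.

Definition oint_integrable (R : realType) (V : normedModType R) (a b : R)
    (F : R -> V) : Prop :=
  bochner_integrable (Num.min a b) (Num.max a b) F.

Definition L2 (R : realType) (V : normedModType R) (a b : R)
    (u : R -> V) : Prop :=
  strongly_measurable `[a, b] u /\
  (\int[leb]_(t in `[a, b]) (`|u t| ^+ 2)%:E < +oo)%E.

(* Derivatives relative to [I] are one-sided at the endpoints of [I]. *)
Definition diff_quot (R : realType) (V : normedModType R) (I : set R)
    (F : R -> V) (t : R) : set_system V :=
  (h^-1 *: (F (t + h) - F t)) @[h --> within [set h | I (t + h)] 0^'].

(* Vacuously true when [I] is reduced to the point [t]. *)
Definition is_derive_in (R : realType) (V : normedModType R) (I : set R)
    (F : R -> V) (t : R) (d : V) : Prop :=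
  diff_quot I F t --> d.

Definition derivable_in (R : realType) (V : normedModType R) (I : set R)
    (F : R -> V) (t : R) : Prop :=
  exists d, is_derive_in I F t d.

Definition derive_in (R : realType) (V : normedModType R) (I : set R)
    (F : R -> V) (t : R) : V :=
  xget 0 [set d | is_derive_in I F t d].

(* Partial derivatives on [I * I] in the first and second variables. *)
Definition d1 (R : realType) (V : normedModType R) (I : set R)
    (G : R -> R -> V) : R -> R -> V :=
  fun t s => derive_in I (G ^~ s) t.

Definition d2 (R : realType) (V : normedModType R) (I : set R)
    (G : R -> R -> V) : R -> R -> V :=
  fun t s => derive_in I (G t) s.

Definition continuous2 (R : realType) (V : normedModType R) (I : set R)
    (G : R -> R -> V) : Prop :=
  {within I `*` I, continuous (fun p : R * R => G p.1 p.2)}.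

Definition C1_2 (R : realType) (V : normedModType R) (I : set R)
    (G : R -> R -> V) : Prop :=
  [/\ forall t s, I t -> I s -> derivable_in I (G ^~ s) t,
      forall t s, I t -> I s -> derivable_in I (G t) s,
      continuous2 I (d1 I G) & continuous2 I (d2 I G)].

Definition C2_2 (R : realType) (V : normedModType R) (I : set R)
    (G : R -> R -> V) : Prop :=
  [/\ C1_2 I G, C1_2 I (d1 I G) & C1_2 I (d2 I G)].

Definition C1_line (R : realType) (V : normedModType R) (F : R -> V) : Prop :=
  (forall t, derivable F t 1) /\ continuous (derive1 F).

Definition cosine_family (R : realType) (X : normedModType R)
    (C0 : R -> X -> X) : Prop :=
  [/\ forall t, bounded_linear (C0 t),
      C0 0 = id,
      forall s t x, C0 (s + t) x + C0 (s - t) x = 2 *: C0 s (C0 t x) &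
      forall x, continuous (C0 ^~ x)].

Definition gen_dom (R : realType) (X : normedModType R)
    (C0 : R -> X -> X) : set X :=
  [set x | C1_line (C0 ^~ x) /\ C1_line (derive1 (C0 ^~ x))].

Definition gen (R : realType) (X : normedModType R)
    (C0 : R -> X -> X) (x : X) : X :=
  derive1 (derive1 (C0 ^~ x)) 0.

Definition sine (R : realType) (X : normedModType R)
    (C0 : R -> X -> X) (t : R) (x : X) : X :=
  obint 0 t (C0 ^~ x).

Definition E_space (R : realType) (X : normedModType R)
    (C0 : R -> X -> X) : set X :=
  [set x | C1_line (C0 ^~ x)].

Definition E_norm (R : realType) (X : normedModType R)
    (C0 : R -> X -> X) (x : X) : R :=
  `|x| + sup [set `|gen C0 (sine C0 t x)| | t in `[0, 1]%classic].

Definition At (R : realType) (X : normedModType R)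
    (C0 : R -> X -> X) (F : R -> X -> X) (t : R) (x : X) : X :=
  gen C0 x + F t x.

(* [F t] is only meaningful on [E_space C0]. *)
Definition perturbation (R : realType) (X : normedModType R)
    (C0 : R -> X -> X) (F : R -> X -> X) : Prop :=
  [/\ forall t (a : R) x y, E_space C0 x -> E_space C0 y ->
        F t (a *: x + y) = a *: F t x + F t y,
      forall t, exists k : R, forall x, E_space C0 x ->
        `|F t x| <= k * E_norm C0 x,
      forall x, E_space C0 x -> C1_line (F ^~ x),
      dense (gen_dom C0) /\
        (forall t, closed [set p : X * X |
           gen_dom C0 p.1 /\ p.2 = At C0 F t p.1]) &
      forall x, gen_dom C0 x -> continuous (fun t => At C0 F t x)].

(* [C(t, s) = - d/ds S(t, s)] on [0, T]. *)
Definition cosop (R : realType) (X : normedModType R) (T : R)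
    (S : R -> R -> X -> X) (t s : R) (x : X) : X :=
  - d2 `[0, T] (fun t s => S t s x) t s.

Definition cond_D1 (R : realType) (X : normedModType R) (T : R)
    (S : R -> R -> X -> X) : Prop :=
  let J : set R := `[0, T]%classic in
  forall x, let Sx := fun t s => S t s x in
  C1_2 J Sx /\
  forall t, J t -> [/\ Sx t t = 0, d1 J Sx t t = x & d2 J Sx t t = - x].

Definition cond_D2 (R : realType) (X : normedModType R) (T : R)
    (C0 F : R -> X -> X) (S : R -> R -> X -> X) : Prop :=
  let J : set R := `[0, T]%classic in
  forall x, gen_dom C0 x -> let Sx := fun t s => S t s x in
  C2_2 J Sx /\
  forall t s, J t -> J s ->
    [/\ gen_dom C0 (Sx t s),
        d1 J (d1 J Sx) t s = At C0 F t (Sx t s),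
        d2 J (d2 J Sx) t s = S t s (At C0 F s x) &
        d2 J (d1 J Sx) t t = 0].

Definition cond_D3 (R : realType) (X : normedModType R) (T : R)
    (C0 F : R -> X -> X) (S : R -> R -> X -> X) : Prop :=
  let J : set R := `[0, T]%classic in
  forall x, gen_dom C0 x -> let Sx := fun t s => S t s x in
  continuous2 J (d2 J Sx) /\
  forall t s, J t -> J s ->
    [/\ gen_dom C0 (d2 J Sx t s),
        is_derive_in J (fun t' => d1 J (d2 J Sx) t' s) t
          (At C0 F t (d2 J Sx t s)) &
        is_derive_in J (fun s' => d2 J (d1 J Sx) t s') s
          (d1 J (fun t s' => S t s' (At C0 F s x)) t s)].

(* [S] is the evolution operator of [A(t) = A + F(t)] on [0, T]: [evol_eq]
   determines it on the dense space [E_space C0], the other fields are the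
   standing properties of this operator. *)
Record evolution_operator (R : realType) (X : normedModType R) (T M Mt : R)
    (C0 F : R -> X -> X) (S : R -> R -> X -> X) : Prop := {
  evol_bounded : forall t s, t \in `[0, T] -> s \in `[0, T] ->
    bounded_linear (S t s) /\ bounded_linear (cosop T S t s) ;
  evol_eq : forall w, E_space C0 w -> forall t s, t \in `[0, T] ->
    s \in `[0, T] -> let k tau := sine C0 (t - tau) (F tau (S tau s w)) in
    [/\ E_space C0 (S t s w), oint_integrable s t k &
        S t s w = sine C0 (t - s) w + obint s t k] ;
  evol_D1 : cond_D1 T S ;
  evol_D2 : cond_D2 T C0 F S ;
  evol_D3 : cond_D3 T C0 F S ;
  evol_cos_le : forall t s, t \in `[0, T] -> s \in `[0, T] ->
    opnorm (cosop T S t s) <= M ;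
  evol_sin_le : forall t s, t \in `[0, T] -> s \in `[0, T] ->
    opnorm (S t s) <= Mt ;
  evol_lipschitz : exists L : R, forall t1 t2 s, t1 \in `[0, T] ->
    t2 \in `[0, T] -> s \in `[0, T] ->
    opnorm (fun x => S t1 s x - S t2 s x) <= L * `|t1 - t2| ;
  evol_compact : (forall t, t \in `[0, T] -> compact_op (sine C0 t)) ->
    forall t s, 0 <= s -> s <= t -> t <= T -> compact_op (S t s) }.

(* Functions on [-q, 0], [0, T] and [-q, T] are represented by total functions
   on [R]; the values elsewhere are irrelevant. *)

Definition in_D (R : realType) (X : normedModType R) (q : R)
    (psi : R -> X) : Prop :=
  let I : set R := `[- q, 0]%classic in
  exists l : seq R, forall s : R, I s ->
    [/\ s \notin l -> psi v @[v --> within I (nbhs s)] --> psi s,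
        exists y : X, psi v @[v --> within I s^'-] --> y &
        exists y : X, psi v @[v --> within I s^'+] --> y].

Definition norm_D (R : realType) (X : normedModType R) (q : R)
    (psi : R -> X) : R :=
  q^-1 * \int[leb]_(s in `[- q, 0]) `|psi s|.

(* For [i = 0] the clause on right limits is the existence of [x(0+)],
   without which the supremum norm may be infinite. *)
Definition PC (R : realType) (X : normedModType R) (T : R) (N : nat)
    (t_ : nat -> R) (x : R -> X) : Prop :=
  [/\ forall i, (i <= N)%N -> {within `]t_ i, t_ i.+1], continuous x},
      forall i, (i <= N)%N ->
        exists y : X, x v @[v --> within `[0, T] (t_ i)^'+] --> y &
      forall i, (1 <= i <= N)%N -> x v @[v --> (t_ i)^'-] --> x (t_ i)].

Definition norm_PC (R : realType) (X : normedModType R) (T : R)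
    (x : R -> X) : R :=
  sup [set `|x t| | t in `[0, T]%classic].

Definition PCq (R : realType) (X : normedModType R) (q T : R) (N : nat)
    (t_ : nat -> R) (x : R -> X) : Prop :=
  (exists2 psi, in_D q psi & forall s, - q <= s < 0 -> x s = psi s) /\
  PC T N t_ x.

Definition norm_PCq (R : realType) (X : normedModType R) (q T : R)
    (x : R -> X) : R :=
  norm_D q x + norm_PC T x.

(* The history [x_t]. *)
Definition hist (R : realType) (X : normedModType R) (x : R -> X) (t : R) :
    R -> X :=
  fun s => x (t + s).

(* Continuity, and complete continuity, on a space [P] of functions for the
   (semi)norm [nrm]. *)
Definition fun_continuous (R : realType) (X : normedModType R)
    (P : set (R -> X)) (nrm : (R -> X) -> R) (G : (R -> X) -> X) : Prop :=
  forall x, P x -> forall e : R, 0 < e -> exists2 d : R, 0 < d &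
    forall y, P y -> nrm (fun s => y s - x s) < d -> `|G y - G x| < e.

Definition fun_completely_continuous (R : realType) (X : normedModType R)
    (P : set (R -> X)) (nrm : (R -> X) -> R) (G : (R -> X) -> X) : Prop :=
  fun_continuous P nrm G /\
  forall K : set (R -> X), K `<=` P ->
    (exists r : R, forall x, K x -> nrm x <= r) -> precompact (G @` K).

(* [0 = t_0 = s_0 < t_1 <= s_1 <= t_2 < ... < t_N <= s_N <= t_(N+1) = T] *)
Definition impulse_times (R : realType) (T : R) (N : nat)
    (t_ s_ : nat -> R) : Prop :=
  [/\ t_ 0%N = 0 /\ s_ 0%N = 0, 0 < t_ 1%N,
      forall i, (1 <= i <= N)%N -> t_ i <= s_ i /\ s_ i <= t_ i.+1,
      forall i, (2 <= i < N)%N -> t_ i < t_ i.+1 &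
      t_ N.+1 = T].

(* [J_1] *)
Definition active_times (R : realType) (N : nat) (t_ s_ : nat -> R) : set R :=
  [set t | exists2 i, (i <= N)%N & t \in `[s_ i, t_ i.+1]].

Definition left_lim (R : realType) (X : normedModType R) (x : R -> X) (t : R) :
    X :=
  lim (x v @[v --> t^'-]).

Definition mild_solution (R : realType) (X U : normedModType R) (q T : R)
    (N : nat) (t_ s_ : nat -> R) (S : R -> R -> X -> X) (B : U -> X)
    (f : R -> (R -> X) -> X) (rho drho : nat -> R -> X -> X)
    (g h : (R -> X) -> X) (phi : R -> X) (eta : X)
    (u : R -> U) (x : R -> X) : Prop :=
  let k t s := S t s (B (u s) + f s (hist x s)) in
  [/\ L2 0 T u /\ PCq q T N t_ x,
      forall t, - q <= t < 0 -> x t = phi t,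
      forall t, 0 <= t <= t_ 1%N ->
        bochner_integrable 0 t (k t) /\
        x t = cosop T S t 0 (phi 0 + g x) + S t 0 (eta + h x)
              + bint 0 t (k t),
      forall i t, (1 <= i <= N)%N -> t_ i < t <= s_ i ->
        x t = rho i t (left_lim x (t_ i)) &
      forall i t, (1 <= i <= N)%N -> s_ i < t <= t_ i.+1 ->
        bochner_integrable (s_ i) t (k t) /\
        x t = cosop T S t (s_ i) (rho i (s_ i) (left_lim x (t_ i)))
              + S t (s_ i) (drho i (s_ i) (left_lim x (t_ i)))
              + bint (s_ i) t (k t)].

(* [Psi_a^b : X^* -> X]; the adjoint of [S b t] is [p |-> p \o S b t]. *)
Definition Psi (R : realType) (X U : normedModType R)
    (S : R -> R -> X -> X) (B : U -> X) (Bs : (X -> R^o) -> U)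
    (a b : R) (p : X -> R^o) : X :=
  bint a b (fun t => S b t (B (Bs (p \o S b t)))).

(* [Res lam a b = (lam I + Psi_a^b J)^-1 : X -> X] *)
Definition resolvent (R : realType) (X U : normedModType R) (T : R)
    (S : R -> R -> X -> X) (B : U -> X) (Bs : (X -> R^o) -> U)
    (J : X -> (X -> R^o)) (Res : R -> R -> R -> X -> X) : Prop :=
  forall lam a b : R, 0 < lam -> 0 <= a -> a <= b -> b <= T ->
    let G z := lam *: z + Psi S B Bs a b (J z) in
    cancel G (Res lam a b) /\ cancel (Res lam a b) G.

Definition xtilde (R : realType) (X : normedModType R) (phi x : R -> X) :
    R -> X :=
  fun t => if t < 0 then phi t else x t.

Definition target (R : realType) (X : normedModType R) (T : R)
    (t_ s_ : nat -> R) (S : R -> R -> X -> X) (f : R -> (R -> X) -> X)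
    (rho drho : nat -> R -> X -> X) (g h : (R -> X) -> X)
    (phi : R -> X) (eta xT : X) (x : R -> X) (i : nat) : X :=
  let xt := xtilde phi x in
  let b := t_ i.+1 in
  match i with
  | 0%N => xT - cosop T S b 0 (phi 0 + g xt) - S b 0 (eta + h xt)
           - bint 0 b (fun s => S b s (f s (hist xt s)))
  | _ => xT - cosop T S b (s_ i) (rho i (s_ i) (left_lim xt (t_ i)))
         - S b (s_ i) (drho i (s_ i) (left_lim xt (t_ i)))
         - bint (s_ i) b (fun s => S b s (f s (hist xt s)))
  end.

Definition feedback (R : realType) (X U : normedModType R) (T : R) (N : nat)
    (t_ s_ : nat -> R) (S : R -> R -> X -> X)
    (f : R -> (R -> X) -> X) (rho drho : nat -> R -> X -> X)
    (g h : (R -> X) -> X) (phi : R -> X) (eta xT : X)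
    (Bs : (X -> R^o) -> U) (J : X -> (X -> R^o))
    (Res : R -> R -> R -> X -> X) (lam : R) (x : R -> X) : R -> U :=
  fun t => \sum_(i < N.+1) (\1_(`[s_ i, t_ i.+1]%classic) t : R) *:
    Bs (J (Res lam (s_ i) (t_ i.+1)
             (target T t_ s_ S f rho drho g h phi eta xT x i))
        \o S (t_ i.+1) t).

(* Main.v *)
Require Import Defs.
From mathcomp Require Import ring lra zify.
From mathcomp Require Import finmap measurable_realfun.

(** The mild solutions are the fixed points of the map sending [x] to the
    right-hand sides of the variation of constants formulas, the control being
    computed from [x]. Schauder's theorem is applied to it on the functions of
    PC(J_q; X) that extend phi and are bounded by [r] on [0, T], for uniform
    convergence on [0, T].

    Continuity. Since the duality map is monotone, [z = R(lam, Psi) y] satisfies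
    [|z| <= |y| / lam], and the controls [u], [u'] built from two targets [y],
    [y'] satisfy [int |u - u'|^2 <= (|z| + |z'|) |y - y'|]; so they depend
    continuously on [y] in L^1.

    Compactness. The values of [C(t, s_i) A] come from points [A] varying in a
    compact set. The other terms are Lipschitz in [t] uniformly in [x], because
    [S(t, s)] is Lipschitz in [t] and vanishes for [t = s], so that only fixed
    times matter; there [S(t, s)] is a compact operator, Lipschitz in [s].

    Invariance. The image of [x] is bounded by
    [c + K (1 + (Mt MB)^2 T / lam) r], hence by [r] when [r] is large.

    Relative compactness is expressed by finite colorings: for every [eps > 0]
    the set is cut into finitely many pieces of diameter at most [eps]. In this
    form Schauder's theorem reduces to Brouwer's on a simplex, which is deduced
    from a combinatorial lemma of Scarf. Everywhere else that Hahn-Banach would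
    be used, the duality map provides the norming functionals. *)

Set Implicit Arguments.
Unset Strict Implicit.
Unset Printing Implicit Defensive.

(** * A combinatorial lemma of Scarf *)

(** Strict convexity of the dual makes the duality map single valued, not norm continuous, so no
    estimate of [z - z'] is sought for the resolvent. What survives is an identity of Gramian type:
    pairing [Psi p - Psi p'] with [p - p'] gives exactly the squared L^2 distance of the two
    controls, and the solution formula sees the resolvent only through the control. Compactness is
    distributed unevenly. [h] and the slopes [drho] are merely continuous, but they enter through
    the compact operators [S]; [g] and [rho] enter through [C], which is the identity for equal
    times, and there complete continuity is used. The control is only bounded, which is enough
    because it stands behind [S] too. The dependence on [r] comes from the first interval alone,
    where [g] and [h] grow with slopes [Mg] and [Mh]; this gives [K]. The factor 1 + (Mt MB)^2 T /
    lam appears because the control is at most MB Mt / lam times the target and is then integrated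
    against Mt MB over a length at most T. Histories are measured in an integral norm, for which
    translation of a piecewise continuous function is continuous; the measurability of f(t, x_t) in
    t rests on this. *)

(** Exactly one fiber of [f] on [S] has two elements and the others have one; the removable elements
    are those two. It serves twice: with [f] a coloring, and with [f] sending an order to the
    minimum of a set. *)
Lemma card_critical (A B : finType) (f : A -> B) (S : {set A}) :
  #|S| = #|f @: S|.+1 -> #|[set a in S | f @: (S :\ a) == f @: S]| = 2.
Proof.
move=> cS.
have : ~~ dinjectiveb f S by apply/negP => /dinjectiveP /card_in_imset; lia.
case/dinjectivePn => a aS [b]; rewrite !inE => /andP[ba bS] fab.
have crit x y : x \in S -> y \in S -> y != x -> f x = f y ->
    f @: (S :\ x) == f @: S.
  move=> xS yS yx fxy; rewrite finset.eqEsubset imsetS ?subsetDl //=.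
  apply/fintype.subsetP => _ /imsetP[z zS ->]; have [->|zx] := eqVneq z x.
    by rewrite fxy imset_f // !inE yx.
  by rewrite imset_f // !inE zx.
suff -> : [set a in S | f @: (S :\ a) == f @: S] = [set a; b].
  by rewrite cards2 eq_sym ba.
apply/setP => k; rewrite !inE; apply/andP/orP; last first.
  by case=> /eqP ->; split=> //; [apply: (crit a b)|apply: (crit b a); rewrite // eq_sym].
case=> kS /eqP e; have cSk : #|f @: (S :\ k)| = #|S :\ k|.
  by rewrite e; have := cardsD1 k S; rewrite kS; lia.
move/eqP/imset_injP: cSk => inj.
have [|ka] := eqVneq k a; first by left.
have [|kb] := eqVneq k b; first by right.
by case/eqP: ba; apply: inj; rewrite // !inE ?bS ?aS eq_sym ?ka ?kb.
Qed.

(* Parity argument: call door a dominant set with one point fewer than [I],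
   colored by all colors but [i0]. Every door lies in exactly two dominant sets
   of cardinal [#|I|], except the door made of the slack points, which lies in
   one; and such a set has one door if it carries all colors, else none or two. *)
Section Scarf.
Variables (X I : finType) (r : I -> X -> nat) (slack : I -> X) (c : X -> I).
Hypothesis r_inj : forall i, injective (r i).
Hypothesis slack_inj : injective slack.
Hypothesis slack_min : forall i y, r i (slack i) <= r i y.
Hypothesis slack_max : forall i j y, j != i -> (forall l, y != slack l) ->
  r i y < r i (slack j).
Hypothesis c_slack : forall i, c (slack i) = i.

(** No point lies strictly above the minimum of [B] in all the orders at once. These are the
    primitive sets of Scarf. *)
Definition dominant (B : {set X}) :=
  [forall y, [exists i, [forall x in B, r i y <= r i x]]].

Lemma dominantP (B : {set X}) :
  reflect (forall y, exists i, forall x, x \in B -> r i y <= r i x)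
          (dominant B).
Proof.
apply: (iffP forallP) => H y.
  by have /existsP[i /forall_inP Hi] := H y; exists i.
by have [i Hi] := H y; apply/existsP; exists i; apply/forall_inP.
Qed.

Lemma dominantS (B D : {set X}) : D \subset B -> dominant B -> dominant D.
Proof.
move=> /fintype.subsetP DB /dominantP H; apply/dominantP => y.
by have [i Hi] := H y; exists i => x /DB; apply: Hi.
Qed.

(** Every point of [D] is the minimum of [D] for some order, and there is one order too many, so one
    point is the minimum for two orders. Each of these two orders [k] can be released, and then the
    only point that can be added is the [k]-largest one above the minima of the other orders. *)
Lemma card_rooms_internal (D : {set X}) (x0 : X) : dominant D -> x0 \in D ->
  (forall l, x0 != slack l) -> #|I| = #|D|.+1 ->
  #|[set x | (x \notin D) && dominant (x |: D)]| = 2.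
Proof.
move=> domD x0D x0s cD.
pose m i := [arg min_(x < x0 in D) r i x].
have mD i : m i \in D by rewrite /m; case: arg_minnP.
have mle i x : x \in D -> r i (m i) <= r i x.
  by rewrite /m; case: arg_minnP => // ? _; apply.
have mP i x : x \in D -> (forall y, y \in D -> r i x <= r i y) -> x = m i.
  move=> xD Hx; apply: (r_inj (i := i)); apply/eqP.
  by rewrite eqn_leq Hx // mle.
have mT : m @: [set: I] = D.
  apply/setP => x; apply/imsetP/idP => [[i _ ->] //|xD].
  have /dominantP/(_ x)[i Hi] := domD.
  by exists i; rewrite ?inE //; apply: mP.
pose K := [set k in [set: I] | m @: ([set: I] :\ k) == m @: [set: I]].
have cK : #|K| = 2 by apply: card_critical; rewrite mT cardsT.
have KP k : reflect (forall d, d \in D -> exists2 l, l != k & d = m l) (k \in K).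
  rewrite !inE mT; apply: (iffP eqP) => [<- d /imsetP[l]|H].
    by rewrite !inE andbT => lk ->; exists l.
  apply/setP => d; apply/imsetP/idP => [[l _ ->] //|/H[l lk ->]].
  by exists l; rewrite // !inE lk.
pose M k := [set y | [forall l, (l != k) ==> (r l (m l) < r l y)]].
have MP k y : reflect (forall l, l != k -> r l (m l) < r l y) (y \in M k).
  by rewrite inE; apply: (iffP forallP) => H l; have /implyP := H l.
(* This makes [M k] nonempty, so that the maximum defining [x_ k] exists. The nonslack point [x0] of
   [D] forces a slack point that is the [l]-minimum of [D] to be [slack l]. *)
have sM k : slack k \in M k.
  apply/MP => l lk.
  case: (pickP (fun j => m l == slack j)) => [j mj|ns].
    have jl : j = l.
      apply/eqP/negPn/negP => jl; have := slack_max jl x0s.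
      by rewrite -(eqP mj) ltnNge mle.
    rewrite (eqP mj) jl ltn_neqAle slack_min andbT.
    by apply/eqP => /r_inj /slack_inj /eqP; rewrite (negPf lk).
  by apply: slack_max; [rewrite eq_sym|move=> j; rewrite ns].
pose x_ k := [arg max_(y > slack k in M k) r k y].
have xM k : x_ k \in M k by rewrite /x_; case: arg_maxnP.
have xmax k y : y \in M k -> r k y <= r k (x_ k).
  by rewrite /x_; case: arg_maxnP => // ? _; apply.
have -> : [set x | (x \notin D) && dominant (x |: D)] = x_ @: K.
  apply/setP => x; rewrite inE; apply/andP/imsetP.
    case=> xD /dominantP dx; have [k Hk] := dx x.
    have kx d : d \in D -> r k x < r k d.
      move=> dD; rewrite ltn_neqAle Hk ?inE ?dD ?orbT // andbT.
      by apply: contraNneq xD => /r_inj ->.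
    have dk d : d \in D -> exists l, [/\ l != k, d = m l & r l d < r l x].
      move=> dD; have [l Hl] := dx d; exists l.
      have dlx : r l d < r l x.
        rewrite ltn_neqAle Hl ?inE ?eqxx // andbT.
        by apply: contraNneq xD => /r_inj <-.
      split=> //; last by apply: mP => // y yD; apply: Hl; rewrite inE yD orbT.
      by apply: contraTneq dlx => ->; rewrite -leqNgt ltnW // kx.
    have kK : k \in K by apply/KP => d /dk [l [lk ? _]]; exists l.
    have xMk : x \in M k.
      apply/MP => l lk; rewrite ltnNge; apply/negP => lx.
      (* If [x] were not above [m l], neither [k] nor [l] would be required to obtain the points of
         [D] as minima, and [D] would have at most [#|I| - 2] points. *)
      have : D \subset m @: ([set: I] :\ k :\ l).
        apply/fintype.subsetP => d dD; have [l' [l'k dl' lt]] := dk d dD.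
        rewrite dl' imset_f // !inE l'k /= andbT.
        by apply: contraTneq lt => l'l; rewrite dl' l'l -leqNgt.
      move/subset_leq_card; rewrite leqNgt => /negP; apply.
      apply: leq_ltn_trans (leq_imset_card _ _) _.
      have := cardsD1 k [set: I]; have := cardsD1 l ([set: I] :\ k).
      rewrite !inE lk /= cardsT; lia.
    exists k => //; apply: (r_inj (i := k)); apply/eqP; rewrite eqn_leq xmax //=.
    have [l Hl] := dx (x_ k).
    have [lk|lk] := eqVneq l k.
      by move: Hl; rewrite lk; apply; rewrite !inE eqxx.
    have /MP/(_ _ lk) := xM k.
    by rewrite ltnNge Hl // inE mD orbT.
  case=> k kK ->; split.
    apply/negP => /(KP _ kK)[l lk e].
    by have /MP/(_ _ lk) := xM k; rewrite e ltnn.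
  apply/dominantP => y; have [l Hl] := dominantP _ domD y.
  have [yM|] := boolP (y \in M k).
    have lk : l = k.
      by apply: contraTeq (Hl _ (mD l)) => lk; rewrite -ltnNge; move/MP: yM; apply.
    exists k => z; rewrite !inE => /orP[/eqP ->|]; first exact: xmax.
    by rewrite -lk; apply: Hl.
  rewrite inE negb_forall => /existsP[j]; rewrite negb_imply -leqNgt => /andP[jk jy].
  exists j => z; rewrite !inE => /orP[/eqP ->|zD].
    by apply: leq_trans jy (ltnW _); have /MP := xM k; apply.
  exact: leq_trans jy (mle _ _ zD).
(* A common value of [x_] at two different orders would be above the minimum of [D] in every order,
   against the dominance of [D]. *)
rewrite card_in_imset // => k k' kK k'K e; apply/eqP/negPn/negP => kk'.
have [l Hl] := dominantP _ domD (x_ k).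
have := Hl _ (mD l); rewrite leqNgt => /negP; apply.
have [lk|lk] := eqVneq l k; last by have /MP := xM k; apply.
by rewrite e; have /MP := xM k'; apply; rewrite lk.
Qed.

(** The point to add is the [i0]-largest nonslack point. Adding [slack i0] instead would leave [y0]
    above the minimum in every order. *)
Lemma card_rooms_outer (i0 : I) (y0 : X) : (forall l, y0 != slack l) ->
  let D := slack @: [set~ i0] in
  #|[set x | (x \notin D) && dominant (x |: D)]| = 1.
Proof.
move=> y0s D.
pose ns := [pred y | [forall l, y != slack l]].
have ns0 : ns y0 by apply/forallP.
pose z := [arg max_(y > y0 | ns y) r i0 y].
have nsz : forall l, z != slack l.
  by apply/forallP; rewrite -/(ns z) /z; case: arg_maxnP.
have zmax y : (forall l, y != slack l) -> r i0 y <= r i0 z.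
  by move=> ny; rewrite /z; case: arg_maxnP => // u _; apply; apply/forallP.
have zD : z \notin D by apply/imsetP => -[l _ /eqP]; rewrite (negPf (nsz l)).
suff -> : [set x | (x \notin D) && dominant (x |: D)] = [set z] by rewrite cards1.
apply/setP => x; rewrite !inE; apply/andP/eqP => [[xD /dominantP dx]|->]; last first.
  split=> //; apply/dominantP => y.
  case: (pickP (fun j => y == slack j)) => [j /eqP ->|ny].
    by exists j => u _; apply: slack_min.
  exists i0 => u; rewrite !inE => /orP[/eqP ->|/imsetP[l]].
    by apply: zmax => l; rewrite ny.
  rewrite !inE => li ->; apply: ltnW; apply: slack_max => // l'.
  by rewrite ny.
have key y : (forall l, y != slack l) -> r i0 y <= r i0 x.
  move=> ny; have [l Hl] := dx y; have [li|li] := eqVneq l i0.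
    by rewrite -li; apply: Hl; rewrite !inE eqxx.
  have : slack l \in x |: D by rewrite !inE imset_f ?orbT // !inE.
  move/Hl => ly; have := slack_min l y => yl.
  have /r_inj/eqP : r l y = r l (slack l) by apply/eqP; rewrite eqn_leq ly yl.
  by rewrite (negPf (ny l)).
apply: (r_inj (i := i0)); apply/eqP; rewrite eqn_leq key // andbT.
case: (pickP (fun j => x == slack j)) => [j /eqP xj|nx]; last first.
  by apply: zmax => l; rewrite nx.
have ji : j = i0.
  by apply: contraNeq xD => ji; rewrite xj imset_f // !inE.
by rewrite xj ji slack_min.
Qed.

(** If [B] carries all colors, [c] is injective on it and only the point colored [i0] can be
    removed. If exactly the color [i0] is missing, [card_critical] gives two removable points; in
    the other cases there is none. *)
Lemma odd_doors (i0 : I) (B : {set X}) : #|B| = #|I| ->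
  odd #|[set b in B | c @: (B :\ b) == [set~ i0]]| = (c @: B == [set: I]).
Proof.
move=> cB; have ci0 : #|I| = #|[set~ i0]|.+1.
  by have := cardsC1 i0; have : 0 < #|I| by [apply/card_gt0P; exists i0]; lia.
have [cT|cT] := eqVneq.
  have /imsetP[b bB cb] : i0 \in c @: B by rewrite cT.
  have inj : {in B &, injective c}.
    by apply/imset_injP; rewrite cT cardsT cB.
  suff -> : [set b in B | c @: (B :\ b) == [set~ i0]] = [set b] by rewrite cards1.
  apply/setP => u; rewrite !inE; apply/andP/eqP => [[uB /eqP e]|->].
    apply: inj => //; rewrite -cb; apply/eqP/negPn/negP => ub.
    have : i0 \in c @: (B :\ u).
      rewrite {1}cb imset_f // !inE bB andbT.
      by apply: contraNneq ub => <-; rewrite cb.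
    by rewrite e !inE eqxx.
  split=> //; apply/eqP/setP => i; rewrite !inE; apply/imsetP/idP.
    case=> v; rewrite !inE => /andP[vb vB] ->; rewrite cb.
    by apply: contra vb => /eqP cvb; apply/eqP/inj.
  move=> ii0; have /imsetP[v vB iv] : i \in c @: B by rewrite cT.
  exists v => //; rewrite !inE vB andbT.
  by apply: contraNneq ii0 => vb; rewrite iv vb cb.
have [->|[b0]] := set_0Vmem [set b in B | c @: (B :\ b) == [set~ i0]].
  by rewrite cards0.
rewrite inE => /andP[b0B /eqP e0].
have cBe : c @: B = [set~ i0].
  apply/eqP; rewrite eq_sym finset.eqEsubset -{1}e0 imsetS ?subsetDl //=.
  apply/fintype.subsetP => _ /imsetP[v vB ->]; rewrite !inE; apply/negP => /eqP cv.
  case/eqP: cT; apply/setP => i; rewrite inE; have [->|ii0] := eqVneq i i0.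
    by rewrite -cv imset_f.
  have : i \in c @: (B :\ b0) by rewrite e0 !inE.
  by move=> /imsetP[w]; rewrite !inE => /andP[_ wB] ->; rewrite imset_f.
by rewrite -cBe card_critical // cBe cB.
Qed.

Lemma scarf : (exists y0, forall l, y0 != slack l) -> 0 < #|I| ->
  exists B : {set X}, [/\ #|B| = #|I|, dominant B & c @: B = [set: I]].
Proof.
case=> y0 y0s /card_gt0P[i0 _].
have ci0 : #|I| = #|[set~ i0]|.+1.
  by have := cardsC1 i0; have : 0 < #|I| by [apply/card_gt0P; exists i0]; lia.
suff /existsP[B /and3P[/eqP ? ? /eqP ?]] :
  [exists B : {set X}, [&& #|B| == #|I|, dominant B & c @: B == [set: I]]].
  by exists B.
apply: contraT => /existsPn none.
(* The pairs formed by a dominant set of cardinal [#|I|] and a point whose removal leaves a door are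
   counted in two ways: along the sets, which gives an even number if no set carries all colors, and
   along the doors, which gives an odd one. *)
pose P := [set p : {set X} * X | [&& #|p.1| == #|I|, dominant p.1,
  p.2 \in p.1 & c @: (p.1 :\ p.2) == [set~ i0]]].
have : ~~ odd #|P|.
  rewrite -sum1_card (partition_big (fun p => p.1) predT) //= -dvdn2.
  apply: dvdn_sum => B _; rewrite sum1_card dvdn2.
  have [/andP[/eqP cB dB]|nB] := boolP ((#|B| == #|I|) && dominant B); last first.
    rewrite (eq_card (B := pred0)) ?card0 // => -[B' b]; rewrite unfold_in /= !inE /=.
    apply/negP => /andP[/and4P[cB' dB' _ _] /eqP BB'].
    by case/negP: nB; rewrite -BB' cB'.
  have := none B; rewrite cB eqxx dB /= -(odd_doors i0) //.
  congr (~~ odd _).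
  rewrite -(card_imset [set b in B | c @: (B :\ b) == [set~ i0]] (f := pair B)).
    apply: eq_card => -[B' b]; rewrite [RHS]unfold_in /= !inE /=; apply/imsetP/idP.
      case=> b'; rewrite !inE => /andP[? ?] [-> ->].
      by rewrite cB !eqxx dB andbT /=; apply/andP.
    case/andP=> /and4P[_ _ bB e] /eqP BB'; rewrite -BB'.
    by exists b => //; rewrite inE bB.
  by move=> u v [].
apply: contraNT => _.
rewrite -sum1_card (partition_big (fun p => p.1 :\ p.2) predT) //=.
have fib (D : {set X}) : #|D|.+1 = #|I| -> c @: D == [set~ i0] ->
    \sum_(p in P | p.1 :\ p.2 == D) 1 =
    #|[set x | (x \notin D) && dominant (x |: D)]|.
  move=> cD eD; rewrite sum1_card.
  rewrite -(card_imset [set x | (x \notin D) && dominant (x |: D)]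
      (f := fun x => (x |: D, x))); last by move=> u v [].
  apply: eq_card => -[B b]; rewrite [LHS]unfold_in /= !inE /=; apply/idP/imsetP.
    case/andP=> /and4P[cB dB bB e] /eqP <-.
    by exists b; rewrite ?finset.setD1K // !inE eqxx /= finset.setD1K.
  case=> x; rewrite inE => /andP[xD dx] [-> ->].
    have -> : (x |: D) :\ x = D.
      by apply/setP => u; rewrite !inE; case: eqVneq => //= ->; rewrite (negPf xD).
    by rewrite dx eD eqxx cardsU1 xD add1n cD !inE !eqxx.
pose D0 := slack @: [set~ i0].
have cD0 : c @: D0 = [set~ i0].
  apply/setP => i; rewrite !inE; apply/imsetP/idP.
    by case=> x /imsetP[l]; rewrite !inE => li -> ->; rewrite c_slack.
  by move=> ii; exists (slack i); rewrite ?c_slack // imset_f // !inE.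
rewrite (bigD1 D0) //= oddD fib ?cD0 //; last first.
  by rewrite /D0 card_imset.
rewrite (card_rooms_outer i0 y0s) // /= -dvdn2; apply: dvdn_sum => D DD0.
have [/andP[/eqP cD eD]|nD] := boolP ((#|D|.+1 == #|I|) && (c @: D == [set~ i0])); last first.
  rewrite big_pred0 // => -[B b]; rewrite !inE /=.
  apply/negP => /andP[/and4P[/eqP cB _ bB e] /eqP BD].
  case/negP: nD; rewrite -BD e andbT; by rewrite -cB (cardsD1 b B) bB.
rewrite fib // dvdn2.
have [->|[x1]] := set_0Vmem [set x | (x \notin D) && dominant (x |: D)].
  by rewrite cards0.
rewrite inE => /andP[_ /(dominantS (finset.subsetUr _ _)) dD].
(* A door made of slack points only is determined by its colors, hence equal to [D0], which is
   excluded here. *)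
have [/existsP[x0 /andP[x0D /forallP x0s]]|all_slack] :=
    boolP [exists x, (x \in D) && [forall l, x != slack l]].
  by rewrite (card_rooms_internal (x0 := x0)).
case/eqP: DD0.
have Ds x : x \in D -> x = slack (c x).
  move=> xD; move: all_slack => /existsPn/(_ x).
  rewrite xD => /forallPn[l]; rewrite negbK => /eqP ->.
  by rewrite c_slack.
rewrite /D0 -(eqP eD) -imset_comp; apply/setP => x; apply/idP/imsetP.
  by move=> xD; exists x => //; apply: Ds.
by case=> y yD ->; rewrite /= -Ds.
Qed.
End Scarf.

(* Scarf's lemma for the orders given by the coordinates, ties being broken by
   [enum_rank]: a dominant set of grid points has diameter at most [#|I|]. *)
Lemma scarf_grid (I : finType) (m : nat) (c : {ffun I -> 'I_m.+1} -> I) :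
  0 < #|I| ->
  exists x : {ffun I -> 'I_m.+1}, \sum_i x i = m /\
  forall i, x i <= #|I| \/ exists y : {ffun I -> 'I_m.+1},
    [/\ \sum_i y i = m, c y = i & forall j, x j <= y j + #|I| /\ y j <= x j + #|I|].
Proof.
move=> I0; have /card_gt0P[i0 _] := I0.
pose T : finType := {x : {ffun I -> 'I_m.+1} | \sum_i x i == m}.
pose gp (x : {ffun I -> 'I_m.+1}) (h : \sum_i x i == m) : T :=
  exist (fun x : {ffun I -> 'I_m.+1} => \sum_i x i == m) x h.
pose big := (m.+1 * #|T|)%N.
(* In the order [i], [slack i] comes first with rank 0, then all grid points, with ranks below
   [1 + big], then the other slack points. *)
pose r (i : I) (z : T + I) : nat := match z with
  | inl x => 1 + sval x i * #|T| + enum_rank x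
  | inr j => if j == i then 0 else 1 + big + enum_rank j end.
pose slack (i : I) : T + I := inr i.
pose cc (z : T + I) : I := match z with inl x => c (sval x) | inr i => i end.
have rT (i : I) (x : T) : 1 + sval x i * #|T| + enum_rank x < 1 + big.
  have ar a b t : a < m.+1 -> b < t -> 1 + a * t + b < 1 + m.+1 * t by nia.
  by apply: ar; apply: ltn_ord.
have rle a a' b b' t : b < t -> b' < t -> 1 + a * t + b <= 1 + a' * t + b' -> a <= a'.
  by nia.
have req a a' b b' t : b < t -> b' < t -> 1 + a * t + b = 1 + a' * t + b' -> b = b'.
  move=> bt bt' e; have aa : a = a'.
    by apply/eqP; rewrite eqn_leq (rle _ _ _ _ _ bt bt') ?e // (rle _ _ _ _ _ bt' bt) ?e.
  by move: e; rewrite aa; lia.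
have r_inj i : injective (r i).
  move=> [x|j] [y|k] //=.
  - move=> e; congr inl; apply: enum_rank_inj; apply: val_inj => /=.
    exact: req (ltn_ord _) (ltn_ord _) e.
  - case: ifP => _ e; first by move: e; rewrite add1n addSn.
    by have := rT i x; rewrite e ltnNge leq_addr.
  - case: ifP => _ e; first by move: e; rewrite add1n addSn.
    by have := rT i y; rewrite -e ltnNge leq_addr.
  - case: ifP => [/eqP ->|ji]; case: ifP => [/eqP -> //|ki]; try lia.
    move=> e; congr inr; apply: enum_rank_inj; apply: val_inj => /=; lia.
have slack_inj : injective slack by move=> i j [].
have slack_min i y : r i (slack i) <= r i y by rewrite /r /= eqxx.
have slack_max i j y : j != i -> (forall l, y != slack l) ->
    r i y < r i (slack j).
  case: y => [x|l] ji ny; last by have := ny l; rewrite /slack eqxx.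
  by rewrite /= (negPf ji); apply: leq_trans (rT i x) (leq_addr _ _).
have sum0 : \sum_i [ffun j => if j == i0 then ord_max else ord0 : 'I_m.+1] i == m.
  rewrite (bigD1 i0) //= ffunE eqxx big1 /= ?addn0 // => j /negPf ji.
  by rewrite ffunE ji.
pose y0 : T + I := inl (gp _ sum0).
have [|//|B [cB dB cBT]] := scarf r_inj slack_inj slack_min slack_max (c := cc) (fun=> erefl).
  by exists y0.
(* An order witnessing the dominance for a grid point lies in [C], since [slack i] is strictly below
   all grid points in the order [i]. *)
pose C := [set i | inr i \notin B].
have dom (y : T) : exists2 i, i \in C & forall x : T, inl x \in B -> sval y i <= sval x i.
  have [i Hi] := dominantP _ _ dB (inl y); exists i.
    by rewrite inE; apply/negP => /Hi; rewrite /= eqxx.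
  by move=> x /Hi; apply: rle; apply: ltn_ord.
have [xs xsB] : exists x : T, inl x \in B.
  have [i iC _] := dom (gp _ sum0).
  have : i \in [set cc z | z in B] by rewrite cBT.
  case/imsetP => -[x|j] zB; first by exists x.
  by move=> /= ij; move: iC; rewrite inE ij zB.
pose mn i : nat := sval [arg min_(x < xs | inl x \in B) sval x i] i.
have mnle i (x : T) : inl x \in B -> mn i <= sval x i.
  by rewrite /mn; case: arg_minnP => // z _; apply.
have mnE i : exists2 x : T, inl x \in B & mn i = sval x i.
  by rewrite /mn; case: arg_minnP => // z zB _; exists z.
(* Otherwise some grid point would exceed the minimum of [B] in all the coordinates of [C]; [rest]
   brings its coordinate sum up to [m]. *)
have sumC : m < \sum_(i in C) (mn i).+1.
  rewrite ltnNge; apply/negP => le.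
  have [i1 i1C _] := dom xs.
  pose rest := m - \sum_(i in C) (mn i).+1.
  pose yv i := (if i \in C then (mn i).+1 else 0) + (if i == i1 then rest else 0).
  have sy : \sum_i yv i = m.
    rewrite big_split /= -big_mkcond /= -big_mkcond /= big_pred1_eq /rest; lia.
  have yle i : yv i < m.+1 by rewrite -sy (bigD1 i) //= ltnS leq_addr.
  have yT : \sum_i [ffun i => Ordinal (yle i)] i == m.
    by rewrite -[X in _ == X]sy; apply/eqP; apply: eq_bigr => i _; rewrite ffunE.
  have [i iC Hi] := dom (gp _ yT); have [x xB e] := mnE i.
  by have := Hi _ xB; rewrite /= ffunE /= /yv iC e addSn ltnNge leq_addr.
have cC : #|C| <= #|I| := max_card _.
(* The coordinates of [x] sum to [m], which by [sumC] is less than the sum of the minima plus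
   [#|C|]. So little is left for the excess over the minima and for the coordinates outside [C]. *)
have sumx (x : T) : inl x \in B ->
    \sum_(i in C) (sval x i - mn i) + \sum_(i in ~: C) sval x i < #|I|.
  move=> xB; have := eqP (svalP x); rewrite (bigID (mem C)) /=.
  under [X in _ + X = _]eq_bigl => i do rewrite -finset.in_setC.
  have -> : \sum_(i in C) sval x i = \sum_(i in C) (sval x i - mn i) + \sum_(i in C) mn i.
    by rewrite -big_split /=; apply: eq_bigr => i _; rewrite subnK // mnle.
  move: sumC; under eq_bigr do rewrite -addn1.
  rewrite big_split /= sum1_card; move: cC.
  by move: #|C| #|I| (\sum_(i in C) (sval x i - mn i)) (\sum_(i in C) mn i) (\sum_(i in ~: C)
    _); lia.
have ar1 a b u v n : a - b + u + v < n -> a <= b + n by lia.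
have ar2 a u v n : u + (a + v) < n -> a <= n by lia.
have xC (x : T) i : inl x \in B -> i \in C -> sval x i <= mn i + #|I|.
  by move=> xB iC; have := sumx _ xB; rewrite (bigD1 i) //=; apply: ar1.
have xnC (x : T) i : inl x \in B -> i \notin C -> sval x i <= #|I|.
  by move=> xB iC; have := sumx _ xB; rewrite [X in _ + X](bigD1 i) ?finset.in_setC //=; apply: ar2.
exists (sval xs); split; first exact/eqP/(svalP xs).
move=> i; have [iC|iC] := boolP (i \in C); last by left; exact: xnC xsB iC.
right; have : i \in [set cc z | z in B] by rewrite cBT inE.
case/imsetP => -[x|j] zB /=; last by move=> ij; move: iC; rewrite inE ij zB.
move=> ->; exists (sval x); split=> //; first exact/eqP/(svalP x).
move=> j; have [jC|jC] := boolP (j \in C).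
  split; [apply: leq_trans (xC _ _ xsB jC) _|apply: leq_trans (xC _ _ zB jC) _];
    by rewrite leq_add2r mnle.
by split; apply: leq_trans (leq_addl _ _); apply: xnC.
Qed.

Local Open Scope classical_set_scope.
Local Open Scope ring_scope.

(** * Finite colorings, Brouwer's and Schauder's theorems *)

(** This is total boundedness, but no axiom of a distance is imposed on [d]: colorings can be pulled
    back along any map and added, and no space of functions has to be built. *)
Definition colorable (R : realType) (P : Type) (K : set P) (d : P -> P -> R) :=
  forall eps : R, 0 < eps -> exists (C : finType) (c : P -> C),
    forall x y, K x -> K y -> c x = c y -> d x y <= eps.

Section Colorable.
Context {R : realType} {P : Type} (K : set P).
Implicit Types d : P -> P -> R.

Lemma colorable_add d d' : colorable K d -> colorable K d' ->
  colorable K (fun x y => d x y + d' x y).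
Proof.
move=> cd cd' e e0; have e2 : 0 < e / 2 by rewrite divr_gt0.
have [C [c Hc]] := cd _ e2; have [C' [c' Hc']] := cd' _ e2.
exists (C * C')%type, (fun x => (c x, c' x)) => x y Kx Ky [ce ce'].
by rewrite (splitr e) lerD // ?Hc ?Hc'.
Qed.

Lemma colorable_sum (J : finType) (d : J -> P -> P -> R) :
  (forall j, colorable K (d j)) -> colorable K (fun x y => \sum_j d j x y).
Proof.
(* The successor keeps the divisor positive when [J] is empty. *)
move=> cd e e0; have J0 : 0 < (#|J|.+1)%:R :> R by rewrite ltr0n.
have e2 : 0 < e / #|J|.+1%:R by rewrite divr_gt0.
have /choice[Cc Hc] : forall j, exists Cc : {C : finType & P -> C},
    forall x y, K x -> K y -> projT2 Cc x = projT2 Cc y ->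
    d j x y <= e / #|J|.+1%:R.
  by move=> j; have [C [c H]] := cd j _ e2; exists (existT (fun C : finType => P -> C) C c).
exists {dffun forall j, projT1 (Cc j)}, (fun x => [ffun j => projT2 (Cc j) x]).
move=> x y Kx Ky /ffunP exy.
have le j : d j x y <= e / #|J|.+1%:R.
  by apply: Hc => //; have := exy j; rewrite !ffunE.
apply: (@le_trans _ _ (\sum_(j : J) e / #|J|.+1%:R)).
  by apply: ler_sum => j _; apply: le.
rewrite sumr_const -[_ *+ #|_|]mulr_natr mulrAC -mulrA ler_piMr // ltW //.
by rewrite ltr_pdivrMr // mul1r ltr_nat ltnS.
Qed.

Lemma colorable_le d d' : (forall x y, K x -> K y -> d x y <= d' x y) ->
  colorable K d' -> colorable K d.
Proof.
move=> le cd e e0; have [C [c Hc]] := cd _ e0; exists C, c => x y Kx Ky cxy.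
exact: le_trans (le _ _ Kx Ky) (Hc _ _ Kx Ky cxy).
Qed.

Lemma colorable_approx d : (forall e, 0 < e -> exists2 d', colorable K d' &
    forall x y, K x -> K y -> d x y <= d' x y + e) -> colorable K d.
Proof.
move=> H e e0; have e2 : 0 < e / 2 by rewrite divr_gt0.
have [d' cd' le] := H _ e2; have [C [c Hc]] := cd' _ e2.
exists C, c => x y Kx Ky cxy; rewrite (splitr e).
by apply: le_trans (le _ _ Kx Ky) _; rewrite lerD2r Hc.
Qed.

Lemma colorable_precompact (X : normedModType R) (F : P -> X) :
  precompact (F @` K) -> colorable K (fun x y => `|F x - F y|).
Proof.
rewrite precompactE compact_cover => cK e e0.
have e2 : 0 < e / 2 by rewrite divr_gt0.
have [||D0 _ KD] := cK X setT (fun z => ball z (e / 2)).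
- by move=> z _; apply: ball_open.
- by move=> z _; exists z => //; apply: ballxx.
pose D : seq X := finmap.enum_fset D0.
(* The color is the position of the first center whose ball contains [F x]. The extra index is the
   default of [find], never reached on [K]. *)
pose c x : 'I_(size D).+1 := inord (find (fun z => `[< ball z (e / 2) (F x) >]) D).
exists ('I_(size D).+1 : finType), c => x y Kx Ky cxy.
have hD u : K u -> has (fun z => `[< ball z (e / 2) (F u) >]) D.
  move=> Ku; have /KD[z zD zu] : closure (F @` K) (F u).
    by apply: subset_closure; exists u.
  by apply/hasP; exists z => //; apply/asboolP.
have cE u : c u = find (fun z => `[< ball z (e / 2) (F u) >]) D :> nat.
  by rewrite /c inordK // ltnS find_size.
have bz u : K u -> ball (nth 0 D (c u)) (e / 2) (F u).
  by move=> /hD/(nth_find 0)/asboolP; rewrite cE.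
have := bz _ Kx; have := bz _ Ky; rewrite cxy -ball_normE /= => h1 h2.
rewrite (splitr e) -(subrK (nth 0 D (c y)) (F x)) -addrA.
by apply: le_trans (ler_normD _ _) _; rewrite lerD // ltW // distrC.
Qed.
End Colorable.

Lemma colorable_comp (R : realType) (P Q : Type) (K : set P) (L : set Q)
    (f : P -> Q) (d : Q -> Q -> R) : (forall x, K x -> L (f x)) ->
  colorable L d -> colorable K (fun x y => d (f x) (f y)).
Proof.
move=> KL cd e e0; have [C [c Hc]] := cd _ e0; exists C, (c \o f) => x y Kx Ky.
by apply: Hc; apply: KL.
Qed.

Lemma colorable_bounded (R : realType) (P : Type) (K : set P) (F : P -> R)
    (M : R) : (forall x, K x -> `|F x| <= M) ->
  colorable K (fun x y => `|F x - F y|).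
Proof.
move=> FM; apply: (@colorable_precompact R P K R^o F).
rewrite precompactE; apply: (subclosed_compact _ (@segment_compact R (- M) M)).
  exact: closed_closure.
have Mcl : closed (`[- M, M]%classic : set R) by exact: itv_closed.
rewrite [X in _ `<=` X](proj1 (closure_id _) Mcl); apply: closureS.
by move=> _ [x Kx <-] /=; rewrite in_itv /= -ler_norml FM.
Qed.

(** An ultrafilter finer than the filter at infinity selects one color class at each scale, so a
    single diagonal choice replaces repeated extractions. [phi] is not claimed to be increasing;
    [k <= phi k] is enough for passing to limits. *)
Lemma cauchy_subseq (R : realType) (d : nat -> nat -> R) :
  colorable setT d -> exists phi : nat -> nat, (forall k, (k <= phi k)%N) /\
  forall e, 0 < e -> exists j, forall k l, (j <= k)%N -> (j <= l)%N ->
    d (phi k) (phi l) <= e.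
Proof.
move=> cd; have [U [UU sU]] := ultraFilterLemma (_ : ProperFilter \oo).
have PU : ProperFilter U by case: UU.
have /choice[A HA] : forall j : nat, exists A : set nat, U A /\
    forall k l, A k -> A l -> d k l <= j.+1%:R^-1.
  move=> j; have [|C [c Hc]] := cd j.+1%:R^-1; first by rewrite invr_gt0 ltr0n.
  suff [a Ua] : exists a, U [set n | c n = a].
    by exists [set n | c n = a]; split=> // k l /= <- e; apply: Hc.
  apply: contrapT => /forallNP nU.
  have : \forall n \near U, forall a, (~` [set n | c n = a]) n.
    apply: filter_forall => a.
    by have [/nU //|] := in_ultra_setVsetC [set n | c n = a] UU.
  by move=> /filter_ex[n /(_ (c n))]; apply.
have /choice[phi Hphi] : forall k, exists n, (k <= n)%N /\ forall j, (j <= k)%N -> A j n.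
  move=> k; have : U ([set n | (k <= n)%N] `&` [set n | forall j : 'I_k.+1, A j n]).
    apply: filterI; first by apply: sU; exists k.
    by apply: filter_forall => j; have [] := HA j.
  move=> /filter_ex[n [kn Hn]]; exists n; split=> // j jk.
  by have := Hn (Ordinal (jk : (j < k.+1)%N)).
exists phi; split=> [k|e e0]; first by have [] := Hphi k.
have [j je] : exists j : nat, j.+1%:R^-1 <= e.
  exists (Num.truncn e^-1); rewrite invf_ple ?posrE ?ltr0n //.
  by rewrite ltW // truncnS_gt.
exists j => k l jk jl; apply: le_trans je; have [_] := HA j; apply.
  by have [_] := Hphi k; apply.
by have [_] := Hphi l; apply.
Qed.

Lemma cauchy_convergent (R : realType) (X : completeNormedModType R)
    (u : nat -> X) :
  (forall e : R, 0 < e -> exists j, forall k l, (j <= k)%N -> (j <= l)%N ->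
     `|u k - u l| <= e) ->
  exists z : X, u k @[k --> \oo] --> z.
Proof.
move=> Hu; apply/cvg_ex; apply: cauchy_cvg; apply: cauchy_exP => e e0.
have e2 : 0 < e / 2 by rewrite divr_gt0.
have [j Hj] := Hu _ e2; exists (u j), j => // k jk.
by rewrite -ball_normE /=; apply: le_lt_trans (Hj _ _ (leqnn _) jk) _; lra.
Qed.

Lemma cvg_sumr (R : realType) (X : normedModType R) (T : Type) (I : finType)
    (F : set_system T) (FF : Filter F) (f : T -> I -> X) (l : I -> X) :
  (forall i, f t i @[t --> F] --> l i) ->
  \sum_i f t i @[t --> F] --> \sum_i l i.
Proof.
move=> fl; elim: (index_enum I) => [|i s IHs].
  by rewrite big_nil; under eq_fun do rewrite big_nil; apply: cvg_cst.
rewrite big_cons; under eq_fun do rewrite big_cons.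
by apply: cvgD; [exact: fl|exact: IHs].
Qed.

Lemma squeeze_norm (R : realType) (X : normedModType R) (T : Type)
    (F : set_system T) (FF : Filter F) (f : T -> X) (l : X) (b : T -> R) :
  (\forall t \near F, `|f t - l| <= b t) -> b t @[t --> F] --> (0 : R) ->
  f t @[t --> F] --> l.
Proof.
move=> fb b0; apply/cvgrPdist_lt => e e0; near=> t.
rewrite distrC; apply: (@le_lt_trans _ _ (b t)); first by near: t.
by near: t; apply: (cvgr_lt _ b0).
Unshelve. all: end_near. Qed.

Lemma norm_cvg_le (R : realType) (X : normedModType R) (T : Type)
    (F : set_system T) (FF : ProperFilter F) (u : T -> X) (z : X) (e : R) :
  u t @[t --> F] --> z -> (\forall t \near F, `|u t| <= e) -> `|z| <= e.
Proof.
move=> /cvg_norm uz ue.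
exact: (@cvgr_to_le _ _ _ _ _ _ _ uz ue).
Qed.

(** * Brouwer's theorem on a simplex *)

Definition simplex (R : realType) (I : finType) : set (I -> R) :=
  [set x | (forall i, 0 <= x i) /\ \sum_i x i = 1].

Lemma brouwer_approx (R : realType) (I : finType) (f : (I -> R) -> I -> R)
    (m : nat) : (0 < #|I|)%N -> (forall x, simplex x -> simplex (f x)) ->
  exists x, simplex x /\ forall i, exists y, [/\ simplex y,
    forall j, `|x j - y j| <= #|I|%:R / m.+1%:R &
    y i - #|I|%:R / m.+1%:R <= f y i].
Proof.
move=> I0 fS; have /card_gt0P[i0 _] := I0.
have m0 : 0 < m.+1%:R :> R by rewrite ltr0n.
pose pt (x : {ffun I -> 'I_m.+2}) (i : I) : R := (x i)%:R / m.+1%:R.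
have ptS (x : {ffun I -> 'I_m.+2}) : (\sum_i x i = m.+1)%N -> simplex (pt x).
  move=> sx; split=> [i|]; first by rewrite divr_ge0.
  by rewrite -mulr_suml -natr_sum sx divff // gt_eqF.
(* The coordinates of a point of the simplex and of its image have the same sum, so some coordinate
   does not decrease; it is taken as the color. *)
pose c (x : {ffun I -> 'I_m.+2}) := odflt i0 [pick i | pt x i <= f (pt x) i].
have cP (x : {ffun I -> 'I_m.+2}) : (\sum_i x i = m.+1)%N ->
    pt x (c x) <= f (pt x) (c x).
  move=> /ptS Sx; rewrite /c; case: pickP => //= no.
  have : \sum_i f (pt x) i < \sum_i pt x i.
    apply: ltr_sum => [|i _]; last by rewrite ltNge no.
    by apply/hasP; exists i0; rewrite ?mem_index_enum.
  by rewrite (proj2 (fS _ Sx)) (proj2 Sx) ltxx.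
have [x [sx Hx]] := scarf_grid (m := m.+1) c I0.
exists (pt x); split; first exact: ptS.
have nm : 0 <= #|I|%:R / m.+1%:R :> R by rewrite divr_ge0.
move=> i; have [xi|[y [sy cy Hy]]] := Hx i.
  (* A small coordinate is no obstacle: [pt x] is its own witness, since [f] takes nonnegative
     values. *)
  exists (pt x); split=> [|j|]; first exact: ptS.
    by rewrite subrr normr0.
  apply: le_trans (proj1 (fS _ (ptS _ sx)) i).
  by rewrite subr_le0 ler_pM2r ?invr_gt0 // ler_nat.
exists (pt y); split=> [|j|]; first exact: ptS.
  rewrite /pt -mulrBl normrM [X in _ * X]gtr0_norm ?invr_gt0 //.
  rewrite ler_pM2r ?invr_gt0 //; have [] := Hy j.
  by rewrite -!(ler_nat R) !natrD ler_norml => h1 h2; apply/andP; split; lra.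
by rewrite -cy; apply: le_trans (cP _ sy); rewrite gerBl.
Qed.

(** At a limit [z] of the approximate solutions no coordinate decreases under [f]. Since both sides
    sum to 1, all coordinates are equal. *)
Lemma brouwer (R : realType) (I : finType) (f : (I -> R) -> I -> R) :
  (0 < #|I|)%N -> (forall x, simplex x -> simplex (f x)) ->
  (forall (x : nat -> I -> R) z, (forall k, simplex (x k)) -> simplex z ->
     (forall i, x k i @[k --> \oo] --> z i) ->
     forall i, f (x k) i @[k --> \oo] --> f z i) ->
  exists2 z, simplex z & f z =1 z.
Proof.
move=> I0 fS fc.
have /choice[x Hx] := fun m => brouwer_approx m I0 fS.
have /choice[y Hy] : forall m, exists y : I -> I -> R, forall i, [/\ simplex (y i),
    forall j, `|x m j - y i j| <= #|I|%:R / m.+1%:R &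
    y i i - #|I|%:R / m.+1%:R <= f (y i) i].
  by move=> m; have [_ /choice[y Hy]] := Hx m; exists y.
have xS m : simplex (x m) by have [] := Hx m.
have cx : colorable setT (fun k l => \sum_j `|x k j - x l j|).
  apply: colorable_sum => j; apply: (@colorable_bounded _ _ _ _ 1) => k _.
  have [x0 <-] := xS k; rewrite ger0_norm //.
  by rewrite [leRHS](bigD1 j) //= lerDl sumr_ge0.
have [phi [phik Hphi]] := cauchy_subseq cx.
have /choice[z Hz] : forall j, exists zj : R, x (phi k) j @[k --> \oo] --> zj.
  move=> j; apply: (@cauchy_convergent R R^o) => e e0.
  have [n Hn] := Hphi _ e0; exists n => k l nk nl.
  by apply: le_trans (Hn _ _ nk nl); rewrite [leRHS](bigD1 j) //= lerDl sumr_ge0.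
have n0 : (#|I|%:R / (phi k).+1%:R : R) @[k --> \oo] --> (0 : R).
  rewrite -(mulr0 #|I|%:R); apply: cvgMr.
  apply: (@squeeze_cvgr _ _ _ _ (fun=> 0) (fun k => k.+1%:R^-1)).
  - near=> k; rewrite invr_ge0 ler0n /= lef_pV2 ?posrE ?ltr0n // ler_nat.
    exact: phik.
  - exact: cvg_cst.
  - exact: cvg_harmonic.
have Hyz i j : y (phi k) i j @[k --> \oo] --> z j.
  have -> : (fun k => y (phi k) i j) =
      (fun k => x (phi k) j - (x (phi k) j - y (phi k) i j)).
    by apply/funext => k; rewrite opprB addrC subrK.
  rewrite -[X in _ --> X]subr0; apply: cvgB; first exact: Hz.
  apply: (@squeeze_norm R R^o _ _ _ _ _ _ _ n0).
  by near=> k; rewrite subr0; have [_ -> _] := Hy (phi k) i.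
have zS : simplex z.
  split=> [i|].
    by apply: (ler_cvg_to (cvg_cst 0) (Hz i)); near=> k; have [] := xS (phi k).
  apply: (@cvg_unique _ _ (\sum_i x (phi k) i @[k --> \oo])) => //.
    exact: (@cvg_sumr R R^o).
  rewrite /= (_ : (fun k => _) = fun=> 1); first exact: cvg_cst.
  by apply/funext => k; apply: (proj2 (xS _)).
have le i : z i <= f z i.
  have yS k : simplex (y (phi k) i) by have [] := Hy (phi k) i.
  have := fc _ _ yS zS (Hyz i) i => fyz.
  apply: (ler_cvg_to _ fyz); last first.
    by near=> k; have [_ _ h] := Hy (phi k) i; apply: h.
  by rewrite -[X in _ --> X]subr0; apply: cvgB; [exact: Hyz|exact: n0].
exists z => // i; apply/eqP; rewrite -subr_eq0; apply/eqP.
apply: (@psumr_eq0P _ I predT (fun i => f z i - z i)) => //.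
  by move=> j _; rewrite subr_ge0.
by rewrite sumrB (proj2 (fS _ zS)) (proj2 zS) subrr.
Unshelve. all: end_near. Qed.

(** * Uniform convergence and Schauder's theorem *)

Definition unif_cvg (R : realType) (W : Type) (X : normedModType R) (D : set W)
    (x : nat -> W -> X) (z : W -> X) : Prop :=
  forall e : R, 0 < e -> exists j, forall k, (j <= k)%N ->
    forall t, D t -> `|x k t - z t| <= e.

Section UniformDistance.
Context {R : realType} {W : Type} {X : normedModType R} (D : set W).
Implicit Types x y z : W -> X.

(** For unbounded differences [sup] takes its default value 0; hence the bound assumed in
    [udist_ge]. *)
Definition udist x y : R := sup [set `|x t - y t| | t in D].

Lemma udist_ge x y (b : R) t : (forall t, D t -> `|x t - y t| <= b) ->
  D t -> `|x t - y t| <= udist x y.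
Proof.
move=> xyb Dt; apply: ub_le_sup; last by exists t.
by exists b => _ [u Du <-]; apply: xyb.
Qed.

Lemma udist_le x y (b : R) : 0 <= b -> (forall t, D t -> `|x t - y t| <= b) ->
  udist x y <= b.
Proof.
move=> b0 xyb; have [D0|/set0P D0] := eqVneq D set0.
  by rewrite /udist D0 image_set0 sup0.
apply: ge_sup; first by have [t Dt] := D0; exists `|x t - y t|, t.
by move=> _ [u Du <-]; apply: xyb.
Qed.

Lemma udist_ge0 x y : 0 <= udist x y.
Proof.
rewrite /udist; set A := image _ _; have [sA|nA] := pselect (has_sup A).
  have [[a Aa] ubA] := sA; apply: le_trans (ub_le_sup ubA Aa).
  by case: Aa => t _ <-.
by rewrite sup_out.
Qed.

Lemma udist_shift x y z (b e : R) : 0 <= e ->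
  (forall t, D t -> `|x t - z t| <= b) ->
  (forall t, D t -> `|y t - x t| <= e) -> udist y z <= udist x z + e.
Proof.
move=> e0 xzb yxe; apply: udist_le => [|t Dt]; first by rewrite addr_ge0 ?udist_ge0.
rewrite -(subrK (x t) (y t)) -addrA addrC.
by apply: le_trans (ler_normD _ _) _; rewrite lerD ?yxe // (udist_ge xzb).
Qed.
End UniformDistance.

Section Schauder.
Context {R : realType} {W : Type} {X : completeNormedModType R} (D : set W).
Variables (K : set (W -> X)) (G : (W -> X) -> W -> X) (r : R).
Hypothesis K_neq0 : K !=set0.
Hypothesis K_bounded : forall x, K x -> forall t, D t -> `|x t| <= r.
Hypothesis K_convex : forall (I : finType) (a : I -> R) (v : I -> W -> X),
  simplex a -> (forall i, K (v i)) -> K (fun t => \sum_i a i *: v i t).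
Hypothesis K_closed : forall x z, (forall k, K (x k)) -> unif_cvg D x z ->
  exists2 z', K z' & forall t, D t -> z' t = z t.
Hypothesis GK : forall x, K x -> K (G x).
Hypothesis G_continuous : forall x z, (forall k, K (x k)) -> K z ->
  unif_cvg D x z -> unif_cvg D (fun k => G (x k)) (G z).
Hypothesis G_compact : colorable K (fun x y => udist D (G x) (G y)).

Let K_diff x y : K x -> K y -> forall t, D t -> `|x t - y t| <= r + r.
Proof.
move=> Kx Ky t Dt; apply: le_trans (ler_normB _ _) _.
by rewrite lerD ?K_bounded.
Qed.

(** Schauder's projection, solved on the coefficients: a tuple [l] of the simplex is sent to the
    normalized weights measuring how close [G (comb l)] is to each [v a]. At a fixed tuple, [comb l]
    is an average of points [v a] within [e] of [G (comb l)]. *)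
Lemma schauder_approx (e : R) : 0 < e ->
  exists2 x, K x & forall t, D t -> `|G x t - x t| <= e.
Proof.
move=> e0; have [C [c Hc]] := G_compact (divr_gt0 e0 (ltr0n R 2)).
(* Only the colors that occur on [K] are kept, so that each has a representative. *)
pose I : finType := {a : C | `[< exists2 x, K x & c x = a >]}.
have /choice[v Hv] (a : I) : exists y, K y /\
    forall x, K x -> c x = sval a -> udist D (G x) y <= e / 2.
  case: a => a /= /asboolP[y Ky cy]; exists (G y); split; first exact: GK.
  by move=> x Kx cx; apply: Hc; rewrite // cx.
have vK a : K (v a) by have [] := Hv a.
have colI x : K x -> exists a : I, c x = sval a.
  move=> Kx; have h : `[< exists2 y, K y & c y = c x >] by apply/asboolP; exists x.
  by exists (exist (fun a => `[< exists2 y, K y & c y = a >]) _ h).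
pose comb (l : I -> R) : W -> X := fun t => \sum_a l a *: v a t.
have combK l : simplex l -> K (comb l) by move=> Sl; apply: K_convex.
(* Twice the positive part of [e - udist D (G x) (v a)]. *)
pose w (x : W -> X) a : R :=
  (e - udist D (G x) (v a)) + `|e - udist D (G x) (v a)|.
have w0 x a : 0 <= w x a by rewrite /w addrC -lerBlDr sub0r -normrN ler_norm.
have sw x : K x -> 0 < \sum_a w x a.
  move=> Kx; have [a ca] := colI _ Kx; have [_ /(_ _ Kx ca) le] := Hv a.
  rewrite (bigD1 a) //= ltr_pwDl ?sumr_ge0 //.
  by rewrite /w ltr_pwDl // subr_gt0 (le_lt_trans le) // gtr_pMr // invf_lt1 // ltr1n.
pose f l a := w (comb l) a / \sum_b w (comb l) b.
have fS l : simplex l -> simplex (f l).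
  move=> /combK/sw s0; split=> [a|]; first by rewrite divr_ge0 // ltW.
  by rewrite /f -mulr_suml divff // gt_eqF.
have I0 : (0 < #|I|)%N.
  by have [x /colI[a _]] := K_neq0; apply/card_gt0P; exists a.
have fc (l : nat -> I -> R) z : (forall k, simplex (l k)) -> simplex z ->
    (forall i, l k i @[k --> \oo] --> z i) ->
    forall i, f (l k) i @[k --> \oo] --> f z i.
  move=> lS zS lz.
  have cl : unif_cvg D (fun k => comb (l k)) (comb z).
    have : (\sum_a `|l k a - z a|) * r @[k --> \oo] --> (0 : R).
      rewrite -[X in _ --> X](mul0r r); apply: cvgMl.
      have : \sum_a `|l k a - z a| @[k --> \oo] --> \sum_(a : I) (0 : R).
        apply: (@cvg_sumr R R^o) => a; rewrite -(@normr0 R R^o) -(subrr (z a)).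
        by apply: cvg_norm; apply: cvgB; [exact: lz|exact: cvg_cst].
      by rewrite big1.
    move=> s0 eps eps0; have [j _ Hj] := cvgr_lt _ s0 _ eps0.
    exists j => k jk t Dt; apply: le_trans (ltW (Hj _ jk)).
    rewrite /comb -sumrB mulr_suml; apply: le_trans (ler_norm_sum _ _ _) _.
    apply: ler_sum => a _; rewrite -scalerBl normrZ ler_wpM2l //.
    exact: K_bounded.
  have Gl := G_continuous (fun k => combK _ (lS k)) (combK _ zS) cl.
  have dl a : udist D (G (comb (l k))) (v a) @[k --> \oo] -->
      udist D (G (comb z)) (v a).
    apply/cvgrPdist_le => eps eps0; have [j Hj] := Gl _ eps0; exists j => // k jk.
    have Kl := GK (combK _ (lS k)); have Kz := GK (combK _ zS).
    rewrite ler_norml; apply/andP; split.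
      rewrite lerNl opprB lerBlDl.
      exact: udist_shift (ltW eps0) (K_diff Kz (vK a)) (Hj _ jk).
    rewrite lerBlDl; apply: udist_shift (ltW eps0) (K_diff Kl (vK a)) _ => t Dt.
    by rewrite distrC; apply: Hj.
  have wl a : w (comb (l k)) a @[k --> \oo] --> w (comb z) a.
    have ed : e - udist D (G (comb (l k))) (v a) @[k --> \oo] -->
        e - udist D (G (comb z)) (v a) by apply: cvgB; [exact: cvg_cst|exact: dl].
    by apply: cvgD => //; apply: (@cvg_norm _ R^o).
  move=> i; apply: cvgM; first exact: wl.
  apply: cvgV; first by rewrite gt_eqF //; apply/sw/combK.
  exact: (@cvg_sumr R R^o).
have [l Sl fl] := brouwer I0 fS fc.
have Kl := combK _ Sl; exists (comb l) => // t Dt.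
have -> : G (comb l) t = \sum_a l a *: G (comb l) t.
  by rewrite -scaler_suml (proj2 Sl) scale1r.
rewrite /comb -sumrB; apply: le_trans (ler_norm_sum _ _ _) _.
rewrite -[e]mul1r -(proj2 Sl) mulr_suml; apply: ler_sum => a _.
rewrite -/(comb l) -scalerBr normrZ ger0_norm ?(proj1 Sl) //.
have [->|la] := eqVneq (l a) 0; first by rewrite !mul0r.
apply: ler_wpM2l; first exact: (proj1 Sl).
apply: le_trans (udist_ge (K_diff (GK Kl) (vK a)) Dt) _.
(* [l a] is proportional to this weight, which vanishes as soon as the distance from [G (comb l)] to
   [v a] reaches [e]. *)
have : w (comb l) a != 0 by apply: contraNneq la => wa; rewrite -fl /f wa mul0r.
rewrite /w; have [|lt0] := leP 0 (e - udist D (G (comb l)) (v a)).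
  by rewrite subr_ge0.
by rewrite ltr0_norm // subrr eqxx.
Qed.

(** The images of approximate fixed points have a uniformly Cauchy subsequence, and the points
    themselves follow it. Values are controlled on [D] only, so the limit is replaced by the member
    [z'] of [K] that agrees with it there. *)
Theorem schauder : exists2 z, K z & forall t, D t -> G z t = z t.
Proof.
have /choice[x Hx] : forall k : nat, exists x, K x /\
    forall t, D t -> `|G x t - x t| <= k.+1%:R^-1.
  move=> k; have [|x Kx Hx] := @schauder_approx k.+1%:R^-1; last by exists x.
  by rewrite invr_gt0 ltr0n.
have xK k : K (x k) by have [] := Hx k.
have cx : colorable setT (fun k l => udist D (G (x k)) (G (x l))).
  exact: (colorable_comp _ G_compact).
have [phi [phik Hphi]] := cauchy_subseq cx.
have /choice[z Hz] t : exists zt : X, D t -> G (x (phi k)) t @[k --> \oo] --> zt.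
  have [Dt|nDt] := pselect (D t); last by exists 0.
  have [|zt] := @cauchy_convergent R X (fun k => G (x (phi k)) t); last by exists zt.
  move=> e e0; have [j Hj] := Hphi _ e0; exists j => k l jk jl.
  by apply: le_trans (Hj _ _ jk jl); apply: udist_ge Dt; apply: K_diff; apply: GK.
have uz : unif_cvg D (fun k => G (x (phi k))) z.
  move=> e e0; have [j Hj] := Hphi _ e0; exists j => k jk t Dt.
  apply: (@norm_cvg_le _ _ _ \oo _ (fun l => G (x (phi k)) t - G (x (phi l)) t)).
    by apply: cvgB; [exact: cvg_cst|exact: Hz].
  exists j => // l jl; apply: le_trans (Hj _ _ jk jl).
  by apply: udist_ge Dt; apply: K_diff; apply: GK.
have [z' Kz' zz'] := K_closed (fun k => GK (xK (phi k))) uz.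
have xz : unif_cvg D (fun k => x (phi k)) z'.
  move=> e e0; have e2 : 0 < e / 2 by rewrite divr_gt0.
  have [j Hj] := uz _ e2; have [n ne] : exists n : nat, n.+1%:R^-1 <= e / 2.
    exists (Num.truncn (e / 2)^-1); rewrite invf_ple ?posrE ?ltr0n //.
    by rewrite ltW // truncnS_gt.
  exists (maxn j n) => k; rewrite geq_max => /andP[jk nk] t Dt.
  rewrite zz' // (splitr e) -(subrK (G (x (phi k)) t) (x (phi k) t)) -addrA.
  apply: le_trans (ler_normD _ _) _; rewrite lerD ?Hj // distrC.
  have [_ h] := Hx (phi k); apply: le_trans (h _ Dt) (le_trans _ ne).
  by rewrite lef_pV2 ?posrE ?ltr0n // ler_nat ltnS (leq_trans nk).
have Gz := G_continuous (fun k => xK (phi k)) Kz' xz.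
exists z' => // t Dt; rewrite zz' //.
apply: (@cvg_unique _ _ (G (x (phi k)) t @[k --> \oo])) => //; last exact: Hz.
apply/cvgrPdist_le => e e0; have [j Hj] := Gz _ e0; exists j => // k jk.
by rewrite distrC; apply: Hj.
Qed.
End Schauder.

Import HBNNSimple.

(** * Almost everywhere statements and strong measurability *)

Definition ae_on (R : realType) (T : Type) (D : set R) (F G : R -> T) : Prop :=
  {ae leb, forall t : R, D t -> F t = G t}.

Section AlmostEverywhere.
Context d {T : measurableType d} {R : realType} (mu : {measure set T -> \bar R}).
Implicit Types P Q : T -> Prop.

Lemma ae_mono P Q : {ae mu, forall t, P t} -> (forall t, P t -> Q t) ->
  {ae mu, forall t, Q t}.
Proof. by move=> + PQ; apply: negligibleS; apply: subsetC => t; apply: PQ. Qed.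

Lemma ae_and P Q : {ae mu, forall t, P t} -> {ae mu, forall t, Q t} ->
  {ae mu, forall t, P t /\ Q t}.
Proof.
move=> aP aQ; apply: negligibleS (negligibleU aP aQ) => t /= nPQ.
by apply: contrapT => /not_orP[/contrapT ? /contrapT ?]; apply: nPQ.
Qed.

Lemma ae_all (P : nat -> T -> Prop) : (forall n, {ae mu, forall t, P n t}) ->
  {ae mu, forall t, forall n, P n t}.
Proof.
move=> aP; apply: negligibleS (negligible_bigcup aP) => t /= /existsNP[n nP].
by exists n.
Qed.

Lemma ae_true P : (forall t, P t) -> {ae mu, forall t, P t}.
Proof.
by move=> PT; apply: negligibleS (negligible_set0 mu) => t /= /(_ (PT t)).
Qed.

Local Open Scope ereal_scope.

(* No measurability is required here: the integral of a nonnegative function is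
   the supremum of the integrals of the simple functions below it. *)
Lemma le_integral_ae (D : set T) (f g : T -> \bar R) :
  (forall t, D t -> 0 <= f t) -> (forall t, D t -> 0 <= g t) ->
  {ae mu, forall t, D t -> f t <= g t} ->
  \int[mu]_(t in D) f t <= \int[mu]_(t in D) g t.
Proof.
move=> f0 g0 [N [mN N0 fgN]].
rewrite !ge0_integralE //; apply: ge_ereal_sup => _ [h /= hf <-].
have mNC : measurable (~` N) by exact: measurableC.
(* Cancelling [h] on the exceptional set keeps its integral and puts it below [g] everywhere. *)
pose h' := mul_nnsfun h (indic_nnsfun R mNC).
have le1 : sintegral mu h <= sintegral mu h'.
  rewrite -!integralT_nnsfun le_eqVlt; apply/orP; left; apply/eqP.
  apply: ge0_ae_eq_integral => //.
  - exact/measurable_EFinP.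
  - exact/measurable_EFinP.
  - by move=> t _; rewrite lee_fin.
  - by move=> t _; rewrite lee_fin.
  exists N; split=> // t /= /not_implyP[_ ht]; apply: contrapT => Nt; apply: ht.
  by rewrite /h' /= /mindic indicE mem_set ?mulr1.
apply: (le_trans le1); apply: ereal_sup_ubound; exists h' => //= t.
rewrite /h' /= /mindic indicE.
have g'0 : 0 <= (g \_ D) t by rewrite patchE; case: ifPn => // /set_mem; apply: g0.
have [Nt|Nt] := pselect (N t).
  by rewrite memNset ?mulr0 // => /(_ Nt).
rewrite mem_set // mulr1; apply: (le_trans (hf t)).
rewrite !patchE; case: ifPn => // /set_mem Dt.
by apply: contrapT => fg; apply: Nt; apply: fgN => /= /(_ Dt).
Qed.

Lemma eq_integral_ae (D : set T) (f g : T -> \bar R) :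
  (forall t, D t -> 0 <= f t) -> (forall t, D t -> 0 <= g t) ->
  {ae mu, forall t, D t -> f t = g t} ->
  \int[mu]_(t in D) f t = \int[mu]_(t in D) g t.
Proof.
move=> f0 g0 fg; apply/eqP; rewrite eq_le; apply/andP.
by split; apply: le_integral_ae => //; apply: (ae_mono fg) => t h /h ->.
Qed.
End AlmostEverywhere.

Lemma ae_neq (R : realType) (a : R) : {ae leb, forall t : R, t != a}.
Proof.
exists [set a]; split; [exact: measurable_set1|exact: lebesgue_measure_set1|].
by move=> t /= /negP; rewrite negbK => /eqP.
Qed.

(** * Measurability of vector functions through distances *)

Section NormMeasurable.
Context {R : realType} {V : normedModType R}.
Implicit Types F G : R -> V.

(* Borel measurability of a function with separable range, expressed through
   real-valued functions. *)
Definition nmeasurable F : Prop :=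
  forall y, measurable_fun setT (fun t => `|F t - y|).

Lemma measurable_simple_param (T : Type) (s : R -> T) (Phi : T -> R -> R) :
  finite_set (range s) -> (forall v, measurable (s @^-1` [set v])) ->
  (forall v, measurable_fun setT (Phi v)) ->
  measurable_fun setT (fun t => Phi (s t) t).
Proof.
move=> fs ms mPhi _ Y mY; rewrite setTI.
have -> : (fun t => Phi (s t) t) @^-1` Y =
    \bigcup_(v in range s) (s @^-1` [set v] `&` Phi v @^-1` Y).
  apply/seteqP; split=> t /=; first by move=> Yt; exists (s t).
  by case=> v _ [/= <-].
apply: fin_bigcup_measurable => // v _; apply: measurableI => //.
by rewrite -[X in measurable X]setTI; apply: mPhi.
Qed.

Lemma measurable_simple_comp (s : R -> V) (psi : V -> R) : simple s ->
  measurable_fun setT (fun t => psi (s t)).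
Proof.
by move=> [fs ms]; apply: (measurable_simple_param (Phi := fun v _ => psi v)).
Qed.

Lemma simple_nmeasurable s : simple s -> nmeasurable s.
Proof. by move=> ss y; apply: (measurable_simple_comp (fun v => `|v - y|)). Qed.

Lemma nmeasurable_cvg (F_ : nat -> R -> V) F :
  (forall n, nmeasurable (F_ n)) -> (forall t, F_ n t @[n --> \oo] --> F t) ->
  nmeasurable F.
Proof.
move=> mF FF y; apply: (@measurable_fun_cvg _ _ _ _ (fun n t => `|F_ n t - y|)).
  by move=> n; apply: mF.
by move=> t _; apply: cvg_norm; apply: cvgB; [exact: FF|exact: cvg_cst].
Qed.

Lemma nmeasurable_if (D : set R) F G : measurable D -> nmeasurable F ->
  nmeasurable G -> nmeasurable (fun t => if t \in D then F t else G t).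
Proof.
move=> mD mF mG y.
have -> : (fun t => `|(if t \in D then F t else G t) - y|) =
    (fun t => if t \in D then `|F t - y| else `|G t - y|).
  by apply/funext => t; case: ifP.
apply: measurable_fun_ifT; [|exact: mF|exact: mG].
apply: (measurable_fun_bool true); rewrite setTI.
rewrite (_ : _ @^-1` _ = D) //; apply/seteqP; split=> t /=.
  by move=> /set_mem.
by move=> Dt; rewrite mem_set.
Qed.

Hypothesis sepV : separable V.

(** The sequence starts with 0 so that the approximants of [nmeasurable_approx] are never farther
    from [F t] than 0; this is the domination required for the integrals. *)
Lemma dense_seq : exists2 x : nat -> V, x 0%N = 0 &
  forall v (e : R), 0 < e -> exists k, `|v - x k| < e.
Proof.
have [A cA dA] := sepV; have [g Ag] : exists g : nat -> V, A `<=` range g.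
  have [A0|A0] := pselect (A !=set0).
    have /countable_injP[f inj] := cA.
    exists (fun n => xget 0 [set v | A v /\ f v = n]) => v Av.
    exists (f v) => //; case: xgetP => [w _ [Aw fw]|/(_ v)]; last by case.
    by apply: inj; rewrite ?mem_set.
  by exists (fun=> 0) => v Av; case: A0; exists v.
exists (fun n => if n is n'.+1 then g n' else 0) => // v e e0.
have [|w [vw Aw]] := dA (ball v e) _ (ball_open v e).
  by exists v; apply: ballxx.
have [n _ nw] := Ag _ Aw; exists n.+1; rewrite nw.
by move: vw; rewrite -ball_normE.
Qed.

(** [s n t] is the point nearest to [F t] among the first terms of the dense sequence, ties going to
    the smallest index. Only distances are compared, and these are measurable by assumption. *)
Lemma nmeasurable_approx F : nmeasurable F ->
  exists s : nat -> R -> V, [/\ forall n, simple (s n),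
    forall t, s n t @[n --> \oo] --> F t &
    forall n t, `|F t - s n t| <= `|F t| ].
Proof.
move=> mF; have [x x0 Hx] := dense_seq.
pose s := fix s n t : V := if n is n'.+1 then
  if `|F t - x n| < `|F t - s n' t| then x n else s n' t else 0.
have mFs n : measurable_fun setT (fun t => `|F t - s n t|).
  elim: n => [|n IHn]; first exact: mF.
  have -> : (fun t => `|F t - s n.+1 t|) = (fun t =>
      if `|F t - x n.+1| < `|F t - s n t| then `|F t - x n.+1| else `|F t - s n t|).
    by apply/funext => t /=; case: ifP.
  by apply: measurable_fun_ifT => //; apply: measurable_fun_ltr.
have sle n t k : (k <= n)%N -> `|F t - s n t| <= `|F t - x k|.
  elim: n => [|n IHn]; first by rewrite leqn0 => /eqP ->; rewrite x0.
  rewrite leq_eqVlt => /orP[/eqP ->|/IHn le] /=; case: ltP => // lt.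
  by apply: le_trans le; apply: ltW.
exists s; split.
- elim=> [|n [fs ms]].
    split; first by apply: (sub_finite_set (B := [set 0])) => // _ [t _ <-].
    move=> v; have [->|v0] := eqVneq v 0.
      by rewrite (_ : _ @^-1` _ = setT) //; apply/seteqP; split.
    rewrite (_ : _ @^-1` _ = set0) //; apply/seteqP; split=> // t /= v00.
    by rewrite v00 eqxx in v0.
  split.
    apply: (sub_finite_set (B := range (s n) `|` [set x n.+1])).
      by move=> _ [t _ <-] /=; case: ifP => _; [right|left; exists t].
    by rewrite finite_setU; split.
  move=> v; pose A := [set t | `|F t - x n.+1| < `|F t - s n t|].
  have mA : measurable A.
    rewrite (_ : A = setT `&` (fun t => `|F t - x n.+1| < `|F t - s n t|) @^-1` [set true]).
      by apply: measurable_fun_ltr => //.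
    by rewrite setTI.
  rewrite (_ : _ @^-1` _ = (A `&` [set _ | x n.+1 = v]) `|` (~` A `&` s n @^-1` [set v])).
    apply: measurableU; apply: measurableI => //; last exact: measurableC.
    have [e|ne] := pselect (x n.+1 = v).
      by rewrite (_ : [set _ | _] = setT) //; apply/seteqP; split.
    by rewrite (_ : [set _ | _] = set0) //; apply/seteqP; split.
  apply/seteqP; split=> t /=; rewrite /A /=.
    by case: ifPn => [lt xv|/negP nlt sv]; [left|right].
  by case=> [[-> ->]|[/negP/negPf -> ->]].
- move=> t; apply/cvgrPdist_lt => e e0; have [k Hk] := Hx (F t) e e0.
  by exists k => // n kn; apply: le_lt_trans Hk; apply: sle.
- by move=> n t; have := sle n t 0%N (leq0n _); rewrite x0 subr0.
Qed.

(** Composition with a Carathéodory function: it is clear for simple [F], and continuity in the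
    first argument allows the passage to the limit. *)
Lemma measurable_param (F : R -> V) (Phi : V -> R -> R) : nmeasurable F ->
  (forall v, measurable_fun setT (Phi v)) ->
  (forall t, continuous (Phi ^~ t)) ->
  measurable_fun setT (fun t => Phi (F t) t).
Proof.
move=> /nmeasurable_approx[s [ss sF _]] mPhi cPhi.
apply: (@measurable_fun_cvg _ _ _ _ (fun n t => Phi (s n t) t)).
  by move=> n; have [fs ms] := ss n; apply: measurable_simple_param.
by move=> t _; exact: (cvg_comp _ _ (sF t) (cPhi t (F t))).
Qed.

(** The distance from a sum to [y] is not a function of the distances of the two terms. It is a
    Carathéodory function of the value of [F], with [G] hidden in the dependence on [t]. *)
Lemma nmeasurableD F G : nmeasurable F -> nmeasurable G ->
  nmeasurable (fun t => F t + G t).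
Proof.
move=> mF mG y; apply: (measurable_param (Phi := fun v t => `|v + G t - y|)) => //.
  move=> v; have -> : (fun t => `|v + G t - y|) = (fun t => `|G t - (y - v)|).
    by apply/funext => t; rewrite opprB addrA (addrC v).
  exact: mG.
move=> t v; apply: cvg_norm; apply: cvgB; last exact: cvg_cst.
by apply: cvgD; [exact: cvg_id|exact: cvg_cst].
Qed.
End NormMeasurable.

(** * Bounded linear maps *)

Section BoundedLinear.
Context {R : realType} {V W : normedModType R}.
Variables (L : V -> W) (bL : bounded_linear L).

Lemma blin_D x y : L (x + y) = L x + L y.
Proof. by have [lin _] := bL; rewrite -{1}[x]scale1r lin scale1r. Qed.

Lemma blin_0 : L 0 = 0.
Proof. by apply: (addrI (L 0)); rewrite -blin_D !addr0. Qed.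

Lemma blin_Z a x : L (a *: x) = a *: L x.
Proof. by have [lin _] := bL; rewrite -[a *: x]addr0 lin blin_0 addr0. Qed.

Lemma blin_B x y : L (x - y) = L x - L y.
Proof. by rewrite blin_D -scaleN1r blin_Z scaleN1r. Qed.

Lemma blin_has_sup : has_sup [set `|L x| | x in [set x : V | `|x| <= 1]].
Proof.
split; first by exists `|L 0|, 0 => //=; rewrite normr0.
have [_ [k Hk]] := bL; exists `|k| => _ [x /= x1 <-].
apply: le_trans (Hk x) _; apply: le_trans (ler_norm _) _.
by rewrite normrM normr_id ler_piMr.
Qed.

Lemma opnorm_ge0 : 0 <= opnorm L.
Proof.
apply: le_trans (normr_ge0 (L 0)) _; apply: ub_le_sup; first by case: blin_has_sup.
by exists 0 => //=; rewrite normr0.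
Qed.

Lemma opnorm_le x : `|L x| <= opnorm L * `|x|.
Proof.
have [->|x0] := eqVneq x 0; first by rewrite blin_0 !normr0 mulr0.
have nx : 0 < `|x| by rewrite normr_gt0.
rewrite -ler_pdivrMr // mulrC.
have -> : `|x|^-1 * `|L x| = `|L (`|x|^-1 *: x)|.
  by rewrite blin_Z normrZ ger0_norm ?invr_ge0.
apply: ub_le_sup; first by case: blin_has_sup.
exists (`|x|^-1 *: x) => //=.
by rewrite normrZ ger0_norm ?invr_ge0 // mulVf // gt_eqF.
Qed.

Lemma opnorm_leW k x : opnorm L <= k -> `|L x| <= k * `|x|.
Proof. by move=> Lk; apply: le_trans (opnorm_le x) _; rewrite ler_wpM2r. Qed.

Lemma blin_continuous : continuous L.
Proof.
move=> x; apply: (@squeeze_norm _ _ _ _ _ _ _ (fun y => opnorm L * `|y - x|)).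
  by apply: nearW => y; rewrite -blin_B opnorm_le.
rewrite -(mulr0 (opnorm L)); apply: cvgMr; rewrite -(@normr0 _ V) -(subrr x).
by apply: cvg_norm; apply: cvgB; [exact: cvg_id|exact: cvg_cst].
Qed.
End BoundedLinear.

Section Dual.
Context {R : realType} {V : normedModType R} (l : V -> R^o) (dl : dual l).

Lemma dual0 : l 0 = 0. Proof. exact: (blin_0 dl). Qed.
Lemma dualD x y : l (x + y) = l x + l y. Proof. exact: (blin_D dl). Qed.
Lemma dualB x y : l (x - y) = l x - l y. Proof. exact: (blin_B dl). Qed.
Lemma dualZ a x : l (a *: x) = a * l x. Proof. exact: (blin_Z dl). Qed.
Lemma dual_le x : `|l x| <= opnorm l * `|x|. Proof. exact: (opnorm_le dl). Qed.
End Dual.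

Section SimpleIntegral.
Context {R : realType} {V : normedModType R}.
Variables (a b : R).
Notation D := (`[a, b]%classic : set R).

Lemma itv_measure_lty : (leb D < +oo)%E.
Proof. by rewrite lebesgue_measure_itv /=; case: ifP => _; rewrite ltry. Qed.

Lemma integrable_bounded (f : R -> R) (M : R) : measurable_fun setT f ->
  (forall t, D t -> `|f t| <= M) -> leb.-integrable D (EFin \o f).
Proof.
move=> mf fM; apply: measurable_bounded_integrable => //.
- exact: itv_measure_lty.
- exact: measurable_funS mf.
exists M; split; first by rewrite num_real.
by move=> x Mx t Dt; apply: le_trans (ltW Mx); apply: fM.
Qed.

Lemma simple_bounded (s : R -> V) (psi : V -> R) : simple s ->
  exists M : R, forall t, `|psi (s t)| <= M.
Proof.
move=> [fs _]; exists (\sum_(v <- fset_set (range s)) `|psi v|) => t.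
rewrite (big_fsetD1 (s t)) /=; first by rewrite lerDl sumr_ge0.
by rewrite in_fset_set // mem_set //; exists t.
Qed.

Lemma integrable_simple (s : R -> V) (psi : V -> R) : simple s ->
  leb.-integrable D (EFin \o (fun t => psi (s t))).
Proof.
move=> ss; have [M HM] := simple_bounded psi ss.
by apply: (integrable_bounded (M := M)) => //; apply: measurable_simple_comp.
Qed.

Lemma Rintegral_sum (J : eqType) (r : seq J) (f : J -> R -> R) :
  (forall j, leb.-integrable D (EFin \o f j)) ->
  \int[leb]_(t in D) (\sum_(j <- r) f j t) = \sum_(j <- r) \int[leb]_(t in D) f j t.
Proof.
move=> fi; elim: r => [|j r IH].
  rewrite big_nil; under eq_Rintegral do rewrite big_nil.
  by rewrite Rintegral_cst // mul0r.
rewrite big_cons -IH; under eq_Rintegral do rewrite big_cons.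
apply: RintegralD => //; have := @integrable_sum _ _ _ leb D (measurable_itv _) J r predT
  (fun j => EFin \o f j) (fun j _ => fi j).
by apply: eq_integrable => // t _ /=; rewrite sumEFin.
Qed.

Lemma dual_simple_integral (s : R -> V) (l : V -> R^o) : simple s -> dual l ->
  l (simple_integral a b s) = \int[leb]_(t in D) l (s t).
Proof.
move=> ss dl; have [fs ms] := ss.
have -> : (\int[leb]_(t in D) (l (s t) : R)) =
    \int[leb]_(t in D) (\sum_(v <- fset_set (range s)) l v * \1_(s @^-1` [set v]) t).
  apply: eq_Rintegral => t _; rewrite (big_fsetD1 (s t)) /=; last first.
    by rewrite in_fset_set // mem_set //; exists t.
  rewrite indicE mem_set // mulr1 big1_fset ?addr0 // => v.
  rewrite !inE => /andP[vs _] _; rewrite indicE memNset ?mulr0 //= => e.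
  by move/eqP: vs; rewrite e.
have ii v : leb.-integrable D (EFin \o (\1_(s @^-1` [set v]) : R -> R)).
  apply: (integrable_bounded (M := 1)); first exact: measurable_indic.
  by move=> t _; rewrite indicE; case: (_ \in _); rewrite ?normr1 ?normr0.
rewrite Rintegral_sum; last first.
  move=> v; have := @integrableZl _ _ _ leb D (measurable_itv _) (l v) _ (ii v).
  by apply: eq_integrable => // t _ /=; rewrite EFinM.
rewrite /simple_integral fsbig_finite //=.
have lsum (r : seq V) (c : V -> R) : l (\sum_(v <- r) c v *: v) = \sum_(v <- r) l v * c v.
  elim: r => [|v r IH]; first by rewrite !big_nil dual0.
  by rewrite !big_cons dualD // dualZ // IH mulrC.
rewrite lsum; apply: eq_bigr => v _; rewrite RintegralZl //; congr (_ * _).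
rewrite /Rintegral integral_indic; [by rewrite setIC|exact: measurable_itv|exact: ms].
Qed.
End SimpleIntegral.

(** * The Bochner integral *)

Lemma fine_cvg0 (R : realType) (f : nat -> \bar R) : f n @[n --> \oo] --> 0%E ->
  fine (f n) @[n --> \oo] --> (0 : R).
Proof. by move=> f0; apply: (fine_cvg (a := 0)). Qed.

Section StrongMeasurability.
Context {R : realType} {V : normedModType R}.
Implicit Types (F G : R -> V) (D : set R).

Lemma nmeasurable_cst (v : V) : nmeasurable (fun _ : R => v).
Proof. by move=> y; apply: measurable_cst. Qed.

Lemma nmeasurableN F : nmeasurable F -> nmeasurable (fun t => - F t).
Proof.
move=> mF y; rewrite (_ : (fun t => _) = fun t => `|F t - (- y)|) //.
by apply/funext => t; rewrite -normrN opprD !opprK.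
Qed.

Lemma nmeasurable_norm F : nmeasurable F -> measurable_fun setT (fun t => `|F t|).
Proof. by move=> /(_ 0); under eq_fun do rewrite subr0. Qed.

(** The representative is measurable on the whole line, which avoids measurability relative to
    [D]. *)
Definition smeasurable D F : Prop :=
  exists2 F', nmeasurable F' & ae_on D F F'.

Lemma strongly_measurable_smeasurable D F : measurable D ->
  strongly_measurable D F -> smeasurable D F.
Proof.
move=> mD [s [ss [N [mN N0 sN]]]].
have mA : measurable (D `\` N) by apply: measurableD.
exists (fun t => if t \in D `\` N then F t else 0).
  apply: (nmeasurable_cvg (F_ := fun n t => if t \in D `\` N then s n t else 0)).
    move=> n; apply: nmeasurable_if => //; first exact: simple_nmeasurable.
    move=> t; case: ifPn => [/set_mem[Dt Nt]|_]; last exact: cvg_cst.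
  apply: contrapT => ncvg; apply: Nt; apply: sN => /= /(_ Dt).
  exact: ncvg.
exists N; split=> // t /= /not_implyP[Dt ne]; apply: contrapT => Nt; apply: ne.
by rewrite mem_set.
Qed.

Lemma smeasurableS D E F : D `<=` E -> smeasurable E F -> smeasurable D F.
Proof. by move=> DE [F' mF FF']; exists F' => //; apply: (ae_mono FF') => t h /DE. Qed.

Lemma smeasurable_ae D F G : ae_on D F G -> smeasurable D F -> smeasurable D G.
Proof.
move=> FG [F' mF FF']; exists F' => //; apply: (ae_mono (ae_and FG FF')).
by move=> t [h1 h2] Dt; rewrite -h1 // h2.
Qed.

Lemma smeasurable_cvg D F (F_ : nat -> R -> V) : measurable D ->
  (forall n, smeasurable D (F_ n)) ->
  {ae leb, forall t : R, D t -> F_ n t @[n --> \oo] --> F t} -> smeasurable D F.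
Proof.
move=> mD mF; have /choice[G HG] : forall n, exists G, nmeasurable G /\ ae_on D (F_ n) G.
  by move=> n; have [G mG FG] := mF n; exists G.
have /ae_all aG : forall n, ae_on D (F_ n) (G n) by move=> n; have [] := HG n.
move=> lim; have [N [mN N0 sN]] := ae_and aG lim.
have mA : measurable (D `\` N) by apply: measurableD.
have onN t : t \in D `\` N -> (forall n, F_ n t = G n t) /\ F_ n t @[n --> \oo] --> F t.
  move=> /set_mem[Dt Nt]; apply: contrapT => h; apply: Nt; apply: sN => -[h1 h2].
  by apply: h; split=> [n|]; [apply: h1|apply: h2].
exists (fun t => if t \in D `\` N then F t else 0).
  apply: (nmeasurable_cvg (F_ := fun n t => if t \in D `\` N then G n t else 0)).
    move=> n; apply: nmeasurable_if => //; first by have [] := HG n.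
    move=> t; case: ifPn => [/onN[FG Fl]|_]; last exact: cvg_cst.
  by rewrite (_ : (fun n => G n t) = F_ ^~ t) //; apply/funext => n; rewrite -FG.
exists N; split=> // t /= /not_implyP[Dt ne]; apply: contrapT => Nt; apply: ne.
by rewrite mem_set.
Qed.
End StrongMeasurability.

Section Bochner.
Context {R : realType} {V : completeNormedModType R}.
Context (J : V -> (V -> R^o)) (dualJ : duality_map J) (sepV : separable V).
Implicit Types F G : R -> V.

(** For [l = J x] the assumption reads |x|^2 <= |x| c. *)
Lemma norm_le_dual (x : V) (c : R) : 0 <= c ->
  (forall l, dual l -> `|l x| <= opnorm l * c) -> `|x| <= c.
Proof.
move=> c0 H; have [dJ Jx nJ] := dualJ x; have := H _ dJ.
have -> : opnorm (J x) = `|x|.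
  by apply/eqP; rewrite -(eqrXn2 (n := 2)) ?opnorm_ge0 ?nJ.
rewrite Jx ger0_norm ?sqr_ge0 // expr2.
have [->|x0] := eqVneq `|x| 0; first by rewrite c0.
by rewrite ler_pM2l // lt0r x0 normr_ge0.
Qed.

Lemma dual_eq (x y : V) : (forall l, dual l -> l x = l y) -> x = y.
Proof.
move=> H; apply/eqP; rewrite -subr_eq0 -normr_le0; apply: norm_le_dual => // l dl.
by rewrite dualB // H // subrr normr0 mulr0.
Qed.

Variables (a b : R).
Notation D := (`[a, b]%classic : set R).

Definition nintegrable F := nmeasurable F /\ leb.-integrable D (EFin \o (fun t => `|F t|)).

Lemma dual_measurable F (l : V -> R^o) : nmeasurable F -> dual l ->
  measurable_fun setT (fun t => l (F t)).
Proof.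
move=> mF dl; apply: (measurable_param sepV (Phi := fun v _ => l v)) => //.
by move=> t; apply: blin_continuous.
Qed.

Lemma le_integrableR (f g : R -> R) : measurable_fun setT f ->
  (forall t, D t -> `|f t| <= g t) -> leb.-integrable D (EFin \o g) ->
  leb.-integrable D (EFin \o f).
Proof.
move=> mf fg; apply: le_integrable => //.
  exact/measurable_EFinP/(measurable_funS measurableT).
by move=> t Dt /=; rewrite lee_fin (le_trans (fg _ Dt)) // ler_norm.
Qed.

Lemma integrableDR (f g : R -> R) : leb.-integrable D (EFin \o f) ->
  leb.-integrable D (EFin \o g) -> leb.-integrable D (EFin \o (fun t => f t + g t)).
Proof.
by move=> fi gi; have := @integrableD _ _ _ leb D (measurable_itv _) _ _ fi gi.
Qed.

Lemma integrableZR (k : R) (f : R -> R) : leb.-integrable D (EFin \o f) ->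
  leb.-integrable D (EFin \o (fun t => k * f t)).
Proof.
by move=> fi; have := @integrableZl _ _ _ leb D (measurable_itv _) k _ fi.
Qed.

Lemma nintegrableD F G : nintegrable F -> nintegrable G ->
  nintegrable (fun t => F t + G t).
Proof.
move=> [mF iF] [mG iG]; have mFG := nmeasurableD sepV mF mG; split=> //.
apply: le_integrableR (integrableDR iF iG); first exact: nmeasurable_norm.
by move=> t _; rewrite normr_id ler_normD.
Qed.

Lemma nintegrableN F : nintegrable F -> nintegrable (fun t => - F t).
Proof.
move=> [mF iF]; split; first exact: nmeasurableN.
by rewrite (_ : (fun t => `|- F t|) = fun t => `|F t|) //; apply/funext => t; rewrite normrN.
Qed.

Lemma nintegrableB F G : nintegrable F -> nintegrable G ->
  nintegrable (fun t => F t - G t).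
Proof. by move=> iF /nintegrableN; apply: nintegrableD. Qed.

Lemma nintegrable_simple s : simple s -> nintegrable s.
Proof.
by move=> ss; split; [exact: simple_nmeasurable|exact: (integrable_simple _ _ (fun v => `|v|))].
Qed.

Lemma dual_integrable F (l : V -> R^o) : nintegrable F -> dual l ->
  leb.-integrable D (EFin \o (fun t => l (F t))).
Proof.
move=> [mF iF] dl; apply: le_integrableR (integrableZR (opnorm l) iF).
  exact: dual_measurable.
by move=> t _; apply: dual_le.
Qed.

Lemma dual_Rintegral_le F (l : V -> R^o) : nintegrable F -> dual l ->
  `|\int[leb]_(t in D) l (F t)| <= opnorm l * \int[leb]_(t in D) `|F t|.
Proof.
move=> iF dl; have lF := dual_integrable iF dl; have [mF nF] := iF.
apply: (le_trans (@le_normr_Rintegral _ _ _ leb D _ (measurable_itv _) lF)).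
rewrite -RintegralZl //; apply: le_Rintegral => //.
- exact: integrable_norm.
- exact: integrableZR.
- by move=> t _; apply: dual_le.
Qed.

Lemma dual_RintegralB F G (l : V -> R^o) : nintegrable F -> nintegrable G ->
  dual l -> \int[leb]_(t in D) l (F t - G t) =
    \int[leb]_(t in D) l (F t) - \int[leb]_(t in D) l (G t).
Proof.
move=> iF iG dl; rewrite -RintegralB //; try exact: dual_integrable.
by apply: eq_Rintegral => t _; rewrite dualB.
Qed.

Lemma dual_Rintegral_ae F G (l : V -> R^o) : nmeasurable F -> nmeasurable G ->
  dual l -> ae_on D F G -> \int[leb]_(t in D) l (F t) = \int[leb]_(t in D) l (G t).
Proof.
move=> mF mG dl FG; congr fine; apply: ae_eq_integral => //.
- apply/measurable_EFinP; apply: (measurable_funS measurableT) => //.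
  exact: dual_measurable.
- apply/measurable_EFinP; apply: (measurable_funS measurableT) => //.
  exact: dual_measurable.
- by apply: (ae_mono FG) => t h /h ->.
Qed.

(* The Bochner integral, characterised through the dual: the values of the
   duality map are norming functionals, so no Hahn-Banach theorem is needed. *)
Definition wintegral F I := exists F', [/\ nintegrable F', ae_on D F F' &
  forall l, dual l -> l I = \int[leb]_(t in D) l (F' t)].

Lemma wintegral_unique F I I' : wintegral F I -> wintegral F I' -> I = I'.
Proof.
move=> [F1 [iF1 e1 H1]] [F2 [iF2 e2 H2]]; apply: dual_eq => l dl.
rewrite H1 // H2 //; apply: dual_Rintegral_ae => //; [by case: iF1|by case: iF2|].
by apply: (ae_mono (ae_and e1 e2)) => t [h1 h2] Dt; rewrite -h1 // h2.
Qed.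

(** Integrals that tend to 0 are eventually finite, so the representative is integrable as a simple
    function plus an integrable error. The identity on functionals is then a limit of the one for
    simple functions. *)
Lemma is_bochner_wintegral F I : is_bochner a b F I -> wintegral F I.
Proof.
move=> [/(strongly_measurable_smeasurable (measurable_itv _))[F' mF FF'] [s [ss + sI]]].
have -> : (fun n => \int[leb]_(t in D) (`|F t - s n t|)%:E)%E =
    (fun n => \int[leb]_(t in D) (`|F' t - s n t|)%:E)%E.
  apply/funext => n; apply: eq_integral_ae.
  - by move=> t _; rewrite lee_fin.
  - by move=> t _; rewrite lee_fin.
  - by apply: (ae_mono FF') => t h /h ->.
move=> E0.
have ms n : nintegrable (s n) by apply: nintegrable_simple.
have mFs n : nmeasurable (fun t => F' t - s n t).
  by apply: nmeasurableD => //; apply: nmeasurableN; case: (ms n).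
have [[n0 _ En0] _] := proj1 (fine_cvgP _ _) E0.
have iFs n : (n0 <= n)%N -> nintegrable (fun t => F' t - s n t).
  move=> nn; split=> //; apply/integrableP; split.
    apply/measurable_EFinP; apply: (measurable_funS measurableT) => //.
    exact: nmeasurable_norm.
  under eq_integral do rewrite /= normr_id.
  by rewrite -ge0_fin_numE ?(En0 _ nn) // integral_ge0.
have iF' : nintegrable F'.
  have := nintegrableD (iFs _ (leqnn _)) (ms n0).
  by under eq_fun do rewrite subrK.
exists F'; split=> // l dl.
have lim1 : l (simple_integral a b (s n)) @[n --> \oo] --> l I.
  by apply: (cvg_comp _ _ sI); apply: blin_continuous.
apply: (@cvg_unique _ _ (l (simple_integral a b (s n)) @[n --> \oo])) => //.
apply: (@squeeze_norm _ R^o _ _ _ _ _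
  (fun n => opnorm l * fine (\int[leb]_(t in D) (`|F' t - s n t|)%:E)%E)).
  exists n0 => // n nn; rewrite dual_simple_integral // distrC -dual_RintegralB //.
  exact: dual_Rintegral_le (iFs _ nn) dl.
by rewrite -(mulr0 (opnorm l)); apply: cvgMr; apply: fine_cvg0.
Qed.

(** The approximants of [nmeasurable_approx] converge in L^1 by dominated convergence. Their
    integrals form a Cauchy sequence, the norm of a difference being tested on functionals, and
    completeness provides [I]. *)
Lemma is_bochner_exists F F' : nintegrable F' -> ae_on D F F' ->
  exists I, is_bochner a b F I.
Proof.
move=> iF' FF'; have [mF nF] := iF'.
have [s [ss sF sle]] := nmeasurable_approx sepV mF.
pose E n := (\int[leb]_(t in D) (`|F' t - s n t|)%:E)%E.
have ms n : nintegrable (s n) by apply: nintegrable_simple.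
have mFs n : nintegrable (fun t => F' t - s n t) by apply: nintegrableB.
have E0 : E n @[n --> \oo] --> 0%E.
  have [||||| _ _] := @dominated_convergence _ _ R leb D (measurable_itv _)
    (fun n t => (`|F' t - s n t|)%:E) (fun=> 0%E) (fun t => (`|F' t|)%:E).
  - move=> n; apply/measurable_EFinP; apply: (measurable_funS measurableT) => //.
    by apply: nmeasurable_norm; case: (mFs n).
  - exact: measurable_cst.
  - apply: ae_true => t _; apply: cvg_EFin; first exact: nearW.
    rewrite -(@normr0 _ V) -(subrr (F' t)); apply: cvg_norm.
    by apply: cvgB; [exact: cvg_cst|exact: sF].
  - exact: nF.
  - by apply: ae_true => t n _; rewrite /= normr_id lee_fin.
  by rewrite integral0.
have [I HI] : exists I : V, simple_integral a b (s n) @[n --> \oo] --> I.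
  apply: cauchy_convergent => e e0.
  have e2 : 0 < e / 2 by rewrite divr_gt0.
  have [j _ Hj] := cvgr_lt _ (fine_cvg0 E0) _ e2.
  exists j => k m jk jm; apply: norm_le_dual => [|l dl]; first exact: ltW.
  rewrite dualB // !dual_simple_integral // -dual_RintegralB //.
  apply: le_trans (dual_Rintegral_le (nintegrableB (ms k) (ms m)) dl) _.
  apply: ler_wpM2l; first exact: opnorm_ge0.
  apply: (@le_trans _ _ (fine (E k) + fine (E m))).
    have [_ iFk] := mFs k; have [_ iFm] := mFs m.
    rewrite -[leRHS]RintegralD //; apply: le_Rintegral => //.
    - by have [] := nintegrableB (ms k) (ms m).
    - exact: integrableDR.
    move=> t _; have -> : s k t - s m t = (s k t - F' t) + (F' t - s m t).
      by rewrite addrA subrK.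
    by apply: le_trans (ler_normD _ _) _; rewrite lerD2r distrC.
  by rewrite (splitr e) lerD // ltW //; [exact: (Hj k)|exact: (Hj m)].
exists I; split.
  by exists s; split=> //; apply: (ae_mono FF') => t h /h ->.
exists s; split=> //; rewrite (_ : (fun n => _) = E) //.
apply/funext => n; apply: eq_integral_ae.
- by move=> t _; rewrite lee_fin.
- by move=> t _; rewrite lee_fin.
- by apply: (ae_mono FF') => t h /h ->.
Qed.

Lemma wintegralP F I : is_bochner a b F I <-> wintegral F I.
Proof.
split; first exact: is_bochner_wintegral.
move=> wI; have [F' [iF' FF' _]] := wI.
have [I' bI'] := is_bochner_exists iF' FF'.
by rewrite (wintegral_unique wI (is_bochner_wintegral bI')).
Qed.

Lemma bint_wintegral F I : wintegral F I -> bint a b F = I.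
Proof.
move=> wI; rewrite /bint; case: xgetP => [I' _ /is_bochner_wintegral wI'|/(_ I)].
  exact: wintegral_unique wI' wI.
by case; apply/wintegralP.
Qed.
End Bochner.

(** The retraction of the line onto [a, b]. Composing with it turns continuity on the interval into
    continuity on the line, without changing the values on the interval. *)
Definition clamp (R : realType) (a b t : R) : R := Num.min b (Num.max a t).

Section Clamp.
Context {R : realType}.
Implicit Types a b t : R.

Lemma clamp_id a b t : a <= t <= b -> clamp a b t = t.
Proof. by move=> /andP[at_ tb]; rewrite /clamp (max_idPr _) // (min_idPr _). Qed.

Lemma clamp_in a b t : a <= b -> a <= clamp a b t <= b.
Proof.
by move=> ab; rewrite /clamp le_min ab /= le_max lexx ge_min lexx.
Qed.

Lemma clamp_le a b t : a <= b -> t <= a -> clamp a b t = a.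
Proof. by move=> ab ta; rewrite /clamp (max_idPl _) // (min_idPr _). Qed.

Lemma clamp_ge a b t : a <= b -> b <= t -> clamp a b t = b.
Proof.
by move=> ab bt; rewrite /clamp (min_idPl _) // le_max bt orbT.
Qed.

Lemma clamp_continuous a b : continuous (clamp a b).
Proof.
move=> t; apply: continuous_min; first exact: cvg_cst.
by apply: continuous_max; [exact: cvg_cst|exact: cvg_id].
Qed.

Lemma within_clamp (V : topologicalType) (f : R -> V) a b : a <= b ->
  {within `[a, b], continuous f} -> continuous (fun t => f (clamp a b t)).
Proof.
move=> ab /subspace_continuousP cf t.
have ct : `[a, b]%classic (clamp a b t) by rewrite /= in_itv /= clamp_in.
apply: (@cvg_comp _ _ _ (clamp a b) f (nbhs t) (within `[a, b] (nbhs (clamp a b t)))).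
  move=> U AU; have H : nbhs t [set s | `[a, b]%classic (clamp a b s) ->
    U (clamp a b s)] := clamp_continuous AU.
  by apply: (filterS _ H) => s /=; apply; rewrite in_itv /= clamp_in.
exact: cf.
Qed.
End Clamp.

Section StrongMeasurability2.
Context {R : realType} {V : normedModType R} (sepV : separable V).
Implicit Types (F G : R -> V) (D : set R).

Lemma smeasurableD D F G : smeasurable D F -> smeasurable D G ->
  smeasurable D (fun t => F t + G t).
Proof.
move=> [F' mF FF'] [G' mG GG']; exists (fun t => F' t + G' t).
  exact: nmeasurableD.
by apply: (ae_mono (ae_and FF' GG')) => t [h1 h2] Dt; rewrite h1 // h2.
Qed.

Lemma smeasurable_param (W : normedModType R) D F (Phi : R -> V -> W) :
  smeasurable D F -> (forall v, nmeasurable (Phi ^~ v)) ->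
  (forall t, continuous (Phi t)) -> smeasurable D (fun t => Phi t (F t)).
Proof.
move=> [F' mF FF'] mPhi cPhi; exists (fun t => Phi t (F' t)).
  move=> y; apply: (measurable_param sepV (Phi := fun v t => `|Phi t v - y|)) => //.
    by move=> v; apply: mPhi.
  by move=> t v; apply: cvg_norm; apply: cvgB; [exact: cPhi|exact: cvg_cst].
by apply: (ae_mono FF') => t h /h ->.
Qed.

Lemma continuous_nmeasurable F : continuous F -> nmeasurable F.
Proof.
move=> cF y; apply: continuous_measurable_fun => t.
by apply: cvg_norm; apply: cvgB; [exact: cF|exact: cvg_cst].
Qed.

Lemma within_smeasurable F a b : {within `[a, b], continuous F} ->
  smeasurable `[a, b] F.
Proof.
move=> cF; have [ab|ba] := leP a b; last first.
  exists (fun=> 0); first by apply: nmeasurable_cst.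
  apply: ae_true => t /=; rewrite in_itv /= => /andP[at_ tb].
  by have := le_lt_trans (le_trans at_ tb) ba; rewrite ltxx.
exists (fun t => F (clamp a b t)).
  by apply: continuous_nmeasurable; apply: within_clamp.
by apply: ae_true => t /=; rewrite in_itv /= => /clamp_id ->.
Qed.

(** A countable gluing, meant for histories frozen at grid times: [k t] is then the index of the
    grid time. *)
Lemma smeasurable_nat_param D (k : R -> nat) (Phi : nat -> R -> V) :
  (forall j, measurable (k @^-1` [set j])) ->
  (forall j, smeasurable D (Phi j)) -> smeasurable D (fun t => Phi (k t) t).
Proof.
move=> mk mPhi.
have /choice[G HG] : forall n, exists G, nmeasurable G /\ ae_on D (Phi n) G.
  by move=> n; have [G mG FG] := mPhi n; exists G.
exists (fun t => G (k t) t).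
  move=> y _ Y mY; rewrite setTI.
  have -> : (fun t => `|G (k t) t - y|) @^-1` Y =
      \bigcup_j (k @^-1` [set j] `&` (fun t => `|G j t - y|) @^-1` Y).
    apply/seteqP; split=> t /=; first by move=> Yt; exists (k t).
    by case=> j _ [/= <-].
  apply: bigcup_measurable => j _; apply: measurableI => //.
  by have [mG _] := HG j; rewrite -[X in measurable X]setTI; apply: mG.
have /ae_all aG : forall n, ae_on D (Phi n) (G n) by move=> n; have [] := HG n.
by apply: (ae_mono aG) => t h; apply: h.
Qed.
End StrongMeasurability2.

Section RealIntegral.
Context {R : realType}.
Implicit Types (a b c : R) (w : R -> R).

Lemma itvS a b c d : a <= c -> d <= b ->
  (`[c, d]%classic : set R) `<=` `[a, b]%classic.
Proof.
move=> ac db t /=; rewrite !in_itv /= => /andP[ct td].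
by rewrite (le_trans ac) // (le_trans td).
Qed.

Lemma integrable_itvS w a b c d : a <= c -> d <= b ->
  leb.-integrable `[a, b] (EFin \o w) -> leb.-integrable `[c, d] (EFin \o w).
Proof.
by move=> ac db; apply: integrableS => //; apply: itvS.
Qed.

Lemma Rintegral_cat w a b c : a <= c -> c <= b ->
  leb.-integrable `[a, b] (EFin \o w) ->
  \int[leb]_(t in `[a, b]) w t =
  \int[leb]_(t in `[a, c]) w t + \int[leb]_(t in `[c, b]) w t.
Proof.
move=> ac cb iw; have := @Rintegral_itvB R w (BLeft a) (BRight b) c iw.
rewrite !bnd_simp => /(_ ac cb) => e.
rewrite -[LHS](subrK (\int[leb]_(t in `[a, c]) w t)) e addrC; congr (_ + _).
apply: Rintegral_itv_obnd_cbnd; apply: integrableS iw => //.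
by apply: subset_itvr; rewrite bnd_simp.
Qed.

Lemma Rintegral_itv_mono w a b c d : a <= c -> c <= d -> d <= b ->
  (forall t, a <= t <= b -> 0 <= w t) ->
  leb.-integrable `[a, b] (EFin \o w) ->
  \int[leb]_(t in `[c, d]) w t <= \int[leb]_(t in `[a, b]) w t.
Proof.
move=> ac cd db w0 iw.
rewrite (Rintegral_cat ac (le_trans cd db)) // (Rintegral_cat cd db).
  rewrite addrCA lerDl addr_ge0 // Rintegral_ge0 // => t /=; rewrite in_itv /= => /andP[h1 h2].
    by apply: w0; rewrite h1 (le_trans h2) // (le_trans cd).
  by apply: w0; rewrite h2 andbT (le_trans _ h1) // (le_trans ac).
exact: integrable_itvS iw.
Qed.

Lemma integrable_cst_itv (k : R) a b : leb.-integrable `[a, b] (EFin \o (fun=> k)).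
Proof. by apply: (integrable_bounded (M := `|k|)) => //; apply: measurable_cst. Qed.

Lemma Rintegral_cst_itv (k : R) a b : a <= b ->
  \int[leb]_(t in `[a, b]) k = k * (b - a).
Proof.
move=> ab; rewrite Rintegral_cst //; congr (_ * _).
transitivity (fine (@lebesgue_measure R `[a, b]%classic)) => //.
rewrite lebesgue_measure_itv /= lte_fin.
case: ltP => // ba; rewrite (_ : b = a) ?subrr //.
by apply/eqP; rewrite eq_le ba ab.
Qed.

Lemma within_integrable (f : R -> R) a b : {within `[a, b], continuous f} ->
  leb.-integrable `[a, b] (EFin \o f).
Proof. exact: (continuous_compact_integrable (@segment_compact R a b)). Qed.
End RealIntegral.

(** * Calculus of the Bochner integral *)

Section BochnerCalculus.
Context {R : realType} {V : completeNormedModType R}.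
Context (J : V -> (V -> R^o)) (dualJ : duality_map J) (sepV : separable V).
Implicit Types (F G : R -> V) (a b c : R) (w : R -> R).

Definition sintegrable a b F : Prop :=
  exists F', nintegrable a b F' /\ ae_on `[a, b] F F'.

Lemma sintegrable_dom a b F w : smeasurable `[a, b] F ->
  {ae leb, forall t, `[a, b]%classic t -> `|F t| <= w t} ->
  leb.-integrable `[a, b] (EFin \o w) -> sintegrable a b F.
Proof.
move=> [F' mF FF'] Fw iw; exists F'; split=> //; split=> //.
apply/integrableP; split.
  apply/measurable_EFinP; apply: (measurable_funS measurableT) => //.
  exact: nmeasurable_norm.
have /integrableP[_] := iw; apply: le_lt_trans.
apply: le_integral_ae => //; apply: (ae_mono (ae_and FF' Fw)) => t [h1 h2] Dt.
by rewrite /= lee_fin normr_id -h1 // (le_trans (h2 Dt)) // ler_norm.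
Qed.

Lemma sintegrable_wintegral a b F : sintegrable a b F -> wintegral a b F (bint a b F).
Proof.
move=> [F' [iF' FF']]; have [I bI] := is_bochner_exists dualJ sepV iF' FF'.
have wI := is_bochner_wintegral sepV bI.
by rewrite (bint_wintegral dualJ sepV wI).
Qed.

Lemma sintegrable_bochner a b F : sintegrable a b F -> bochner_integrable a b F.
Proof.
by move=> /sintegrable_wintegral wI; exists (bint a b F); apply/wintegralP.
Qed.

Lemma sintegrable_ae a b F G : ae_on `[a, b] F G -> sintegrable a b F ->
  sintegrable a b G.
Proof.
move=> FG [F' [iF' FF']]; exists F'; split=> //.
by apply: (ae_mono (ae_and FG FF')) => t [h1 h2] Dt; rewrite -h1 // h2.
Qed.

Lemma bint_ae a b F G : ae_on `[a, b] F G -> sintegrable a b F ->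
  bint a b F = bint a b G.
Proof.
move=> FG /sintegrable_wintegral[F' [iF' FF' HF]].
apply/esym/(bint_wintegral dualJ sepV); exists F'; split=> //.
by apply: (ae_mono (ae_and FG FF')) => t [h1 h2] Dt; rewrite -h1 // h2.
Qed.

Lemma sintegrableS a b c d F : a <= c -> d <= b -> sintegrable a b F ->
  sintegrable c d F.
Proof.
move=> ac db [F' [[mF iF] FF']]; exists F'; split.
  by split=> //; apply: integrable_itvS iF.
by apply: (ae_mono FF') => t h Dt; apply: h; apply: itvS Dt.
Qed.

Lemma sintegrableB a b F G : sintegrable a b F -> sintegrable a b G ->
  sintegrable a b (fun t => F t - G t).
Proof.
move=> [F' [iF FF']] [G' [iG GG']]; exists (fun t => F' t - G' t); split.
  exact: nintegrableB.
by apply: (ae_mono (ae_and FF' GG')) => t [h1 h2] Dt; rewrite h1 // h2.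
Qed.

Lemma bintB a b F G : sintegrable a b F -> sintegrable a b G ->
  bint a b (fun t => F t - G t) = bint a b F - bint a b G.
Proof.
move=> /sintegrable_wintegral[F' [iF FF' HF]] /sintegrable_wintegral[G' [iG GG' HG]].
apply: (bint_wintegral dualJ sepV); exists (fun t => F' t - G' t); split.
- exact: nintegrableB.
- by apply: (ae_mono (ae_and FF' GG')) => t [h1 h2] Dt; rewrite h1 // h2.
- by move=> l dl; rewrite dualB // HF // HG // (dual_RintegralB sepV).
Qed.

Lemma sintegrable_linear a b F (L : V -> V) : bounded_linear L ->
  sintegrable a b F -> sintegrable a b (fun t => L (F t)).
Proof.
move=> bL [F' [[mF iF] FF']]; exists (fun t => L (F' t)); split; last first.
  by apply: (ae_mono FF') => t h /h ->.
have mL : nmeasurable (fun t => L (F' t)).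
  move=> y; apply: (measurable_param sepV (Phi := fun v _ => `|L v - y|)) => //.
  by move=> _ v; apply: cvg_norm; apply: cvgB; [exact: blin_continuous|exact: cvg_cst].
split=> //; apply: le_integrableR (integrableZR (opnorm L) iF).
  exact: nmeasurable_norm.
by move=> t _; rewrite normr_id opnorm_le.
Qed.

Lemma bint_linear a b F (L : V -> V) : bounded_linear L -> sintegrable a b F ->
  bint a b (fun t => L (F t)) = L (bint a b F).
Proof.
move=> bL iF; have [F' [iF' FF' HF]] := sintegrable_wintegral iF.
apply: (dual_eq dualJ) => l dl.
have dL : dual (fun v => l (L v) : R^o).
  split=> [k x y|]; first by rewrite /= blin_D // blin_Z // dualD // dualZ.
  exists (opnorm l * opnorm L) => x; apply: le_trans (dual_le dl _) _.
  by rewrite -mulrA ler_wpM2l ?opnorm_ge0 // opnorm_le.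
rewrite (HF _ dL).
have [G [iG GG HG]] := sintegrable_wintegral (sintegrable_linear bL iF).
rewrite HG //; congr fine; apply: ae_eq_integral => //.
- apply/measurable_EFinP; apply: (measurable_funS measurableT) => //.
  by apply: dual_measurable => //; case: iG.
- apply/measurable_EFinP; apply: (measurable_funS measurableT) => //.
  by apply: (dual_measurable sepV _ dL); case: iF'.
- by apply: (ae_mono (ae_and FF' GG)) => t [h1 h2] Dt; rewrite -h2 // h1.
Qed.

Lemma bint_dual a b F (l : V -> R^o) : nintegrable a b F -> dual l ->
  l (bint a b F) = \int[leb]_(t in `[a, b]) l (F t).
Proof.
move=> iF dl; have wF : sintegrable a b F by exists F; split=> //; apply: ae_true.
have [F' [iF' FF' HF]] := sintegrable_wintegral wF.
rewrite HF //; apply: dual_Rintegral_ae => //; [by case: iF'|by case: iF|].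
by apply: (ae_mono FF') => t h /h ->.
Qed.

Lemma bint_norm_le a b F w : sintegrable a b F ->
  {ae leb, forall t, `[a, b]%classic t -> `|F t| <= w t} ->
  leb.-integrable `[a, b] (EFin \o w) ->
  `|bint a b F| <= \int[leb]_(t in `[a, b]) w t.
Proof.
move=> iF Fw iw; have [F' [iF' FF' HF]] := sintegrable_wintegral iF.
have le : \int[leb]_(t in `[a, b]) `|F' t| <= \int[leb]_(t in `[a, b]) w t.
  (* [w] bounds the norm of [F'] only almost everywhere. The maximum has the same integral and is a
     bound at every point. *)
  have -> : \int[leb]_(t in `[a, b]) w t = \int[leb]_(t in `[a, b]) Num.max (w t) `|F' t|.
    congr fine; apply: ae_eq_integral => //.
    - exact: (measurable_int leb).
    - apply/measurable_EFinP; apply: measurable_maxr.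
        by apply/measurable_EFinP; exact: (measurable_int leb).
      apply: (measurable_funS measurableT) => //; apply: nmeasurable_norm.
      by case: iF'.
    apply: (ae_mono (ae_and FF' Fw)) => t [h1 h2] Dt /=.
    by rewrite (max_idPl _) // -h1 // h2.
  have [mF' nF'] := iF'.
  apply: le_Rintegral => //; last by move=> t _; rewrite le_max lexx orbT.
  apply: (le_integrable _ _ _ (integrableDR (integrable_norm iw) nF')) => //.
    apply/measurable_EFinP; apply: measurable_maxr.
      by apply/measurable_EFinP; exact: (measurable_int leb).
    by apply: (measurable_funS measurableT) => //; apply: nmeasurable_norm.
  move=> t _ /=; rewrite lee_fin [leRHS]ger0_norm ?addr_ge0 //.
  by case: (leP (w t) `|F' t|) => _; rewrite ?normr_id ?lerDl ?lerDr.
apply: (norm_le_dual dualJ) => [|l dl].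
  by apply: le_trans le; apply: Rintegral_ge0.
rewrite HF //; apply: le_trans (dual_Rintegral_le sepV iF' dl) _.
by rewrite ler_wpM2l // opnorm_ge0.
Qed.

Lemma bint_cat a b c F : a <= c -> c <= b -> sintegrable a b F ->
  bint a b F = bint a c F + bint c b F.
Proof.
move=> ac cb iF; have [F' [iF' FF']] := iF; have [mF nF] := iF'.
apply: (dual_eq dualJ) => l dl; rewrite dualD //.
have key (u v : R) : a <= u -> v <= b ->
    l (bint u v F) = \int[leb]_(t in `[u, v]) l (F' t).
  move=> au vb; have iuv : nintegrable u v F'.
    by split; [exact: mF|exact: integrable_itvS au vb nF].
  rewrite -(bint_dual iuv dl).
  congr (l _); apply: bint_ae; last exact: sintegrableS iF.
  by apply: (ae_mono FF') => t h Dt; apply: h; apply: itvS Dt.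
rewrite (key a b) // (key a c) // (key c b) //; apply: Rintegral_cat => //.
exact: (dual_integrable sepV iF' dl).
Qed.

Lemma bint_point a F : sintegrable a a F -> bint a a F = 0.
Proof.
move=> iF; apply/eqP; rewrite -normr_le0.
have [F' [[mF' iF'] FF']] := iF.
apply: (le_trans (bint_norm_le (w := fun t => `|F' t|) iF _ _)) => //.
  by apply: (ae_mono FF') => t h /h ->.
by rewrite set_itv1 Rintegral_set1.
Qed.
End BochnerCalculus.

(** * Piecewise continuous functions *)

(** One notion for two-sided and one-sided limits, with the side encoded in [P]. It holds vacuously
    when [P] stays away from [p], as it does to the right of [T]. *)
Definition lim_at (R : realType) (X : normedModType R) (P : set R) (x : R -> X)
    (p : R) (y : X) : Prop :=
  forall e : R, 0 < e -> exists2 d : R, 0 < d &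
    forall v, P v -> `|v - p| < d -> `|x v - y| < e.

Section LimAt.
Context {R : realType} {X : normedModType R}.
Implicit Types (P Q : set R) (x z : R -> X) (p : R) (y : X).

Lemma limatP P x p y : x v @[v --> within P (nbhs p)] --> y <-> lim_at P x p y.
Proof.
split=> [/cvgrPdist_lt H e e0|H].
  have /nbhs_ballP[d d0 Hd] := H _ e0; exists d => // v Pv vp.
  by rewrite distrC; apply: Hd => //; rewrite -ball_normE /= distrC.
apply/cvgrPdist_lt => e e0; have [d d0 Hd] := H _ e0.
apply/nbhs_ballP; exists d => // v; rewrite -ball_normE /= distrC => vp Pv.
by rewrite distrC; apply: Hd.
Qed.

Lemma limat_leftP P x p y : x v @[v --> within P p^'-] --> y <->
  lim_at [set v | P v /\ v < p] x p y.
Proof.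
rewrite -limatP; suff -> : within P p^'- = within [set v | P v /\ v < p] (nbhs p) by [].
apply/seteqP; split=> U /= h; apply: (@filterS _ (nbhs p) _ _ _ _ h) => v /= H.
  by case=> Pv vp; apply: H.
by move=> vp Pv; apply: H.
Qed.

Lemma limat_rightP P x p y : x v @[v --> within P p^'+] --> y <->
  lim_at [set v | P v /\ p < v] x p y.
Proof.
rewrite -limatP; suff -> : within P p^'+ = within [set v | P v /\ p < v] (nbhs p) by [].
apply/seteqP; split=> U /= h; apply: (@filterS _ (nbhs p) _ _ _ _ h) => v /= H.
  by case=> Pv vp; apply: H.
by move=> vp Pv; apply: H.
Qed.

Lemma limat_atleftP x p y : x v @[v --> p^'-] --> y <-> lim_at [set v | v < p] x p y.
Proof. exact: limatP. Qed.

Lemma within_contP P x : {within P, continuous x} <->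
  forall p, P p -> lim_at P x p (x p).
Proof.
split=> [/subspace_continuousP cx p Pp|H]; first exact/limatP/cx.
by apply/subspace_continuousP => p Pp; apply/limatP/H.
Qed.

Lemma continuous_limat P x p : {for p, continuous x} -> lim_at P x p (x p).
Proof.
move=> cx; apply/limatP; apply: cvg_trans cx; apply: cvg_app.
exact: cvg_within.
Qed.

Lemma limat_eq (d0 : R) P Q x z p y : 0 < d0 ->
  (forall v, Q v -> `|v - p| < d0 -> P v /\ z v = x v) ->
  lim_at P x p y -> lim_at Q z p y.
Proof.
move=> d00 H Hx e e0; have [d d_gt0 Hd] := Hx _ e0.
exists (Num.min d d0) => [|v Qv]; first by rewrite lt_min d_gt0.
by rewrite lt_min => /andP[vd /(H _ Qv)[Pv ->]]; apply: Hd.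
Qed.

Lemma limatS P Q x p y : Q `<=` P -> lim_at P x p y -> lim_at Q x p y.
Proof. by move=> QP; apply: (limat_eq ltr01) => v /QP. Qed.

Lemma limat_sum (I : finType) P (x : I -> R -> X) (a : I -> R) (y : I -> X) p :
  (forall i, lim_at P (x i) p (y i)) ->
  lim_at P (fun t => \sum_i a i *: x i t) p (\sum_i a i *: y i).
Proof.
move=> H; apply/limatP; apply: cvg_sumr => i.
by apply: cvgZ; [exact: cvg_cst|exact/limatP].
Qed.

Lemma limatB P x z p y y' : lim_at P x p y -> lim_at P z p y' ->
  lim_at P (fun t => x t - z t) p (y - y').
Proof. by move=> /limatP h /limatP h'; apply/limatP; apply: cvgB. Qed.
End LimAt.

Lemma limat_unif (R : realType) (X : completeNormedModType R) (D P : set R)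
    (x : nat -> R -> X) (z : R -> X) (p : R) :
  unif_cvg D x z -> (exists2 d0 : R, 0 < d0 & forall v, P v -> `|v - p| < d0 -> D v) ->
  (forall n, exists y, lim_at P (x n) p y) -> exists y, lim_at P z p y.
Proof.
move=> xz [d0 d00 PD] lx.
(* If [P] avoids a neighborhood of [p], any value is a limit; otherwise the filter is proper and
   completeness applies. *)
have [triv|ntriv] := pselect (exists2 d : R, 0 < d & forall v, P v -> ~ `|v - p| < d).
  have [d d_gt0 Hd] := triv; exists 0 => e e0; exists d => // v Pv vp.
  by case: (Hd v Pv vp).
have PF : ProperFilter (within P (nbhs p)).
  split; last exact: within_filter.
  rewrite /within /= => /nbhs_ballP[d d_gt0 Hd]; apply: ntriv; exists d => // v Pv vp.
  by apply: (Hd v) => //; rewrite -ball_normE /= distrC.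
suff : cvg (z v @[v --> within P (nbhs p)]) by move=> /cvg_ex[y zy]; exists y; apply/limatP.
apply: cauchy_cvg; apply: cauchy_exP => e e0.
have e2 : 0 < e / 2 by rewrite divr_gt0.
have [j Hj] := xz _ e2; have [y Hy] := lx j; have [d d_gt0 Hd] := Hy _ e2.
exists y; apply/nbhs_ballP; exists (Num.min d d0); first by rewrite /= lt_min d_gt0.
move=> v; rewrite -ball_normE /= distrC lt_min => /andP[vd vd0] Pv.
rewrite -ball_normE /= (_ : y - z v = (y - x j v) + (x j v - z v)); last by rewrite addrA subrK.
apply: le_lt_trans (ler_normD _ _) _; rewrite (splitr e).
have h1 := Hd v Pv vd; have h2 := Hj _ (leqnn _) v (PD v Pv vd0).
by rewrite distrC in h1; rewrite ltr_leD.
Qed.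

Lemma limat_unif_at (R : realType) (X : normedModType R) (D P : set R)
    (x : nat -> R -> X) (z : R -> X) (p : R) :
  unif_cvg D x z -> D p -> (exists2 d0 : R, 0 < d0 & forall v, P v -> `|v - p| < d0 -> D v) ->
  (forall n, lim_at P (x n) p (x n p)) -> lim_at P z p (z p).
Proof.
move=> xz Dp [d0 d00 PD] lx e e0.
have e3 : 0 < e / 3 by rewrite divr_gt0.
have [j Hj] := xz _ e3; have [d d_gt0 Hd] := lx j _ e3.
exists (Num.min d d0); first by rewrite /= lt_min d_gt0.
move=> v Pv; rewrite lt_min => /andP[vd vd0].
have -> : z v - z p = (z v - x j v) + (x j v - x j p) + (x j p - z p).
  by rewrite (addrA (z v - x j v)) subrK addrA subrK.
have h1 := Hj _ (leqnn _) _ Dp; have h2 := Hj _ (leqnn _) _ (PD _ Pv vd0).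
have h3 := Hd _ Pv vd; rewrite distrC in h2.
have n1 := ler_normD (z v - x j v + (x j v - x j p)) (x j p - z p).
have n2 := ler_normD (z v - x j v) (x j v - x j p).
by lra.
Qed.

(** This is [in_D] on an arbitrary interval, so that all histories come from one path on [-q, T] by
    restriction and translation. *)
Definition pwc (R : realType) (X : normedModType R) (a b : R) (x : R -> X) : Prop :=
  exists l : seq R, forall s, a <= s <= b ->
    [/\ s \notin l -> lim_at `[a, b] x s (x s),
        exists y, lim_at [set v | a <= v /\ v < s] x s y &
        exists y, lim_at [set v | v <= b /\ s < v] x s y].

Section PiecewiseContinuous.
Context {R : realType} {X : normedModType R}.
Implicit Types (a b : R) (x : R -> X).

Lemma in_D_pwc q psi : @in_D R X q psi <-> pwc (- q) 0 psi.
Proof.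
have L (s : R) : - q <= s <= 0 -> [set v | `[- q, 0]%classic v /\ v < s] =
    [set v | - q <= v /\ v < s].
  move=> /andP[_ s0]; apply/seteqP; split=> v /=; rewrite in_itv /=.
    by case=> /andP[].
  by case=> -> vs; rewrite vs (le_trans (ltW vs)).
have Rt (s : R) : - q <= s <= 0 -> [set v | `[- q, 0]%classic v /\ s < v] =
    [set v | v <= 0 /\ s < v].
  move=> /andP[qs _]; apply/seteqP; split=> v /=; rewrite in_itv /=.
    by case=> /andP[].
  by case=> -> vs; rewrite vs (le_trans _ (ltW vs)).
split=> -[l H]; exists l => s.
  move=> sI; have [|h1 [y /limat_leftP h2] [y' /limat_rightP h3]] := H s.
    by rewrite /= in_itv.
  rewrite L // in h2; rewrite Rt // in h3.
  by split; [move/h1/limatP|exists y|exists y'].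
rewrite /= in_itv /= => sI; have [h1 [y h2] [y' h3]] := H s sI; split.
- by move/h1 => h; apply/limatP.
- by exists y; apply/limat_leftP; rewrite L.
- by exists y'; apply/limat_rightP; rewrite Rt.
Qed.

Lemma pwcS a b c d x : a <= c -> d <= b -> pwc a b x -> pwc c d x.
Proof.
move=> ac db [l H]; exists l => s /andP[cs sd].
have [|h1 [y h2] [y' h3]] := H s; first by rewrite (le_trans ac) // (le_trans sd).
split.
- by move/h1; apply: limatS; apply: itvS.
- by exists y; apply: limatS h2 => v /= [cv vs]; rewrite (le_trans ac).
- by exists y'; apply: limatS h3 => v /= [vd sv]; rewrite (le_trans vd).
Qed.

Lemma pwc_shift a b t x : pwc (t + a) (t + b) x -> pwc a b (fun s => x (t + s)).
Proof.
move=> [l H]; exists [seq p - t | p <- l] => s /andP[as_ sb].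
have shift P Q y : (forall v, Q v -> P (t + v)) -> lim_at P x (t + s) y ->
    lim_at Q (fun s => x (t + s)) s y.
  move=> PQ Hx e e0; have [d d0 Hd] := Hx _ e0; exists d => // v Qv vs.
  by apply: Hd; [exact: PQ|rewrite opprD addrACA subrr add0r].
have [|h1 [y h2] [y' h3]] := H (t + s); first by rewrite !lerD2l as_.
split.
- move=> sl; apply: shift (h1 _) => [v /=|].
    by rewrite !in_itv /= !lerD2l.
  by apply: contra sl => h; apply/mapP; exists (t + s) => //; rewrite addrC addKr.
- by exists y; apply: shift h2 => v /= [av vs]; rewrite lerD2l ltrD2l.
- by exists y'; apply: shift h3 => v /= [av vs]; rewrite lerD2l ltrD2l.
Qed.

Lemma pwcB a b x z : pwc a b x -> pwc a b z -> pwc a b (fun t => x t - z t).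
Proof.
move=> [l H] [l' H']; exists (l ++ l') => s sab.
have [h1 [y h2] [w h3]] := H s sab; have [h1' [y' h2'] [w' h3']] := H' s sab.
split; last 2 first.
- by exists (y - y'); apply: limatB.
- by exists (w - w'); apply: limatB.
by rewrite mem_cat negb_or => /andP[/h1 ? /h1' ?]; apply: limatB.
Qed.

(** One-sided limits bound [x] on both sides of each point, the value at the point is added, and
    compactness of [a, b] makes the bounds finite in number. *)
Lemma pwc_bounded a b x : pwc a b x -> exists M : R, forall t, a <= t <= b -> `|x t| <= M.
Proof.
move=> [l H].
have /choice[dM HdM] : forall s, exists dM : R * R, a <= s <= b -> 0 < dM.1 /\
    forall v, a <= v <= b -> `|v - s| < dM.1 -> `|x v| <= dM.2.
  move=> s; have [sab|] := pselect (a <= s <= b); last by exists (0, 0).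
  have [_ [y h2] [y' h3]] := H s sab.
  have [d d0 Hd] := h2 _ ltr01; have [d' d'0 Hd'] := h3 _ ltr01.
  exists (Num.min d d', `|x s| + (`|y| + 1) + (`|y'| + 1)) => _ /=.
  split=> [|v /andP[av vb]]; first by rewrite lt_min d0.
  rewrite lt_min => /andP[vd vd'].
  have tri (u w : X) : `|u - w| < 1 -> `|u| <= `|w| + 1.
    move=> uw; rewrite -(subrK w u) addrC; apply: le_trans (ler_normD _ _) _.
    by rewrite lerD2l ltW.
  have := normr_ge0 (x s); have := normr_ge0 y; have := normr_ge0 y'.
  have [vs|sv|->] := ltgtP v s; last by move=> *; lra.
    by have := tri _ _ (Hd v (conj av vs) vd) => *; lra.
  by have := tri _ _ (Hd' v (conj vb sv) vd') => *; lra.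
have := @segment_compact R a b; rewrite compact_cover.
move=> /(_ R `[a, b]%classic (fun s => ball s (dM s).1)).
case=> [s _||D' D'I cov].
- exact: ball_open.
- move=> s /=; rewrite in_itv /= => sab; exists s; first by rewrite /= in_itv.
  by apply: ballxx; have [] := HdM s sab.
exists (\sum_(s <- enum_fset D') `|(dM s).2|) => t tab.
have [|s /= sD'] := cov t; first by rewrite /= in_itv.
rewrite -ball_normE /= distrC => ts.
have sab : a <= s <= b by have /set_mem := D'I _ sD'; rewrite /= in_itv.
have [_ Hs] := HdM s sab; apply: le_trans (Hs _ tab ts) (le_trans (ler_norm _) _).
by rewrite (big_rem s) //= lerDl sumr_ge0.
Qed.

Lemma pwc_measurable_norm a b x : pwc a b x ->
  measurable_fun (`[a, b] : set R) (fun t => `|x t|).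
Proof.
move=> [l H]; set I : set R := `[a, b]%classic.
pose L : set R := [set` l].
have fL : finite_set L by exact: finite_seq.
have mfin (A : set R) : finite_set A -> measurable A.
  move=> fA; rewrite (_ : A = \bigcup_(p in A) [set p]).
    by apply: fin_bigcup_measurable.
  by apply/seteqP; split=> [p Ap|p [p' Ap' /= ->]] //; exists p.
have mL := mfin _ fL.
rewrite (_ : I = (I `\` L) `|` (I `&` L)); last by rewrite setUC setUIDK.
have mI : measurable I by exact: measurable_itv.
apply/measurable_funU; [exact: measurableD|exact: measurableI|split].
  apply: subspace_continuous_measurable_fun; first exact: measurableD.
  apply/(@within_contP R R^o) => p [Ip Lp].
  have [|h1 _ _] := H p; first by move: Ip; rewrite /I /= in_itv.
  have /(limatS (Q := I `\` L)) h : lim_at I x p (x p) by apply: h1; apply/negP.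
  have {}h : lim_at (I `\` L) x p (x p) by apply: h => v [].
  by apply/limatP; apply: cvg_norm; apply/limatP.
move=> _ Y _; apply: mfin; apply: sub_finite_set fL => t [[_ Lt] _].
exact: Lt.
Qed.
End PiecewiseContinuous.

Section SeminormD.
Context {R : realType} {X : normedModType R} (q : R) (q_gt0 : 0 < q).
Implicit Types x : R -> X.

Lemma ae_notin (l : seq R) : {ae leb, forall v : R, v \notin l}.
Proof.
elim: l => [|p l IH]; first exact: ae_true.
apply: (ae_mono (ae_and (ae_neq p) IH)) => v [vp vl].
by rewrite inE negb_or vp.
Qed.

Lemma norm_D_le x (c : R) : 0 <= c -> (forall t, - q <= t <= 0 -> `|x t| <= c) ->
  norm_D q x <= c.
Proof.
move=> c0 H; rewrite /norm_D -[c]mul1r -(mulVf (lt0r_neq0 q_gt0)) -mulrA.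
rewrite ler_pM2l ?invr_gt0 //.
have qc : \int[leb]_(t in `[- q, 0]) c = q * c.
  by rewrite Rintegral_cst_itv ?oppr_le0 ?ltW // opprK add0r mulrC.
have iq : (\int[leb]_(t in `[(- q)%R, 0%R]) c%:E)%E = (q * c)%:E.
  rewrite -qc /Rintegral fineK //.
  exact: (@integrable_fin_num _ _ _ leb _ (measurable_itv _) _ (integrable_cst_itv c (- q) 0)).
rewrite -lee_fin -iq.
(* [x] may fail to be measurable; the comparison in the extended reals also shows that the integral
   is finite, so that [fine] is harmless. *)
have le : (\int[leb]_(t in `[(- q)%R, 0%R]) (`|x t|)%:E <=
    \int[leb]_(t in `[(- q)%R, 0%R]) c%:E)%E.
  apply: le_integral_ae => [t _|t _|]; rewrite ?lee_fin //.
  by apply: ae_true => t /=; rewrite in_itv /= lee_fin => /H.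
rewrite /Rintegral fineK // ge0_fin_numE ?integral_ge0 //.
by apply: le_lt_trans le _; rewrite iq ltry.
Qed.

Lemma norm_D_eq x z : (forall t, t < 0 -> x t = z t) -> norm_D q x = norm_D q z.
Proof.
move=> xz; rewrite /norm_D; congr (_ * fine _); apply: eq_integral_ae => [t _|t _|].
- by rewrite lee_fin.
- by rewrite lee_fin.
apply: (ae_mono (ae_neq 0)) => t t0 /=; rewrite in_itv /= => /andP[_ t0'].
by rewrite xz // lt_neqAle t0.
Qed.

Lemma in_D_hist (T : R) x t : pwc (- q) T x -> 0 <= t <= T -> in_D q (hist x t).
Proof.
move=> px /andP[t0 tT]; apply/in_D_pwc; apply: pwc_shift.
by apply: pwcS px; rewrite ?addr0 // lerDr.
Qed.

(** Translation is continuous for the integral norm: the values converge except where [t + v] is one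
    of finitely many discontinuities of [x], and [x] is bounded. The supremum norm would not allow
    this. *)
Lemma norm_D_hist_cvg (T : R) x (s : nat -> R) t : pwc (- q) T x ->
  (forall n, 0 <= s n <= T) -> 0 <= t <= T -> s n @[n --> \oo] --> t ->
  norm_D q (fun v => hist x (s n) v - hist x t v) @[n --> \oo] --> (0 : R).
Proof.
move=> px sT tT st; have [M HM] := pwc_bounded px; have [l Hl] := px.
have hT u v : 0 <= u <= T -> - q <= v <= 0 -> - q <= u + v <= T.
  by move=> /andP[u0 uT] /andP[v0 v1]; apply/andP; split; lra.
rewrite -(mulr0 q^-1); apply: cvgMr; apply: fine_cvg0.
have [||||| _ _] := @dominated_convergence _ _ R leb `[- q, 0]%classic (measurable_itv _)
  (fun n v => (`|hist x (s n) v - hist x t v|)%:E) (fun=> 0%E) (fun=> (M + M)%:E).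
- move=> n; apply/measurable_EFinP; apply: pwc_measurable_norm; apply: pwcB;
    apply/in_D_pwc; exact: in_D_hist px _.
- exact: measurable_cst.
- apply: (ae_mono (ae_notin [seq p - t | p <- l])) => v vl /=; rewrite in_itv /= => vI.
  apply: cvg_EFin; first exact: nearW.
  rewrite -(@normr0 _ X) -(subrr (x (t + v))); apply: cvg_norm; apply: cvgB; last exact: cvg_cst.
  have [/(_ _)/limatP h _ _] := Hl _ (hT _ _ tT vI).
  have {}h : x w @[w --> within `[- q, T] (nbhs (t + v))] --> x (t + v).
    by apply: h; apply: contra vl => tl; apply/mapP; exists (t + v) => //; rewrite addrC addKr.
  apply: (@cvg_comp _ _ _ (fun n => s n + v) x \oo (within `[- q, T] (nbhs (t + v)))) h.
  move=> U AU; have sv : s n + v @[n --> \oo] --> t + v.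
    by apply: cvgD; [exact: st|exact: cvg_cst].
  have H : \forall n \near \oo, `[- q, T]%classic (s n + v) -> U (s n + v) := sv _ AU.
  by apply: (filterS _ H) => n /=; apply; rewrite in_itv /= hT.
- exact: integrable_cst_itv.
- apply: ae_true => v n /=; rewrite in_itv /= normr_id lee_fin => vI.
  by apply: le_trans (ler_normB _ _) _; rewrite lerD ?HM ?hT.
by rewrite integral0.
Qed.
End SeminormD.

(** * Impulse times and the space PC *)

Section ImpulseTimes.
Context {R : realType} (T : R) (N : nat) (t_ s_ : nat -> R).
Hypothesis times : impulse_times T N t_ s_.

Lemma times_s i : (i <= N)%N -> t_ i <= s_ i /\ s_ i <= t_ i.+1.
Proof.
have [[t0 s0] t1 H _ _] := times; case: i => [_|i iN]; last exact: H.
by rewrite t0 s0 lexx ltW.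
Qed.

Lemma times_step i : (i <= N)%N -> t_ i <= t_ i.+1.
Proof. by move=> /times_s[]; apply: le_trans. Qed.

Lemma times_mono i j : (i <= j)%N -> (j <= N.+1)%N -> t_ i <= t_ j.
Proof.
move=> ij; elim: j ij => [|j IH]; first by rewrite leqn0 => /eqP ->.
rewrite leq_eqVlt => /predU1P[->|ij] //; rewrite ltnS => jN.
by apply: le_trans (times_step jN); apply: IH; rewrite // (leq_trans jN).
Qed.

Lemma times_t0 : t_ 0%N = 0. Proof. by case: times => -[]. Qed.
Lemma times_s0 : s_ 0%N = 0. Proof. by case: times => -[]. Qed.
Lemma times_tT : t_ N.+1 = T. Proof. by case: times. Qed.

Lemma times_in i : (i <= N.+1)%N -> 0 <= t_ i <= T.
Proof. by move=> iN; rewrite -times_t0 -times_tT !times_mono. Qed.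

Lemma times_t_gt0 i : (1 <= i)%N -> (i <= N.+1)%N -> 0 < t_ i.
Proof.
have [_ t1 _ _ _] := times; move=> i1 iN; apply: lt_le_trans t1 _.
exact: times_mono.
Qed.

Lemma times_T_gt0 : 0 < T.
Proof. by rewrite -times_tT times_t_gt0. Qed.

Lemma times_s_in i : (i <= N)%N -> 0 <= s_ i <= T.
Proof.
move=> iN; have [h1 h2] := times_s iN.
have /andP[h3 _] := times_in (leqW iN).
have /andP[_ h4] : 0 <= t_ i.+1 <= T by apply: times_in.
by rewrite (le_trans h3 h1) (le_trans h2 h4).
Qed.

Lemma times_cover_left p : 0 < p <= T -> exists2 i, (i <= N)%N & t_ i < p <= t_ i.+1.
Proof.
move=> /andP[p0 pT].
have ex : exists i, p <= t_ i by exists N.+1; rewrite times_tT.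
case: (ex_minnP ex) => -[|i] pi min.
  by move: pi; rewrite times_t0 leNgt p0.
have iN : (i <= N)%N by rewrite -ltnS min // times_tT.
exists i => //; rewrite pi andbT ltNge; apply/negP => /min.
by rewrite ltnn.
Qed.

Lemma times_cover_right p : 0 <= p < T -> exists2 i, (i <= N)%N & t_ i <= p < t_ i.+1.
Proof.
move=> /andP[p0 pT].
have ex : exists i, p < t_ i by exists N.+1; rewrite times_tT.
case: (ex_minnP ex) => -[|i] pi min.
  by move: pi; rewrite times_t0 ltNge p0.
have iN : (i <= N)%N by rewrite -ltnS min // times_tT.
exists i => //; rewrite pi andbT leNgt; apply/negP => /min.
by rewrite ltnn.
Qed.

Lemma times_uniq i j p : (i <= N)%N -> (j <= N)%N ->
  t_ i < p <= t_ i.+1 -> t_ j < p <= t_ j.+1 -> i = j.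
Proof.
wlog ij : i j / (i <= j)%N.
  move=> W iN jN hi hj; have [ij|/ltnW ji] := leqP i j; first exact: W.
  by apply/esym; apply: W.
move=> iN jN /andP[_ h1] /andP[h2 _]; apply/eqP; rewrite eqn_leq ij leqNgt.
apply/negP => ltij; have := times_mono ltij (leqW jN).
by rewrite leNgt (lt_le_trans h2 h1).
Qed.

Section PCLemmas.
Context {X : completeNormedModType R}.
Implicit Types x z : R -> X.

Lemma PCP x : PC T N t_ x <->
  [/\ forall i p, (i <= N)%N -> t_ i < p <= t_ i.+1 ->
        lim_at [set v | t_ i < v <= t_ i.+1] x p (x p),
      forall i, (i <= N)%N -> exists y,
        lim_at [set v | v <= T /\ t_ i < v] x (t_ i) y &
      forall i, (1 <= i <= N)%N -> lim_at [set v | v < t_ i] x (t_ i) (x (t_ i))].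
Proof.
have rt i : (i <= N)%N -> [set v | `[0, T]%classic v /\ t_ i < v] =
    [set v | v <= T /\ t_ i < v].
  move=> iN; apply/seteqP; split=> v /=; rewrite in_itv /=; first by case=> /andP[].
  case=> -> tv; rewrite tv; have /andP[h _] := times_in (leqW iN).
  by rewrite (le_trans h (ltW tv)).
have itvE i : (`]t_ i, t_ i.+1]%classic : set R) = [set v | t_ i < v <= t_ i.+1].
  by apply/seteqP; split=> v /=; rewrite in_itv.
split=> -[H1 H2 H3]; split.
- move=> i p iN pI; have /within_contP := H1 i iN; rewrite itvE; exact.
- by move=> i iN; have [y /limat_rightP h] := H2 i iN; exists y; rewrite -rt.
- by move=> i iN; apply/limat_atleftP/H3.
- move=> i iN; apply/within_contP => p; rewrite /= in_itv /= => pI.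
  by rewrite itvE; apply: H1.
- by move=> i iN; have [y h] := H2 i iN; exists y; apply/limat_rightP; rewrite rt.
- by move=> i iN; apply/limat_atleftP/H3.
Qed.

Lemma PC_pwc q phi x : 0 < q -> in_D q phi -> (forall t, t < 0 -> x t = phi t) ->
  PC T N t_ x -> pwc (- q) T x.
Proof.
move=> q0 /in_D_pwc[l Hl] xphi /PCP[H1 H2 H3].
(* The exceptional points are those of [phi] and all the impulse times; [t_ 0 = 0] is among them, so
   nothing has to match between [phi] and the values after 0. *)
exists (l ++ [seq t_ i | i <- iota 0 N.+2]) => s /andP[qs sT].
have q0' : - q <= 0 <= (0 : R) by rewrite lexx oppr_le0 ltW.
have [s0|s0|s0] := ltgtP s 0.
- have sq : - q <= s <= 0 by rewrite qs ltW.
  have [h1 [y h2] [y' h3]] := Hl _ sq; have ns : 0 < - s by rewrite oppr_gt0.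
  have neg v : `|v - s| < - s -> v < 0 by rewrite ltr_norml => /andP[_]; lra.
  split.
  + rewrite mem_cat negb_or xphi // => /andP[/h1 h _].
    apply: limat_eq ns _ h => v /=; rewrite !in_itv /= => /andP[-> _] /neg v0.
    by rewrite xphi // ltW.
  + exists y; apply: limat_eq ns _ h2 => v /= [qv vs] /neg v0.
    by rewrite xphi.
  + exists y'; apply: limat_eq ns _ h3 => v /= [qv vs] /neg v0.
    by rewrite xphi // ltW.
- have /times_cover_left[i iN siI] : 0 < s <= T by rewrite s0.
  have /andP[ti ti1] := siI; have dt : 0 < s - t_ i by rewrite subr_gt0.
  have near_t v : v <= s -> `|v - s| < s - t_ i -> t_ i < v <= t_ i.+1.
    move=> vs; rewrite ltr_norml => /andP[h _]; apply/andP; split; first by lra.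
    exact: le_trans ti1.
  split.
  + rewrite mem_cat negb_or => /andP[_ snt].
    have ti1' : s < t_ i.+1.
      rewrite lt_neqAle ti1 andbT; apply: contra snt => /eqP ->.
      by apply/mapP; exists i.+1; rewrite // mem_iota.
    have := H1 i s iN siI; apply: (limat_eq (d0 := Num.min (s - t_ i) (t_ i.+1 - s))).
      by rewrite lt_min dt subr_gt0.
    move=> v _; rewrite lt_min => /andP[v1 v2]; split=> //=.
    by move: v1 v2; rewrite !ltr_norml => /andP[? ?] /andP[? ?]; apply/andP; split; lra.
  + exists (x s); have := H1 i s iN siI; apply: limat_eq dt _ => v /= [_ vs] vd.
    by split=> //; apply: near_t => //; apply: ltW.
  + have [e1|ne1] := eqVneq s (t_ i.+1).
      have [iN1|] := ltnP i N; last first.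
        move=> Ni; exists 0; apply: (limatS (P := set0)) => [v /= [vT sv]|e e0]; last first.
          by exists 1.
        have ii : i = N by apply/eqP; rewrite eqn_leq iN.
        by move: (lt_le_trans sv vT); rewrite e1 ii times_tT ltxx.
      have [y hy] := H2 i.+1 iN1; exists y; rewrite e1; apply: limatS hy => v /=.
      by [].
    exists (x s); have := H1 i s iN siI.
    have lt1 : s < t_ i.+1 by rewrite lt_neqAle ne1.
    apply: (limat_eq (d0 := t_ i.+1 - s)) => [|v /= [vT sv] vs]; first by rewrite subr_gt0.
    split=> //; move: vs; rewrite ltr_norml => /andP[_ h].
    by rewrite (lt_trans ti sv) /= ltW //; lra.
- have [h1 [y h2] [y' h3]] := Hl _ q0'; rewrite s0; split.
  + rewrite mem_cat negb_or -times_t0 => /andP[_ /negP[]].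
    by apply/mapP; exists 0%N; rewrite // mem_iota.
  + exists y; apply: (limat_eq ltr01) h2 => v /= [qv v0] _; split=> //.
    by rewrite xphi.
  + by have [w hw] := H2 0%N (leq0n _); rewrite times_t0 in hw; exists w.
Qed.

Lemma PC_pieces x (c : nat -> R -> X) : (forall i, (i <= N)%N -> continuous (c i)) ->
  (forall i t, (i <= N)%N -> t_ i < t <= t_ i.+1 -> x t = c i t) ->
  PC T N t_ x.
Proof.
move=> cc xc; apply/PCP; split.
- move=> i p iN pI; rewrite (xc _ _ iN pI).
  apply: (limat_eq ltr01 (P := setT) (x := c i)) => [v /= vI _|].
    by rewrite (xc i).
  exact/continuous_limat/cc.
(* Some intervals may be empty, so the right limit at [t_ i] is read on the interval with index
   [j >= i] that really follows it. At [T] nothing follows and any value will do. *)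
- move=> i iN; have /andP[t0 tT] := times_in (leqW iN).
  have [ltT|] := ltP (t_ i) T; last first.
    move=> Tt; exists 0; apply: (limatS (P := set0)) => [v /= [vT tv]|e e0]; last by exists 1.
    by move: (lt_le_trans tv (le_trans vT Tt)); rewrite ltxx.
  have /times_cover_right[j jN /andP[tj tj1]] : 0 <= t_ i < T by rewrite t0.
  have ij : (i <= j)%N.
    rewrite leqNgt; apply/negP => ji; have := times_mono ji (leqW iN).
    by rewrite leNgt tj1.
  have e : t_ j = t_ i by apply/eqP; rewrite eq_le tj times_mono // leqW.
  exists (c j (t_ i)); apply: (limat_eq (d0 := t_ j.+1 - t_ i) (P := setT) (x := c j)).
  + by rewrite subr_gt0.
  + move=> v /= [vT tv]; rewrite ltr_norml => /andP[_ h]; split=> //.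
    by apply: xc => //; rewrite e tv /= ltW //; lra.
  + exact/continuous_limat/cc.
- move=> i /andP[i1 iN].
  have /times_cover_left[j jN tI] : 0 < t_ i <= T.
    by rewrite times_t_gt0 ?leqW //; have /andP[_] := times_in (leqW iN).
  have /andP[tj tj1] := tI; rewrite (xc _ _ jN tI).
  apply: (limat_eq (d0 := t_ i - t_ j) (P := setT) (x := c j)).
  + by rewrite subr_gt0.
  + move=> v /= vt; rewrite ltr_norml => /andP[h _]; split=> //.
    by apply: xc => //; apply/andP; split; [lra|rewrite (le_trans (ltW vt))].
  + exact/continuous_limat/cc.
Qed.

Lemma PC_sum (I : finType) (a : I -> R) (v : I -> R -> X) :
  (forall i, PC T N t_ (v i)) -> PC T N t_ (fun t => \sum_i a i *: v i t).
Proof.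
move=> Hv; have {}Hv i := proj1 (PCP (v i)) (Hv i); apply/PCP; split.
- by move=> i p iN pI; apply: limat_sum => k; have [h _ _] := Hv k; apply: h.
- move=> i iN; have /choice[y Hy] : forall k, exists y,
      lim_at [set w | w <= T /\ t_ i < w] (v k) (t_ i) y.
    by move=> k; have [_ h _] := Hv k; apply: h.
  by exists (\sum_k a k *: y k); apply: limat_sum.
- by move=> i iN; apply: limat_sum => k; have [_ _ h] := Hv k; apply: h.
Qed.

Lemma PC_unif (x : nat -> R -> X) z : (forall n, PC T N t_ (x n)) ->
  unif_cvg `[0, T]%classic x z -> PC T N t_ z.
Proof.
move=> Hx xz; have {}Hx n := proj1 (PCP (x n)) (Hx n); apply/PCP.
have inT i v : (i <= N)%N -> t_ i < v <= t_ i.+1 -> `[0, T]%classic v.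
  move=> iN /andP[h1 h2]; rewrite /= in_itv /=.
  have /andP[h3 _] := times_in (leqW iN).
  have /andP[_ h4] : 0 <= t_ i.+1 <= T by apply: times_in.
  by rewrite (le_trans h3 (ltW h1)) (le_trans h2).
split.
- move=> i p iN pI; apply: (limat_unif_at xz); first exact: inT pI.
    by exists 1 => // v vI _; apply: inT vI.
  by move=> n; have [h _ _] := Hx n; apply: h.
- move=> i iN; apply: (limat_unif xz).
    exists 1 => // v /= [vT tv] _; rewrite in_itv /= vT andbT.
    by have /andP[h _] := times_in (leqW iN); apply: le_trans h (ltW tv).
  by move=> n; have [_ h _] := Hx n; apply: h.
- move=> i /andP[i1 iN]; have /andP[h1 h2] := times_in (leqW iN).
  have h0 := times_t_gt0 i1 (leqW iN).
  apply: (limat_unif_at xz); first by rewrite /= in_itv /= h1.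
    exists (t_ i) => // v /= vt; rewrite ltr_norml in_itv /= => /andP[h3 _].
    by rewrite (le_trans (ltW vt)) // andbT; lra.
  by move=> n; have [_ _ h] := Hx n; apply: h; rewrite i1.
Qed.

Lemma PC_left_lim x i : (1 <= i <= N)%N -> PC T N t_ x -> left_lim x (t_ i) = x (t_ i).
Proof. by move=> iN [_ _ /(_ i iN) h]; apply/cvg_lim. Qed.

Lemma norm_PC_le x (c : R) : (forall t, 0 <= t <= T -> `|x t| <= c) -> norm_PC T x <= c.
Proof.
move=> H; apply: ge_sup => [|_ [t + <-]]; last by rewrite /= in_itv; apply: H.
by exists `|x 0|, 0 => //=; rewrite in_itv /= lexx ltW // times_T_gt0.
Qed.
End PCLemmas.
End ImpulseTimes.

(** * The mean value inequality and the evolution operator *)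

Section MeanValue.
Context {R : realType} {V : normedModType R}.
Implicit Types f : R -> V.

Lemma is_derive_inP (I : set R) f t d : is_derive_in I f t d <->
  forall e : R, 0 < e -> exists2 r : R, 0 < r &
    forall h, h != 0 -> I (t + h) -> `|h| < r -> `|h^-1 *: (f (t + h) - f t) - d| < e.
Proof.
split=> [/cvgrPdist_lt H e e0|H].
  have /nbhs_ballP[r r0 Hr] := H _ e0; exists r => // h h0 Ih hr.
  by rewrite distrC; apply: Hr => //; rewrite -ball_normE /= sub0r normrN.
apply/cvgrPdist_lt => e e0; have [r r0 Hr] := H _ e0.
apply/nbhs_ballP; exists r => // h; rewrite -ball_normE /= sub0r normrN => hr h0 Ih.
by rewrite distrC; apply: Hr.
Qed.

Lemma is_derive_in_limat (I : set R) f t d : is_derive_in I f t d ->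
  lim_at I f t (f t).
Proof.
move=> /is_derive_inP /(_ _ ltr01)[r r0 Hr] e e0.
have k0 : 0 < `|d| + 1 by rewrite ltr_wpDl.
exists (Num.min r (e / (`|d| + 1))); first by rewrite lt_min r0 divr_gt0.
move=> v Iv; rewrite lt_min => /andP[vr ve].
have [->|vt] := eqVneq v t; first by rewrite subrr normr0.
have h0 : v - t != 0 by rewrite subr_eq0.
have := Hr (v - t) h0; rewrite subrKC => /(_ Iv vr) lt1.
have -> : f v - f t = (v - t) *: ((v - t)^-1 *: (f v - f t)).
  by rewrite scalerA divff // scale1r.
rewrite normrZ; move: ve; rewrite ltr_pdivlMr //; apply: le_lt_trans.
apply: ler_wpM2l => //; rewrite -lerBlDl.
by apply: le_trans (lerB_dist _ _) (ltW lt1).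
Qed.
End MeanValue.

Lemma is_derive_in_real (R : realType) (a b t d : R) (g : R -> R) : a < t < b ->
  is_derive_in (V := R^o) `[a, b] g t d -> is_derive t 1 g d.
Proof.
move=> /andP[at_ tb] /is_derive_inP H.
suff cg : h^-1 *: ((g \o shift t) (h *: 1) - g t) @[h --> 0^'] --> (d : R^o).
  by split; [apply/cvg_ex; exists d|exact/cvg_lim].
apply/cvgrPdist_lt => e e0; have [r r0 Hr] := H _ e0.
apply/nbhs_ballP; exists (Num.min r (Num.min (t - a) (b - t))).
  by rewrite /= !lt_min r0 !subr_gt0 at_.
move=> h; rewrite -ball_normE /= sub0r normrN !lt_min => /and3P[hr ha hb] h0.
rewrite distrC /shift /= [h *: 1]mulr1 (addrC h t).
apply: Hr => //; rewrite /= in_itv /=.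
by move: ha hb; rewrite !ltr_norml => /andP[? ?] /andP[? ?]; apply/andP; split; lra.
Qed.

Section MeanValue2.
Context {R : realType} {V : completeNormedModType R}.
Context (J : V -> (V -> R^o)) (dualJ : duality_map J).

(** The scalar mean value theorem is applied to [l \o f] for each functional [l]; [norm_le_dual]
    recovers the norm. *)
Lemma mean_value_le (a b k : R) (f f' : R -> V) : 0 <= k ->
  (forall t, a <= t <= b -> is_derive_in `[a, b] f t (f' t) /\ `|f' t| <= k) ->
  forall s t, a <= s <= b -> a <= t <= b -> `|f s - f t| <= k * `|s - t|.
Proof.
move=> k0 H s t; wlog st : s t / s <= t.
  move=> W sI tI; have [|/ltW] := leP s t; first by move=> ?; apply: W.
  by rewrite distrC (distrC s) => ?; apply: W.
move=> /andP[as_ sb] /andP[at_ tb].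
have [->|neq] := eqVneq s t; first by rewrite !subrr !normr0 mulr0.
have {st}st : s < t by rewrite lt_neqAle neq.
rewrite distrC (distrC s) (gtr0_norm (_ : 0 < t - s)) ?subr_gt0 //.
apply: (norm_le_dual dualJ) => [|l dl]; first by rewrite mulr_ge0 // subr_ge0 ltW.
rewrite dualB //.
have dl' u : s < u < t -> is_derive u 1 (fun v => l (f v) : R) (l (f' u)).
  move=> /andP[su ut]; have uI : a <= u <= b.
    by rewrite (le_trans as_ (ltW su)) (le_trans (ltW ut)).
  have [/is_derive_inP du _] := H u uI.
  apply: (@is_derive_in_real R s t); first by rewrite su.
  apply/is_derive_inP => e e0; have n0 : 0 < opnorm l + 1.
    by rewrite ltr_wpDl // (opnorm_ge0 dl).
  have [r r0 Hr] := du _ (divr_gt0 e0 n0); exists r => // h h0 hI hr.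
  rewrite -dualB // -[_ *: (l _)](dualZ dl) -dualB //.
  apply: le_lt_trans (dual_le dl _) _.
  have {}hI : `[a, b]%classic (u + h) by apply: itvS hI.
  have := Hr h h0 hI hr; rewrite ltr_pdivlMr // mulrC; apply: le_lt_trans.
  by rewrite ler_wpM2r // lerDl.
have cl : {within `[s, t], continuous (fun v => l (f v) : R)}.
  apply/(@within_contP R R^o) => p; rewrite /= in_itv /= => /andP[sp pt].
  have pI : a <= p <= b by rewrite (le_trans as_ sp) (le_trans pt).
  have [/is_derive_in_limat fp _] := H p pI.
  have /limatP {}fp := limatS (@itvS R a b s t as_ tb) fp.
  by apply/limatP; apply: (cvg_comp _ _ fp); apply: blin_continuous.
have [c cI ->] := MVT st dl' cl.
rewrite normrM (gtr0_norm (_ : 0 < t - s)) ?subr_gt0 // mulrA.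
apply: ler_wpM2r; first by rewrite subr_ge0 ltW.
apply: le_trans (dual_le dl _) _; apply: ler_wpM2l; first exact: (opnorm_ge0 dl).
move: cI; rewrite in_itv /= => /andP[sc ct]; apply: (proj2 (H c _)).
by rewrite (le_trans as_ (ltW sc)) (le_trans (ltW ct)).
Qed.
End MeanValue2.

(** * Estimates for the evolution operator *)

Section Evolution.
Context {R : realType} {X : completeNormedModType R}.
Context (J : X -> (X -> R^o)) (dualJ : duality_map J) (sepX : separable X).
Context (T M Mt : R) (C0 F : R -> X -> X) (S : R -> R -> X -> X).
Hypothesis T_gt0 : 0 < T.
Hypothesis M_ge0 : 0 <= M.
Hypothesis Mt_ge0 : 0 <= Mt.
Hypothesis evolS : evolution_operator T M Mt C0 F S.
Notation I t := (0 <= t <= T).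
Notation C := (cosop T S).

Lemma evol_S_blin t s : I t -> I s -> bounded_linear (S t s).
Proof. by move=> It Is; have [] := evol_bounded evolS (t := t) (s := s); rewrite ?in_itv. Qed.

Lemma evol_C_blin t s : I t -> I s -> bounded_linear (C t s).
Proof. by move=> It Is; have [] := evol_bounded evolS (t := t) (s := s); rewrite ?in_itv. Qed.

Lemma evol_S_le t s x : I t -> I s -> `|S t s x| <= Mt * `|x|.
Proof.
move=> It Is; apply: opnorm_leW; first exact: evol_S_blin.
by apply: (evol_sin_le evolS); rewrite in_itv.
Qed.

Lemma evol_C_le t s x : I t -> I s -> `|C t s x| <= M * `|x|.
Proof.
move=> It Is; apply: opnorm_leW; first exact: evol_C_blin.
by apply: (evol_cos_le evolS); rewrite in_itv.
Qed.

Lemma evol_S_lip1 : exists2 L : R, 0 <= L & forall t1 t2 s x, I t1 -> I t2 -> I s ->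
  `|S t1 s x - S t2 s x| <= L * `|t1 - t2| * `|x|.
Proof.
have [L HL] := evol_lipschitz evolS; exists `|L| => // t1 t2 s x I1 I2 Is.
have b1 := evol_S_blin I1 Is; have b2 := evol_S_blin I2 Is.
have bl : bounded_linear (fun x => S t1 s x - S t2 s x).
  split=> [k u v|].
    by rewrite (blin_D b1) (blin_D b2) (blin_Z b1) (blin_Z b2) scalerBr opprD addrACA.
  exists (Mt + Mt) => u; apply: le_trans (ler_normB _ _) _.
  by rewrite mulrDl lerD // evol_S_le.
apply: (opnorm_leW bl); apply: le_trans (HL _ _ _ _ _ _) _; rewrite ?in_itv //.
by rewrite ler_wpM2r // ler_norm.
Qed.

Lemma evol_S_derive t s x : I t -> I s ->
  is_derive_in `[0, T] (fun s => S t s x) s (- C t s x).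
Proof.
move=> It Is; have [[_ /(_ t s) H _ _] _] := evol_D1 evolS x.
have Jt : `[0, T]%classic t by rewrite /= in_itv.
have Js : `[0, T]%classic s by rewrite /= in_itv.
have [d Hd] := H Jt Js; rewrite /cosop opprK /d2 /derive_in.
by case: xgetP => [y _ //|/(_ d)].
Qed.

(** The derivative in the second variable is the opposite of [C], hence bounded by [M]. *)
Lemma evol_S_lip2 t s1 s2 x : I t -> I s1 -> I s2 ->
  `|S t s1 x - S t s2 x| <= M * `|s1 - s2| * `|x|.
Proof.
move=> It I1 I2; rewrite mulrAC.
apply: (mean_value_le dualJ (a := 0) (b := T) (f := fun s => S t s x) (f' := fun s => - C t s
  x)) => //.
  by rewrite mulr_ge0.
by move=> s Is; split; [exact: evol_S_derive|rewrite normrN evol_C_le].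
Qed.

Lemma evol_S_tt t x : I t -> S t t x = 0.
Proof.
by move=> It; have [_ /(_ t)[|]] := evol_D1 evolS x; rewrite /= ?in_itv.
Qed.

Lemma evol_C_tt t x : I t -> C t t x = x.
Proof.
move=> It; have [_ /(_ t)[|_ _ e]] := evol_D1 evolS x; first by rewrite /= in_itv.
by rewrite /cosop e opprK.
Qed.

Lemma evol_C_cont s x : I s -> {within `[0, T], continuous (fun t => C t s x)}.
Proof.
move=> Is; have [[_ _ _ /subspace_continuousP H] _] := evol_D1 evolS x.
apply/subspace_continuousP => t Jt.
apply: cvgN; have := H (t, s); rewrite /from_subspace /= => {}H.
have Js : `[0, T]%classic s by rewrite /= in_itv.
have {}H := H (conj Jt Js).
have K : (t', s) @[t' --> within `[0, T] (nbhs t)] -->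
    within (`[0, T] `*` `[0, T]) (nbhs (t, s)).
  move=> U AU.
  have /nbhs_ballP[e e0 He] : nbhs (t, s)
    [set p | (`[0, T] `*` `[0, T])%classic p -> U p] := AU.
  apply/nbhs_ballP; exists e => // t' tt' Jt'; apply: He => //.
  by split=> //=; apply: ballxx.
exact: (cvg_comp _ _ K H).
Qed.

Lemma evol_S_cont2 t x : I t -> {within `[0, T], continuous (fun s => S t s x)}.
Proof.
move=> It; apply/within_contP => s Js; have Is : I s by move: Js; rewrite /= in_itv.
by apply: is_derive_in_limat; exact: evol_S_derive.
Qed.

Lemma smeasurable_S t a b (G : R -> X) : I t -> 0 <= a -> b <= T ->
  smeasurable `[a, b] G -> smeasurable `[a, b] (fun s => S t s (G s)).
Proof.
move=> It a0 bT mG.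
apply: (smeasurable_ae (F := fun s => S t (clamp 0 T s) (G s))).
  apply: ae_true => s /=; rewrite in_itv /= => /andP[as_ sb].
  by rewrite clamp_id // (le_trans a0 as_) (le_trans sb).
apply: (smeasurable_param sepX mG (Phi := fun s v => S t (clamp 0 T s) v)).
  move=> v; apply: continuous_nmeasurable; apply: (within_clamp (f := fun s => S t s v)); first
    exact: ltW.
  exact: evol_S_cont2.
move=> s; apply: blin_continuous; apply: evol_S_blin => //.
by apply: clamp_in; apply: ltW.
Qed.
End Evolution.

(** * The resolvent and the controls *)

Lemma limat_lipschitz (R : realType) (V : normedModType R) (P : set R)
    (f : R -> V) (p k : R) : 0 <= k -> (forall v, P v -> `|f v - f p| <= k * `|v - p|) ->
  lim_at P f p (f p).
Proof.
move=> k0 H e e0; have k1 : 0 < k + 1 by rewrite ltr_wpDl.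
exists (e / (k + 1)); first by rewrite divr_gt0.
move=> v Pv; rewrite ltr_pdivlMr // => ve; apply: le_lt_trans (H v Pv) _.
by apply: le_lt_trans ve; rewrite mulrC ler_wpM2l // lerDl.
Qed.

Section DualExtra.
Context {R : realType} {V : normedModType R}.

Lemma dual_sub (p p' : V -> R^o) : dual p -> dual p' -> dual (fun x => p x - p' x : R^o).
Proof.
move=> dp dp'; split=> [k x y|].
  by rewrite (dualD dp) (dualD dp') (dualZ dp) (dualZ dp') -[k *: _]/(k * _); ring.
exists (opnorm p + opnorm p') => x; apply: le_trans (ler_normB _ _) _.
by rewrite mulrDl lerD // dual_le.
Qed.

Lemma dual_zero : dual (fun _ : V => 0 : R^o).
Proof.
split=> [k x y|]; first by rewrite scaler0 addr0.
by exists 0 => x; rewrite normr0 mul0r.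
Qed.

Lemma dual_comp (W : normedModType R) (p : V -> R^o) (L : W -> V) :
  dual p -> bounded_linear L -> dual (p \o L : W -> R^o).
Proof.
move=> dp bL; split=> [k x y|].
  by rewrite /= (blin_D bL) (blin_Z bL) (dualD dp) (dualZ dp).
exists (opnorm p * opnorm L) => x; apply: le_trans (dual_le dp _) _.
by rewrite -mulrA ler_wpM2l ?(opnorm_ge0 dp) // opnorm_le.
Qed.

Context (J : V -> (V -> R^o)) (dualJ : duality_map J).

Lemma duality_dual x : dual (J x). Proof. by case: (dualJ x). Qed.

Lemma duality_norm x : opnorm (J x) = `|x|.
Proof.
have [dJ _ nJ] := dualJ x.
by apply/eqP; rewrite -(eqrXn2 (n := 2)) ?nJ // (opnorm_ge0 dJ).
Qed.

Lemma duality_le x y : `|J x y| <= `|x| * `|y|.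
Proof. by rewrite -duality_norm; apply: dual_le; apply: duality_dual. Qed.

Lemma duality_self x : J x x = `|x| ^+ 2.
Proof. by case: (dualJ x). Qed.

(** The left side is hidden in |x|^2 + |y|^2 - J x y - J y x, which is at least (|x| - |y|)^2. *)
Lemma duality_monotone x y : 0 <= (J x (x - y) - J y (x - y) : R).
Proof.
rewrite !(dualB (duality_dual _)) !duality_self.
have := duality_le x y; have := duality_le y x; rewrite !ler_norml.
move=> /andP[_ h1] /andP[_ h2].
have := sqr_ge0 (`|x| - `|y|); rewrite sqrrB; lra.
Qed.
End DualExtra.

Section Control.
Context {R : realType} {X U : completeNormedModType R}.
Context (J : X -> (X -> R^o)) (dualJ : duality_map J) (sepX : separable X).
Context (T M Mt : R) (C0 F : R -> X -> X) (S : R -> R -> X -> X).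
Hypothesis T_gt0 : 0 < T.
Hypothesis M_ge0 : 0 <= M.
Hypothesis Mt_ge0 : 0 <= Mt.
Hypothesis evolS : evolution_operator T M Mt C0 F S.
Context (dot : U -> U -> R) (hilbU : inner_product dot).
Context (B : U -> X) (MB : R) (linB : bounded_linear B) (B_le : opnorm B <= MB).
Context (Bs : (X -> R^o) -> U) (adjB : adjoint_to dot B Bs).
Context (Res : R -> R -> R -> X -> X) (resRes : resolvent T S B Bs J Res).
Notation I t := (0 <= t <= T).

Lemma MB_ge0 : 0 <= MB. Proof. exact: le_trans (opnorm_ge0 linB) B_le. Qed.

Lemma dotBl u v w : dot (u - v) w = dot u w - dot v w.
Proof.
have [lin _ _] := hilbU.
by rewrite addrC -scaleN1r lin mulN1r addrC.
Qed.

Lemma Bs_diff p p' u : dual p -> dual p' -> dot (Bs p - Bs p') u = p (B u) - p' (B u).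
Proof. by move=> dp dp'; rewrite dotBl !adjB. Qed.

(** The squared norm of the difference is its product with itself, which the adjoint relation turns
    into a value of [p - p']. Working with differences gives the bound of [Bs] and its Lipschitz
    estimates without proving [Bs] linear. *)
Lemma Bs_diff_le p p' k : dual p -> dual p' -> 0 <= k ->
  (forall x, `|(p x - p' x : R)| <= k * `|x|) -> `|Bs p - Bs p'| <= k * MB.
Proof.
move=> dp dp' k0 H; set v := Bs p - Bs p'.
have [->|v0] := eqVneq v 0; first by rewrite normr0 mulr_ge0 // MB_ge0.
have nv : 0 < `|v| by rewrite normr_gt0.
have [_ _ sq] := hilbU; rewrite -(ler_pM2r nv) -expr2 -sq Bs_diff //.
apply: le_trans (ler_norm _) _; apply: le_trans (H _) _.
by rewrite -mulrA ler_wpM2l //; apply: opnorm_leW.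
Qed.

Definition adj (p : X -> R^o) (b t : R) : U := Bs (p \o S b t).

Lemma adj_diff_le p p' k b t : dual p -> dual p' -> 0 <= k -> I b -> I t ->
  (forall x, `|(p x - p' x : R)| <= k * `|x|) -> `|adj p b t - adj p' b t| <= k * Mt * MB.
Proof.
move=> dp dp' k0 Ib It H.
have bS := evol_S_blin evolS Ib It.
apply: Bs_diff_le; [exact: dual_comp|exact: dual_comp|exact: mulr_ge0|].
move=> x /=; apply: le_trans (H _) _; rewrite -mulrA ler_wpM2l //.
exact: (evol_S_le evolS).
Qed.

Lemma adj_zero b t : adj (fun=> 0) b t = 0.
Proof.
have z : Bs (fun=> 0) = 0.
  have [_ _ sq] := hilbU; apply/eqP; rewrite -normr_eq0 -sqrf_eq0 -sq adjB //.
  exact: dual_zero.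
by rewrite /adj -[RHS]z.
Qed.

Lemma adj_le p b t : dual p -> I b -> I t -> `|adj p b t| <= opnorm p * Mt * MB.
Proof.
move=> dp Ib It; have d0 := @dual_zero R X.
have := @adj_diff_le p (fun=> 0) (opnorm p) b t dp d0 (opnorm_ge0 dp) Ib It.
by rewrite adj_zero subr0; apply=> x; rewrite subr0; apply: dual_le.
Qed.

Lemma adj_lip p b t t' : dual p -> I b -> I t -> I t' ->
  `|adj p b t - adj p b t'| <= opnorm p * M * MB * `|t - t'|.
Proof.
move=> dp Ib It It'; have bS := evol_S_blin evolS Ib It.
have bS' := evol_S_blin evolS Ib It'.
have np := opnorm_ge0 dp.
rewrite (mulrAC _ MB) ; apply: Bs_diff_le; [exact: dual_comp|exact: dual_comp| |].
  by rewrite !mulr_ge0.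
move=> x /=; rewrite -dualB //; apply: le_trans (dual_le dp _) _.
rewrite -!mulrA ler_wpM2l // mulrA.
exact: (evol_S_lip2 dualJ M_ge0 evolS).
Qed.

Lemma adj_cont p b a c : dual p -> I b -> 0 <= a -> c <= T ->
  {within `[a, c], continuous (adj p b)}.
Proof.
move=> dp Ib a0 cT; apply/within_contP => t; rewrite /= in_itv /= => tI.
have sub v : a <= v <= c -> I v.
  by move=> /andP[av vc]; rewrite (le_trans a0 av) (le_trans vc).
apply: (limat_lipschitz (k := opnorm p * M * MB)).
  by rewrite !mulr_ge0 ?MB_ge0 ?(opnorm_ge0 dp).
by move=> v; rewrite /= in_itv /= => /sub Iv; apply: adj_lip => //; apply: sub.
Qed.

Section Interval.
Variables (a b : R).
Hypothesis a_ge0 : 0 <= a.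
Hypothesis ab : a <= b.
Hypothesis bT : b <= T.

Let Ib : I b. Proof. by rewrite bT (le_trans a_ge0). Qed.
Let Isub t : a <= t <= b -> I t.
Proof. by move=> /andP[at_ tb]; rewrite (le_trans a_ge0 at_) (le_trans tb). Qed.

Let G p t : X := S b t (B (adj p b t)).

Let G_cont p : dual p -> {within `[a, b], continuous (G p)}.
Proof.
move=> dp; apply/within_contP => t; rewrite /= in_itv /= => tI.
have np := opnorm_ge0 dp; have MB0 := MB_ge0.
pose A := opnorm p * Mt * MB; pose A' := opnorm p * M * MB.
have A0 : 0 <= A by rewrite !mulr_ge0.
have A'0 : 0 <= A' by rewrite !mulr_ge0.
apply: (limat_lipschitz (k := M * (MB * A) + Mt * (MB * A'))).
  by rewrite addr_ge0 // !mulr_ge0.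
move=> v; rewrite /= in_itv /= => vI; have Iv := Isub vI; have It := Isub tI.
rewrite /G; set S1 := S b v; set S2 := S b t.
have -> : S1 (B (adj p b v)) - S2 (B (adj p b t)) =
    (S1 (B (adj p b v)) - S2 (B (adj p b v))) + S2 (B (adj p b v - adj p b t)).
  have bS2 : bounded_linear S2 := evol_S_blin evolS Ib It.
  by rewrite (blin_B linB) (blin_B bS2) addrA subrK.
apply: le_trans (ler_normD _ _) _; rewrite mulrDl lerD //.
  apply: le_trans (evol_S_lip2 dualJ M_ge0 evolS _ Ib Iv It) _.
  rewrite mulrAC ler_wpM2r // ler_wpM2l //.
  by apply: le_trans (opnorm_leW linB _ B_le) _; rewrite ler_wpM2l // adj_le.
apply: le_trans (evol_S_le evolS _ Ib It) _; rewrite -!mulrA ler_wpM2l //.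
apply: le_trans (opnorm_leW linB _ B_le) _; rewrite ler_wpM2l // mulrA.
by rewrite [leRHS]mulrA adj_lip.
Qed.

Let G_sint p : dual p -> sintegrable a b (G p).
Proof.
move=> dp; have np := opnorm_ge0 dp; have MB0 := MB_ge0.
apply: (sintegrable_dom (w := fun=> Mt * (MB * (opnorm p * Mt * MB)))).
- exact/within_smeasurable/G_cont.
- apply: ae_true => t /=; rewrite in_itv /= => /Isub It.
  apply: le_trans (evol_S_le evolS _ Ib It) _; rewrite ler_wpM2l //.
  by apply: le_trans (opnorm_leW linB _ B_le) _; rewrite ler_wpM2l // adj_le.
- exact: integrable_cst_itv.
Qed.

(** The Gramian structure: the adjoint of [S b t \o B] appears on both sides of the pairing, so
    [Psi] is monotone and the defect is exactly the squared L^2 distance of the controls. *)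
Lemma Psi_diff p p' : dual p -> dual p' ->
  (p (Psi S B Bs a b p - Psi S B Bs a b p') - p' (Psi S B Bs a b p - Psi S B Bs a b p') : R)
  = \int[leb]_(t in `[a, b]) `|adj p b t - adj p' b t| ^+ 2.
Proof.
move=> dp dp'; have dd := dual_sub dp dp'.
rewrite /Psi -/(G p) -/(G p') -(bintB dualJ sepX (G_sint dp) (G_sint dp')).
pose H t : X := G p t - G p' t.
have cH : {within `[a, b], continuous H}.
  apply/within_contP => t tI; apply: limatB.
    by have /within_contP := G_cont dp; apply.
  by have /within_contP := G_cont dp'; apply.
have aeH : ae_on `[a, b] H (fun t => H (clamp a b t)).
  by apply: ae_true => t /=; rewrite in_itv /= => /clamp_id ->.
have sH : sintegrable a b H by apply: sintegrableB => //; apply: G_sint.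
rewrite (bint_ae dualJ sepX aeH sH).
have cHc := within_clamp ab cH.
have nH : nintegrable a b (fun t => H (clamp a b t)).
  split; first exact: continuous_nmeasurable.
  apply: within_integrable; apply/(@within_contP R R^o) => t _.
  by apply: continuous_limat; apply: cvg_norm; apply: cHc.
rewrite (bint_dual dualJ sepX nH dd).
apply: eq_Rintegral => t /set_mem /=; rewrite in_itv /= => tI.
rewrite clamp_id // /H /G.
have bS := evol_S_blin evolS Ib (Isub tI).
rewrite -(blin_B bS) -(blin_B linB).
have dpS := dual_comp dp bS; have dpS' := dual_comp dp' bS.
by have [_ _ sq] := hilbU; rewrite -sq Bs_diff.
Qed.

Lemma Psi_zero : Psi S B Bs a b (fun=> 0) = 0.
Proof.
have d0 := @dual_zero R X.
apply/eqP; rewrite -normr_le0.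
apply: (le_trans (bint_norm_le dualJ sepX (w := fun=> 0) (G_sint d0) _ _)).
- apply: ae_true => t /=; rewrite in_itv /= => /Isub It.
  by rewrite /G adj_zero (blin_0 linB) (blin_0 (evol_S_blin evolS Ib It)) normr0.
- exact: integrable_cst_itv.
- by rewrite Rintegral_cst_itv // mul0r.
Qed.

Variable lam : R.
Hypothesis lam0 : 0 < lam.

Lemma resE y : lam *: Res lam a b y + Psi S B Bs a b (J (Res lam a b y)) = y.
Proof. by have [_ H] := resRes lam0 a_ge0 ab bT; apply: H. Qed.

Definition ctrl y t : U := Bs (J (Res lam a b y) \o S b t).

(** The difference of the two resolvent equations is paired with [J z - J z']. The term in [lam] is
    nonnegative by monotonicity and is dropped, the other one is given by [Psi_diff], and the norm
    of [J z - J z'] is at most |z| + |z'|. *)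
Lemma res_diff y y' :
  \int[leb]_(t in `[a, b]) `|ctrl y t - ctrl y' t| ^+ 2 <=
  (`|Res lam a b y| + `|Res lam a b y'|) * `|y - y'|.
Proof.
set z := Res lam a b y; set z' := Res lam a b y'.
have dz := duality_dual dualJ z; have dz' := duality_dual dualJ z'.
have e0 := Psi_diff dz dz'; rewrite /adj in e0; rewrite /ctrl -/z -/z' -e0.
have e : y - y' = lam *: (z - z') + (Psi S B Bs a b (J z) - Psi S B Bs a b (J z')).
  by rewrite -(resE y) -(resE y') -/z -/z' scalerBr opprD addrACA.
have e1 : (J z (y - y') - J z' (y - y') : R) = lam * (J z (z - z') - J z' (z - z')) +
   (J z (Psi S B Bs a b (J z) - Psi S B Bs a b (J z')) -
    J z' (Psi S B Bs a b (J z) - Psi S B Bs a b (J z'))).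
  rewrite e; move: (z - z') (Psi _ _ _ _ _ _ - _) => w P.
  by rewrite (dualD dz) (dualD dz') (dualZ dz) (dualZ dz'); ring.
have m := mulr_ge0 (ltW lam0) (duality_monotone dualJ z z').
have h1 := duality_le dualJ z (y - y'); have h2 := duality_le dualJ z' (y - y').
move: h1 h2; rewrite !ler_norml => /andP[_ h1] /andP[h2 _].
by rewrite mulrDl; lra.
Qed.

(** Pairing the resolvent equation with [J z] gives lam |z|^2 plus a nonnegative term, and this is
    at most |z| |y|. *)
Lemma res_le y : `|Res lam a b y| <= `|y| / lam.
Proof.
set z := Res lam a b y; have dz := duality_dual dualJ z.
have := Psi_diff dz (@dual_zero R X); rewrite Psi_zero !subr0.
set K := Rintegral _ _ _ => e1.
have K0 : 0 <= K by apply: Rintegral_ge0 => t _; apply: sqr_ge0.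
have := congr1 (fun v => J z v : R) (resE y); rewrite -/z (dualD dz) (dualZ dz) duality_self // e1.
have := duality_le dualJ z y; rewrite ler_norml => /andP[_ h] e2.
rewrite ler_pdivlMr //; have [->|z0] := eqVneq z 0; first by rewrite normr0 mul0r.
have nz : 0 < `|z| by rewrite normr_gt0.
rewrite -(ler_pM2l nz); move: h; rewrite -e2 expr2; move: K0.
by rewrite mulrCA mulrA [_ * lam]mulrC; lra.
Qed.

Lemma ctrl_le y t : I t -> `|ctrl y t| <= MB * Mt / lam * `|y|.
Proof.
move=> It; have dz := duality_dual dualJ (Res lam a b y).
apply: le_trans (adj_le dz Ib It) _; rewrite (duality_norm dualJ).
rewrite -mulrA mulrC [X in _ <= X](_ : _ = Mt * MB * (`|y| / lam)); last by ring.
by rewrite ler_wpM2l ?res_le // mulr_ge0 // MB_ge0.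
Qed.

Lemma ctrl_cont y : {within `[a, b], continuous (ctrl y)}.
Proof. by apply: adj_cont => //; apply: duality_dual. Qed.

Lemma ctrl_cvg (y_ : nat -> X) y : y_ n @[n --> \oo] --> y ->
  \int[leb]_(t in `[a, b]) `|ctrl (y_ n) t - ctrl y t| @[n --> \oo] --> (0 : R).
Proof.
move=> yy.
pose Q n := (`|Res lam a b (y_ n)| + `|Res lam a b y|) * `|y_ n - y|.
have Q0 : Q n @[n --> \oo] --> (0 : R).
  apply: (@squeeze_norm _ R^o _ _ _ _ _ (fun n => (`|y_ n| / lam + `|y| / lam) * `|y_ n - y|)).
    near=> n; rewrite subr0 ger0_norm ?mulr_ge0 ?addr_ge0 //.
    by rewrite ler_wpM2r // lerD // res_le.
  rewrite -(mulr0 (`|y| / lam + `|y| / lam)); apply: cvgM.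
    by apply: cvgD; [apply: cvgMl; exact: cvg_norm|exact: cvg_cst].
  rewrite -(@normr0 _ X) -(subrr y); apply: cvg_norm.
  by apply: cvgB; [exact: yy|exact: cvg_cst].
have cd n : {within `[a, b], continuous (fun t => `|ctrl (y_ n) t - ctrl y t| : R)}.
  apply/(@within_contP R R^o) => t tI; apply/limatP; apply: cvg_norm; apply/limatP.
  apply: limatB; first by have /within_contP := @ctrl_cont (y_ n); apply.
  by have /within_contP := @ctrl_cont y; apply.
have cd2 n : {within `[a, b], continuous (fun t => `|ctrl (y_ n) t - ctrl y t| ^+ 2 : R)}.
  apply/(@within_contP R R^o) => t tI; apply/limatP.
  have /(@within_contP R R^o)/(_ t tI)/limatP h := cd n.
  by rewrite expr2; under eq_fun do rewrite expr2; apply: cvgM.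
apply/cvgrPdist_lt => e e0.
have ba0 : 0 < b - a + 1 by rewrite ltr_wpDl // subr_ge0.
(* The inequality v <= h + v^2 / h replaces Cauchy-Schwarz: [h] makes the constant part integrate to
   less than [e / 2], and for this fixed [h] the L^2 part is eventually below [e / 2]. *)
pose h := e / (2 * (b - a + 1)).
have h0 : 0 < h by rewrite divr_gt0 // mulr_gt0.
have [n0 _ Hn] := cvgr_lt _ Q0 _ (mulr_gt0 h0 (divr_gt0 e0 (ltr0n R 2))).
exists n0 => // n nn; have {}Hn := Hn n nn.
rewrite distrC subr0 ger0_norm; last by apply: Rintegral_ge0.
have amgm v : 0 <= v -> v <= h + h^-1 * v ^+ 2.
  move=> v0; have [vh|hv] := leP v h.
    by rewrite (le_trans vh) // lerDl mulr_ge0 ?invr_ge0 ?sqr_ge0 // ltW.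
  apply: (@le_trans _ _ (h^-1 * v ^+ 2)); last by rewrite lerDr ltW.
  by rewrite ler_pdivlMl // expr2 ler_wpM2r // ltW.
apply: (@le_lt_trans _ _ (\int[leb]_(t in `[a, b]) (h + h^-1 * `|ctrl (y_ n) t - ctrl y t| ^+ 2))).
  apply: le_Rintegral => //.
  - exact: within_integrable (cd n).
  - apply: integrableDR; first exact: integrable_cst_itv.
    by apply: integrableZR; exact: within_integrable (cd2 n).
  - by move=> t _; apply: amgm.
have i2 := within_integrable (cd2 n).
rewrite RintegralD //; [|exact: integrable_cst_itv|exact: integrableZR].
rewrite Rintegral_cst_itv // RintegralZl //.
have le2 := res_diff (y_ n) y.
have lt1 : h * (b - a) < e / 2.
  rewrite /h invfM mulrA -mulrA gtr_pMr ?divr_gt0 //.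
  by rewrite mulrC ltr_pdivrMr // mul1r ltrDl.
have le3 : h^-1 * \int[leb]_(t in `[a, b]) `|ctrl (y_ n) t - ctrl y t| ^+ 2 < e / 2.
  rewrite mulrC ltr_pdivrMr // (mulrC _ h); exact: le_lt_trans le2 Hn.
by rewrite (splitr e) ltrD.
Unshelve. all: end_near. Qed.
End Interval.
End Control.

(** * Duhamel integrals *)

(** Stated without [udist], whose supremum is meaningful only for bounded differences; estimates
    made at each [t] then combine directly. *)
Definition ucolorable (R : realType) (P W : Type) (X : normedModType R)
    (K : set P) (D : set W) (v : P -> W -> X) : Prop :=
  forall e : R, 0 < e -> exists (C : finType) (c : P -> C),
    forall x y, K x -> K y -> c x = c y -> forall t, D t -> `|v x t - v y t| <= e.

Lemma ucolorable_udist (R : realType) (P W : Type) (X : normedModType R)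
    (K : set P) (D : set W) (v : P -> W -> X) :
  ucolorable K D v -> colorable K (fun x y => udist D (v x) (v y)).
Proof.
move=> H e e0; have [C [c Hc]] := H e e0; exists C, c => x y Kx Ky cxy.
by apply: udist_le; [exact: ltW|exact: Hc].
Qed.

(** The argument of Ascoli's theorem: the values are colored at the points of a finite grid, and the
    common Lipschitz constant takes care of the points between. *)
Lemma ucolorable_lipschitz (R : realType) (P : Type) (X : normedModType R)
    (K : set P) (v : P -> R -> X) (a b k : R) : a <= b -> 0 <= k ->
  (forall x s t, K x -> a <= s <= b -> a <= t <= b -> `|v x s - v x t| <= k * `|s - t|) ->
  (forall t, a <= t <= b -> colorable K (fun x y => `|v x t - v y t|)) ->
  ucolorable K `[a, b]%classic v.
Proof.
move=> ab k0 lip col e e0; have k1 : 0 < k + 1 by rewrite ltr_wpDl.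
pose h := e / (3 * (k + 1)); have h0 : 0 < h by rewrite divr_gt0 // mulr_gt0.
pose n := (Num.truncn ((b - a) / h)).+1.
pose p j := clamp a b (a + j%:R * h).
have pI j : a <= p j <= b by apply: clamp_in.
have [C [c Hc]] := colorable_sum (fun j : 'I_n => col _ (pI j)) (divr_gt0 e0 (ltr0n R 3)).
exists C, c => x y Kx Ky cxy t; rewrite /= in_itv /= => tI; have /andP[at_ tb] := tI.
have r0 : 0 <= (t - a) / h by rewrite divr_ge0 ?subr_ge0 // ltW.
pose j := Num.truncn ((t - a) / h).
have /andP[jl jr] : j%:R <= (t - a) / h < j.+1%:R by apply: truncn_itv.
have jn : (j < n)%N.
  rewrite ltnS /j; apply: le_truncn.
  by rewrite ler_pM2r ?invr_gt0 // lerD2r.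
have pj : p j = a + j%:R * h.
  apply: clamp_id; rewrite lerDl mulr_ge0 // ?(ltW h0) //=.
  by apply: le_trans tb; rewrite addrC -lerBrDr -ler_pdivlMr.
have d1 : `|t - p j| <= h.
  rewrite pj opprD addrA ger0_norm; last by rewrite subr_ge0 -ler_pdivlMr.
  by move: jr; rewrite -natr1 ltr_pdivrMr // mulrDl mul1r => /ltW; lra.
have kh : k * h <= e / 3.
  rewrite (_ : k * h = e / 3 * (k / (k + 1))); last by rewrite /h; field; rewrite gt_eqF.
  by rewrite ler_piMr ?divr_ge0 ?ltW // ltr_pdivrMr // mul1r ltrDl.
have l1 z : K z -> `|v z t - v z (p j)| <= e / 3.
  by move=> Kz; apply: le_trans (lip _ _ _ Kz tI (pI j)) (le_trans _ kh); rewrite ler_wpM2l.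
have l2 : `|v x (p j) - v y (p j)| <= e / 3.
  apply: le_trans (Hc _ _ Kx Ky cxy); rewrite (bigD1 (Ordinal jn)) //= lerDl.
  exact: sumr_ge0.
have -> : v x t - v y t = (v x t - v x (p j)) + (v x (p j) - v y (p j)) + - (v y t - v y (p j)).
  by rewrite opprB !addrA !subrK.
apply: le_trans (ler_normD _ _) _; rewrite normrN.
have := ler_normD (v x t - v x (p j)) (v x (p j) - v y (p j)).
have := l1 _ Kx; have := l1 _ Ky; lra.
Qed.

(* Once [n] is large, infinitely many [m] share the color of [n], and letting
   [m] tend to infinity along them bounds the distance to the limit. *)
Lemma ucolorable_unif_cvg (R : realType) (P W : Type) (X : normedModType R)
    (K : set P) (D : set W) (v : P -> W -> X) (x : nat -> P) (z : P) :
  ucolorable K D v -> (forall n, K (x n)) ->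
  (forall t, D t -> v (x n) t @[n --> \oo] --> v z t) ->
  unif_cvg D (fun n => v (x n)) (v z).
Proof.
move=> H Kx xz e e0; have [C [c Hc]] := H e e0.
have /choice[m Hm] : forall a : C, exists m, (forall n, (m <= n)%N -> c (x n) <> a) \/
    (forall n, exists2 n', (n <= n')%N & c (x n') = a).
  move=> a; have [[m Hm]|nH] := pselect (exists m, forall n, (m <= n)%N -> c (x n) <> a).
    by exists m; left.
  exists 0%N; right=> n; apply: contrapT => nE; apply: nH; exists n => n' nn' cn'.
  by apply: nE; exists n'.
exists (\max_a m a) => n mn t Dt.
have [Hn|Hn] := Hm (c (x n)).
  by case: (Hn n) => //; apply: leq_trans mn; apply: (leq_bigmax (c (x n))).
apply: contrapT => /negP; rewrite -ltNge => lt.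
have g0 : 0 < `|v (x n) t - v z t| - e by rewrite subr_gt0.
have /cvgrPdist_lt/(_ _ g0)[n1 _ Hn1] := xz t Dt.
have [n2 n12 cn2] := Hn n1.
have h1 := Hn1 n2 n12; rewrite distrC in h1; have h2 := Hc _ _ (Kx n) (Kx n2) (esym cn2) t Dt.
have : `|v (x n) t - v z t| < `|v (x n) t - v z t|.
  apply: (@le_lt_trans _ _ (`|v (x n) t - v (x n2) t| + `|v (x n2) t - v z t|)).
    have -> : v (x n) t - v z t = (v (x n) t - v (x n2) t) + (v (x n2) t - v z t) by rewrite
      addrA subrK.
    exact: ler_normD.
  lra.
by rewrite ltxx.
Qed.

Section Duhamel.
Context {R : realType} {X : completeNormedModType R}.
Context (J : X -> (X -> R^o)) (dualJ : duality_map J) (sepX : separable X).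
Context (T M Mt : R) (C0 F0 : R -> X -> X) (S : R -> R -> X -> X).
Hypothesis T_gt0 : 0 < T.
Hypothesis M_ge0 : 0 <= M.
Hypothesis Mt_ge0 : 0 <= Mt.
Hypothesis evolS : evolution_operator T M Mt C0 F0 S.
Variables (a b : R).
Hypothesis a_ge0 : 0 <= a.
Hypothesis ab : a <= b.
Hypothesis bT : b <= T.
Notation I t := (0 <= t <= T).
Implicit Types (F G : R -> X) (w : R -> R).

Let Isub t : a <= t <= b -> I t.
Proof. by move=> /andP[at_ tb]; rewrite (le_trans a_ge0 at_) (le_trans tb). Qed.

Definition duhamel F t : X := bint a t (fun s => S t s (F s)).

Definition dominated w F := smeasurable `[a, b] F /\
  {ae leb, forall t, `[a, b]%classic t -> `|F t| <= w t}.

Lemma duhamel_sint w F t : leb.-integrable `[a, b] (EFin \o w) -> dominated w F ->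
  I t -> sintegrable a b (fun s => S t s (F s)).
Proof.
move=> iw [mF Fw] It; apply: (sintegrable_dom (w := fun s => Mt * w s)).
- exact: (smeasurable_S sepX T_gt0 evolS It a_ge0 bT).
- apply: (ae_mono Fw) => s Hs sI; have := sI; rewrite /= in_itv /= => /Isub Is.
  apply: le_trans (evol_S_le evolS _ It Is) _.
  by rewrite ler_wpM2l // Hs.
- exact: integrableZR.
Qed.

Lemma duhamel_le w F t : leb.-integrable `[a, b] (EFin \o w) ->
  (forall s, a <= s <= b -> 0 <= w s) -> dominated w F ->
  a <= t <= b -> `|duhamel F t| <= Mt * \int[leb]_(s in `[a, b]) w s.
Proof.
move=> iw w0 dF tI; have It := Isub tI; have /andP[at_ tb] := tI.
have sint := sintegrableS (lexx a) tb (duhamel_sint iw dF It).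
have iw' := integrable_itvS (lexx a) tb iw.
apply: (le_trans (bint_norm_le dualJ sepX (w := fun s => Mt * w s) sint _ _)).
- have [_ Fw] := dF; apply: (ae_mono Fw) => s Hs sI.
  have sI' := itvS (lexx a) tb sI; have := sI'; rewrite /= in_itv /= => /Isub Is.
  by apply: le_trans (evol_S_le evolS _ It Is) _; rewrite ler_wpM2l // Hs.
- exact: integrableZR.
- rewrite RintegralZl // ler_wpM2l //; apply: Rintegral_itv_mono => //.
Qed.

Lemma duhamel_diff_le w w' F G t : leb.-integrable `[a, b] (EFin \o w) ->
  leb.-integrable `[a, b] (EFin \o w') ->
  (forall s, a <= s <= b -> 0 <= w' s) -> dominated w F -> dominated w G ->
  {ae leb, forall t, `[a, b]%classic t -> `|F t - G t| <= w' t} ->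
  a <= t <= b -> `|duhamel F t - duhamel G t| <= Mt * \int[leb]_(s in `[a, b]) w' s.
Proof.
move=> iw iw' w0 dF dG FG tI; have It := Isub tI; have /andP[at_ tb] := tI.
have sF := sintegrableS (lexx a) tb (duhamel_sint iw dF It).
have sG := sintegrableS (lexx a) tb (duhamel_sint iw dG It).
rewrite /duhamel -(bintB dualJ sepX sF sG).
have iw'' := integrable_itvS (lexx a) tb iw'.
apply: (le_trans (bint_norm_le dualJ sepX (w := fun s => Mt * w' s) (sintegrableB sepX sF sG) _ _)).
- apply: (ae_mono FG) => s Hs sI.
  have sI' := itvS (lexx a) tb sI; have := sI'; rewrite /= in_itv /= => /Isub Is.
  rewrite -(blin_B (evol_S_blin evolS It Is)).
  by apply: le_trans (evol_S_le evolS _ It Is) _; rewrite ler_wpM2l // Hs.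
- exact: integrableZR.
- rewrite RintegralZl // ler_wpM2l //; apply: Rintegral_itv_mono => //.
Qed.

Lemma duhamel_lip L w F : 0 <= L -> (forall t1 t2 s x, I t1 -> I t2 -> I s ->
    `|S t1 s x - S t2 s x| <= L * `|t1 - t2| * `|x|) ->
  leb.-integrable `[a, b] (EFin \o w) ->
  (forall s, a <= s <= b -> 0 <= w s) -> dominated w F ->
  forall t t', a <= t <= b -> a <= t' <= b ->
  `|duhamel F t - duhamel F t'| <= L * (\int[leb]_(s in `[a, b]) w s) * `|t - t'|.
Proof.
move=> L0 HL iw w0 dF t t'; wlog tt' : t t' / t <= t' => [H|].
  move=> tI tI'; have [/H|/ltW/H] := leP t t'; first exact.
  by rewrite distrC (distrC t); apply.
move=> tI tI'; have It := Isub tI; have It' := Isub tI'.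
have /andP[at_ tb] := tI; have /andP[at'_ tb'] := tI'.
have s1 := sintegrableS (lexx a) tb (duhamel_sint iw dF It).
have s2' := sintegrableS (lexx a) tb' (duhamel_sint iw dF It').
have s2 := sintegrableS (lexx a) tb (duhamel_sint iw dF It').
have s3 := sintegrableS at_ tb' (duhamel_sint iw dF It').
rewrite /duhamel (bint_cat dualJ sepX at_ tt' s2') opprD addrA -(bintB dualJ sepX s1 s2).
have [_ Fw] := dF.
pose k s := L * `|t - t'| * w s.
have k0 : 0 <= L * `|t - t'| by rewrite mulr_ge0.
have i1 : leb.-integrable `[a, t] (EFin \o k) by apply: integrableZR; apply: integrable_itvS iw.
have i2 : leb.-integrable `[t, t'] (EFin \o k) by apply: integrableZR; apply: integrable_itvS iw.
apply: le_trans (ler_normD _ _) _; rewrite normrN.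
apply: (@le_trans _ _ (\int[leb]_(s in `[a, t]) k s + \int[leb]_(s in `[t, t']) k s)).
  apply: lerD.
    apply: (bint_norm_le dualJ sepX (sintegrableB sepX s1 s2)) => //.
    apply: (ae_mono Fw) => s Hs sI.
    have sI' := itvS (lexx a) tb sI; have := sI'; rewrite /= in_itv /= => /Isub Is.
    by apply: le_trans (HL _ _ _ _ It It' Is) _; rewrite ler_wpM2l // Hs.
  apply: (bint_norm_le dualJ sepX s3) => //.
  apply: (ae_mono Fw) => s Hs sI.
  have sI' := itvS at_ tb' sI; have := sI'; rewrite /= in_itv /= => /Isub Is.
  have := sI; rewrite /= in_itv /= => /andP[ts st'].
  (* On [t, t'] the kernel is compared with [S s s], which is 0, at the cost of
     [t' - s <= t' - t]. *)
  rewrite -[S t' s (F s)]subr0 -(evol_S_tt evolS (F s) Is).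
  apply: le_trans (HL _ _ _ _ It' Is Is) _; apply: ler_pM => //; last exact: Hs.
    by rewrite mulr_ge0.
  by rewrite ler_wpM2l // [leRHS]distrC !ger0_norm ?subr_ge0 // lerD2l lerN2.
have ik : leb.-integrable `[a, t'] (EFin \o k) by apply: integrableZR; apply: integrable_itvS iw.
rewrite -(Rintegral_cat at_ tt' ik) RintegralZl //; last exact: integrable_itvS iw.
by rewrite mulrAC ler_wpM2r // ler_wpM2l //; apply: Rintegral_itv_mono.
Qed.

Section Compactness.
Hypothesis compS : forall t s, 0 <= s -> s <= t -> t <= T -> compact_op (S t s).
Variables (P : Type) (K : set P).

Lemma colorable_evol (t s c : R) (v : P -> X) : 0 <= s -> s <= t -> t <= T ->
  (forall x, K x -> `|v x| <= c) -> colorable K (fun x y => `|S t s (v x) - S t s (v y)|).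
Proof.
move=> s0 st tT vc; apply: (@colorable_precompact _ _ _ _ (fun x => S t s (v x))).
rewrite -(image_comp v (S t s)); apply: (compS s0 st tT).
exists c; split; first exact: num_real.
by move=> m cm _ [x Kx <-]; apply: le_trans (vc _ Kx) (ltW cm).
Qed.

Variables (w : R -> R) (F : P -> R -> X).
Hypothesis iw : leb.-integrable `[a, b] (EFin \o w).
Hypothesis w_ge0 : forall s, a <= s <= b -> 0 <= w s.
Hypothesis domF : forall x, K x -> dominated w (F x).

(* On a slice [c, c + del] the operator [S t s] is replaced by the compact
   operator [S t c]. *)
Lemma duhamel_slices t del n : 0 < del -> a <= t <= b -> forall c, a <= c <= t ->
  t - c <= n%:R * del -> exists2 d, colorable K d & forall x y, K x -> K y ->
  `|bint c t (fun s => S t s (F x s)) - bint c t (fun s => S t s (F y s))| <=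
  d x y + 2 * (M * del * \int[leb]_(s in `[c, t]) w s).
Proof.
move=> del0 tI; have It := Isub tI; have /andP[at_ tb] := tI.
have W c : a <= c <= t -> 0 <= \int[leb]_(s in `[c, t]) w s.
  move=> /andP[ac ct]; apply: Rintegral_ge0 => s; rewrite /= in_itv /= => /andP[cs st].
  by apply: w_ge0; rewrite (le_trans ac cs) (le_trans st).
have Mdel : 0 <= M * del by rewrite mulr_ge0 // ltW.
elim: n => [|n IHn] c cI; have /andP[ac ct] := cI => tc.
  have e : t = c by apply/eqP; rewrite eq_le ct -subr_le0; move: tc; rewrite mul0r => ->.
  exists (fun _ _ => 0) => [|x y Kx Ky].
    by move=> e' e0; exists unit, (fun=> tt) => x y *; exact: ltW.
  have sx z : K z -> sintegrable t t (fun s => S t s (F z s)).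
    by move=> Kz; apply: sintegrableS (duhamel_sint iw (domF Kz) It).
  rewrite -e (bint_point dualJ sepX (sx _ Kx)) (bint_point dualJ sepX (sx _ Ky)) subrr normr0 add0r.
  by apply: mulr_ge0 => //; apply: mulr_ge0 => //; apply: W; rewrite lexx at_.
pose c' := Num.min t (c + del).
have cc' : c <= c' by rewrite le_min ct lerDl ltW.
have c't : c' <= t by rewrite ge_min lexx.
have c'I : a <= c' <= t by rewrite (le_trans ac cc').
have tc' : t - c' <= n%:R * del.
  rewrite /c'; case: (leP t (c + del)) => h; first by rewrite subrr mulr_ge0 // ltW.
  by move: tc; rewrite -natr1 mulrDl mul1r; lra.
have c'c : c' - c <= del by rewrite lerBlDl ge_min lexx orbT.
have [d cd Hd] := IHn c' c'I tc'.
have Ic : I c by apply: Isub; rewrite ac (le_trans ct).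
have iw1 : leb.-integrable `[c, c'] (EFin \o w).
  by apply: integrable_itvS iw => //; apply: le_trans tb.
have iw2 : leb.-integrable `[c, t] (EFin \o w) by apply: integrable_itvS iw.
have sx z : K z -> sintegrable c t (fun s => S t s (F z s)).
  by move=> Kz; apply: sintegrableS (duhamel_sint iw (domF Kz) It).
have sx1 z : K z -> sintegrable c c' (fun s => S t s (F z s)).
  by move=> Kz; apply: sintegrableS (sx _ Kz).
have sF z : K z -> sintegrable c c' (F z).
  move=> Kz; have [mF Fw] := domF Kz; apply: (@sintegrableS _ _ a b) => //.
    exact: le_trans tb.
  exact: sintegrable_dom Fw iw.
have bS := evol_S_blin evolS It Ic.
have sx2 z : K z -> sintegrable c c' (fun s => S t c (F z s)).
  by move=> Kz; apply: sintegrable_linear (sF _ Kz).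
have wsub s : `[c, c']%classic s -> `[a, b]%classic s.
  by apply: itvS => //; apply: le_trans tb.
have slice z : K z -> `|bint c c' (fun s => S t s (F z s)) - S t c (bint c c' (F z))| <=
    M * del * \int[leb]_(s in `[c, c']) w s.
  move=> Kz; rewrite -(bint_linear dualJ sepX bS (sF _ Kz)).
  rewrite -(bintB dualJ sepX (sx1 _ Kz) (sx2 _ Kz)) -RintegralZl //.
  apply: (bint_norm_le dualJ sepX (sintegrableB sepX (sx1 _ Kz) (sx2 _ Kz))).
  - have [_ Fw] := domF Kz; apply: (ae_mono Fw) => s Hs sI.
    have sI' := wsub _ sI; have := sI'; rewrite /= in_itv /= => /Isub Is.
    have := sI; rewrite /= in_itv /= => /andP[cs sc'].
    apply: le_trans (evol_S_lip2 dualJ M_ge0 evolS _ It Is Ic) _.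
    apply: ler_pM => //; [by rewrite mulr_ge0| |exact: Hs].
    by rewrite ler_wpM2l // ger0_norm ?subr_ge0 // (le_trans _ c'c) // lerD2r.
  - exact: integrableZR.
pose W1 := \int[leb]_(s in `[c, c']) w s.
have bd z : K z -> `|bint c c' (F z)| <= W1.
  move=> Kz; apply: (bint_norm_le dualJ sepX (sF _ Kz)) => //.
  by have [_ Fw] := domF Kz; apply: (ae_mono Fw) => s Hs /wsub; apply: Hs.
(* After freezing, the compact operator acts on the vector [bint c c' (F x)], for which a bound
   independent of [x] is enough. *)
have col := colorable_evol (le_trans a_ge0 ac) ct (le_trans tb bT) bd.
exists (fun x y => `|S t c (bint c c' (F x)) - S t c (bint c c' (F y))| + d x y) => [|x y Kx Ky].
  exact: colorable_add.
rewrite (bint_cat dualJ sepX cc' c't (sx _ Kx)) (bint_cat dualJ sepX cc' c't (sx _ Ky)).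
have := Hd _ _ Kx Ky; have := slice _ Kx; have := slice _ Ky.
rewrite (Rintegral_cat cc' c't iw2).
move: (bint c c' (fun s => S t s (F x s))) (bint c c' (fun s => S t s (F y s))) => A1 A2.
move: (bint c' t (fun s => S t s (F x s))) (bint c' t (fun s => S t s (F y s))) => B1 B2.
move: (S t c _) (S t c _) => D1 D2 h2 h1 h3.
have -> : A1 + B1 - (A2 + B2) = ((A1 - D1) - (A2 - D2)) + (D1 - D2) + (B1 - B2).
  rewrite opprD addrACA; congr (_ + _).
  by rewrite -{1}(subrK D1 A1) -{1}(subrK D2 A2) opprD addrACA.
have n1 := ler_normD (A1 - D1 - (A2 - D2) + (D1 - D2)) (B1 - B2).
have n2 := ler_normD (A1 - D1 - (A2 - D2)) (D1 - D2).
have n3 := ler_normB (A1 - D1) (A2 - D2).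
move: h1 h2 h3 n1 n2 n3; rewrite [M * del * (_ + _)]mulrDr; lra.
Qed.

Lemma colorable_duhamel t : a <= t <= b ->
  colorable K (fun x y => `|duhamel (F x) t - duhamel (F y) t|).
Proof.
move=> tI; have /andP[at_ tb] := tI; apply: colorable_approx => e e0.
pose W := \int[leb]_(s in `[a, t]) w s.
have W0 : 0 <= W.
  apply: Rintegral_ge0 => s; rewrite /= in_itv /= => /andP[cs st].
  by apply: w_ge0; rewrite cs (le_trans st).
have k0 : 0 < 2 * (M * W) + 1 by rewrite ltr_wpDl // !mulr_ge0.
(* With this width the errors of all slices add up to at most [e]; the added 1 avoids a division by
   0. *)
pose del := e / (2 * (M * W) + 1); have del0 : 0 < del by rewrite divr_gt0.
have atI : a <= a <= t by rewrite lexx at_.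
have [|d cd Hd] := @duhamel_slices t del (Num.truncn ((t - a) / del)).+1 del0 tI a atI.
  rewrite -ler_pdivrMr //; apply: ltW.
  exact: truncnS_gt.
exists d => // x y Kx Ky; apply: le_trans (Hd _ _ Kx Ky) _; rewrite lerD2l.
rewrite -/W (_ : 2 * _ = e * (2 * (M * W)) / (2 * (M * W) + 1)); last by rewrite /del; ring.
by rewrite ler_pdivrMr // ler_wpM2l ?lerDl // ltW.
Qed.
End Compactness.
End Duhamel.

Lemma truncn_preimage_measurable (R : realType) (g : R -> R) (j : nat) :
  measurable_fun setT g -> (forall t, 0 <= g t) ->
  measurable ((fun t => Num.truncn (g t)) @^-1` [set j]).
Proof.
move=> mg g0; rewrite [X in measurable X](_ : _ = g @^-1` `[j%:R, j.+1%:R[).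
  by rewrite -[X in measurable X]setTI; apply: mg => //; exact: measurable_itv.
apply/seteqP; split=> t /=; rewrite in_itv /=.
  by move/eqP; rewrite truncn_eq.
by move=> h; apply/eqP; rewrite truncn_eq.
Qed.

(** * Composition of the nonlinearity with histories *)

Section Nemytskii.
Context {R : realType} {X : completeNormedModType R} (sepX : separable X).
Context (q T : R) (q_gt0 : 0 < q) (T_gt0 : 0 < T).
Variables (a b : R).
Hypothesis a_ge0 : 0 <= a.
Hypothesis ab : a <= b.
Hypothesis bT : b <= T.
Variables (f : R -> (R -> X) -> X) (gamma : R -> R).
Hypothesis f_meas : forall psi, in_D q psi -> smeasurable `[a, b] (f ^~ psi).
Hypothesis f_cont : {ae leb, forall t : R, `[a, b]%classic t ->
  fun_continuous (in_D q) (norm_D q) (f t)}.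
Hypothesis gamma_int : leb.-integrable `[a, b] (EFin \o gamma).
Hypothesis f_le : {ae leb, forall t : R, `[a, b]%classic t ->
  forall psi, in_D q psi -> `|f t psi| <= gamma t}.
Notation I t := (0 <= t <= T).

Let Isub t : `[a, b]%classic t -> I t.
Proof.
by rewrite /= in_itv /= => /andP[at_ tb]; rewrite (le_trans a_ge0 at_) (le_trans tb).
Qed.

Lemma fun_continuous_cvg (t : R) (psi_ : nat -> R -> X) psi :
  fun_continuous (in_D q) (norm_D q) (f t) -> in_D q psi -> (forall n, in_D q (psi_ n)) ->
  norm_D q (fun v => psi_ n v - psi v) @[n --> \oo] --> (0 : R) ->
  f t (psi_ n) @[n --> \oo] --> f t psi.
Proof.
move=> fc Dp Dpn cv; apply/cvgrPdist_lt => e e0.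
have [d d0 Hd] := fc _ Dp _ e0.
have [n0 _ Hn] := cvgr_lt _ cv _ d0.
by exists n0 => // n nn; rewrite distrC; apply: Hd => //; apply: Hn.
Qed.

Lemma nemytskii_smeas x : pwc (- q) T x -> smeasurable `[a, b] (fun t => f t (hist x t)).
Proof.
move=> px.
pose k n (t : R) := Num.truncn (Num.max 0 t * n.+1%:R).
pose tau n (j : nat) : R := clamp 0 T (j%:R / n.+1%:R).
have tauI n j : I (tau n j) by apply: clamp_in; exact: ltW.
apply: (smeasurable_cvg (F_ := fun n t => f t (hist x (tau n (k n t))))) => //.
  move=> n; apply: (smeasurable_nat_param (k := k n) (Phi := fun j t => f t (hist x (tau n j)))).
    move=> j; apply: truncn_preimage_measurable => [|t].
      by apply: measurable_funM => //; apply: measurable_maxr.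
    by rewrite mulr_ge0 // le_max lexx.
  by move=> j; apply: f_meas; exact: in_D_hist px (tauI n j).
apply: (ae_mono f_cont) => t ft tI; have It := Isub tI; have /andP[t0 tT] := It.
apply: fun_continuous_cvg; [exact: ft|exact: in_D_hist px It| |].
  by move=> n; exact: in_D_hist px (tauI _ _).
apply: norm_D_hist_cvg => //; first exact: px.
apply: (@squeeze_norm _ R^o _ _ _ _ _ (fun n => n.+1%:R^-1)); last exact: cvg_harmonic.
near=> n; have n0 : 0 < n.+1%:R :> R by rewrite ltr0n.
rewrite /k (max_idPr t0).
have /andP[j1 j2] := truncn_itv (mulr_ge0 t0 (ltW n0)).
have j1' : (Num.truncn (t * n.+1%:R))%:R / n.+1%:R <= t by rewrite ler_pdivrMr.
rewrite /tau clamp_id; last first.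
  by rewrite divr_ge0 ?(ltW n0) //=; apply: le_trans j1' tT.
rewrite distrC ger0_norm ?subr_ge0 //.
by rewrite lerBlDr -[X in X + _]div1r -mulrDl ler_pdivlMr // addrC natr1 ltW.
Unshelve. all: end_near. Qed.

Lemma nemytskii_le x : pwc (- q) T x ->
  {ae leb, forall t, `[a, b]%classic t -> `|f t (hist x t)| <= gamma t}.
Proof.
move=> px; apply: (ae_mono f_le) => t H tI; apply: H => //.
by apply: in_D_hist px (Isub tI).
Qed.

(** The bounds [w] are part of the conclusion because the differences are only almost everywhere
    equal to measurable functions; [w n] is the norm of the difference of representatives. Dominated
    convergence applies with [2 * gamma]. *)
Lemma nemytskii_cvg (x_ : nat -> R -> X) x : pwc (- q) T x -> (forall n, pwc (- q) T (x_ n)) ->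
  (forall n t, t < 0 -> x_ n t = x t) -> unif_cvg `[0, T]%classic x_ x ->
  exists w : nat -> R -> R, [/\ forall n t, 0 <= w n t,
    forall n, leb.-integrable `[a, b] (EFin \o w n),
    forall n, {ae leb, forall t, `[a, b]%classic t ->
      `|f t (hist (x_ n) t) - f t (hist x t)| <= w n t} &
    \int[leb]_(t in `[a, b]) w n t @[n --> \oo] --> (0 : R)].
Proof.
move=> px pxn xneg ux.
have /choice[F_ HF_] n : exists F', nmeasurable F' /\ ae_on `[a, b] (fun t => f t (hist (x_ n)
  t)) F'.
  by have [F' mF FF'] := nemytskii_smeas (pxn n); exists F'.
have [F mF FF] := nemytskii_smeas px.
pose w n t := `|F_ n t - F t|.
have mw n : measurable_fun setT (w n).
  apply: nmeasurable_norm; apply: (nmeasurableD sepX); first by have [] := HF_ n.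
  exact: nmeasurableN.
have HA : {ae leb, forall t, forall n, `[a, b]%classic t -> f t (hist (x_ n) t) = F_ n t}.
  by apply: ae_all => n; have [_ h] := HF_ n; apply: (ae_mono h).
have dom : {ae leb, forall t, `[a, b]%classic t -> forall n, w n t <= 2 * gamma t}.
  apply: (ae_mono (ae_and HA (ae_and FF f_le))) => t [h1 [h2 h3]] tI n.
  have It := Isub tI.
  rewrite /w -h1 // -h2 //; apply: le_trans (ler_normB _ _) _.
  have := h3 tI _ (in_D_hist (pxn n) It); have := h3 tI _ (in_D_hist px It); lra.
have cvw : {ae leb, forall t, `[a, b]%classic t -> w n t @[n --> \oo] --> (0 : R)}.
  apply: (ae_mono (ae_and HA (ae_and FF f_cont))) => t [h1 [h2 h3]] tI.
  have It := Isub tI; have /andP[t0 tT] := It.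
  have cv : f t (hist (x_ n) t) @[n --> \oo] --> f t (hist x t).
    apply: fun_continuous_cvg; [exact: h3|exact: in_D_hist px It| |].
      by move=> n; exact: in_D_hist (pxn n) It.
    apply/cvgrPdist_le => e e0; have [n0 Hn] := ux _ e0; exists n0 => // n nn.
    rewrite distrC subr0 ger0_norm; last first.
      by rewrite mulr_ge0 ?invr_ge0 ?(ltW q_gt0) //; apply: Rintegral_ge0.
    apply: (norm_D_le q_gt0); first exact: ltW.
    move=> s /andP[s1 s2]; rewrite /hist; have [lt|ge] := ltP (t + s) 0.
      by rewrite xneg // subrr normr0 ltW.
    by apply: Hn => //; rewrite /= in_itv /= ge /=; apply: le_trans tT; rewrite gerDl.
  have : `|f t (hist (x_ n) t) - f t (hist x t)| @[n --> \oo] --> (0 : R).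
    rewrite -(@normr0 _ X) -(subrr (f t (hist x t))); apply: cvg_norm.
    by apply: cvgB; [exact: cv|exact: cvg_cst].
  by rewrite /w -h2 //; under eq_fun do rewrite h1 //.
have ig2 : leb.-integrable `[a, b] (EFin \o (fun t => 2 * gamma t)) by exact: integrableZR.
have w0 n t : 0 <= w n t by exact: normr_ge0.
have iw n : leb.-integrable `[a, b] (EFin \o w n).
  have mwI : measurable_fun `[a, b] (w n) by apply: (measurable_funS measurableT) => //; exact: mw.
  apply/integrableP; split; first exact/measurable_EFinP.
  have /integrableP[_] := ig2; apply: le_lt_trans.
  apply: le_integral_ae => //; apply: (ae_mono dom) => t h tI.
  by rewrite /= lee_fin (ger0_norm (w0 n t)) (le_trans (h tI n)) // ler_norm.
have [||||| _ _ i3] := @dominated_convergence _ _ R leb _ (measurable_itv `[a, b])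
  (fun n t => (w n t)%:E) (fun=> 0%E) (EFin \o (fun t => 2 * gamma t)).
- by move=> n; apply/measurable_EFinP; apply: (measurable_funS measurableT) => //; exact: mw.
- exact: measurable_cst.
- by apply: (ae_mono cvw) => t h /h cv; apply: cvg_EFin; [exact: nearW|].
- exact: ig2.
- by apply: (ae_mono dom) => t h n tI; rewrite /= lee_fin ger0_norm //; apply: h.
exists w; split=> //.
  move=> n; apply: (ae_mono (ae_and HA FF)) => t [h1 h2] tI.
  by rewrite /w h1 // h2.
by apply: fine_cvg0; move: i3; rewrite integral0.
Unshelve. all: end_near. Qed.
End Nemytskii.

(** * The solution formula on one interval *)

Lemma ucolorable_le (R : realType) (P W W' : Type) (X X' : normedModType R)
    (K : set P) (D : set W) (D' : set W') (v : P -> W -> X) (v' : P -> W' -> X')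
    (k : R) : 0 <= k ->
  (forall t, D t -> exists2 t', D' t' &
     forall x y, K x -> K y -> `|v x t - v y t| <= k * `|v' x t' - v' y t'|) ->
  ucolorable K D' v' -> ucolorable K D v.
Proof.
move=> k0 vv' H e e0; have k1 : 0 < k + 1 by rewrite ltr_wpDl.
have [C [c Hc]] := H _ (divr_gt0 e0 k1); exists C, c => x y Kx Ky cxy t Dt.
have [t' Dt' le] := vv' t Dt; apply: le_trans (le _ _ Kx Ky) _.
apply: le_trans (ler_wpM2l k0 (Hc _ _ Kx Ky cxy t' Dt')) _.
by rewrite mulrA ler_pdivrMr // mulrC ler_pM2l // lerDl.
Qed.

Lemma ucolorableD (R : realType) (P W : Type) (X : normedModType R)
    (K : set P) (D : set W) (v v' : P -> W -> X) :
  ucolorable K D v -> ucolorable K D v' -> ucolorable K D (fun x t => v x t + v' x t).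
Proof.
move=> H H' e e0; have e2 : 0 < e / 2 by rewrite divr_gt0.
have [C [c Hc]] := H _ e2; have [C' [c' Hc']] := H' _ e2.
exists (C * C')%type, (fun x => (c x, c' x)) => x y Kx Ky [ce ce'] t Dt.
rewrite opprD addrACA (splitr e); apply: le_trans (ler_normD _ _) _.
by rewrite lerD ?Hc ?Hc'.
Qed.

Lemma ucolorable_cst (R : realType) (P W : Type) (X : normedModType R)
    (K : set P) (D : set W) (v : P -> X) :
  colorable K (fun x y => `|v x - v y|) -> ucolorable K D (fun x _ => v x).
Proof.
move=> H e e0; have [C [c Hc]] := H e e0; exists C, c => x y Kx Ky cxy t _.
exact: Hc.
Qed.

Lemma blin_cvg (R : realType) (V W : normedModType R) (L : V -> W) (T : Type)
    (F : set_system T) (FF : Filter F) (u : T -> V) (l : V) : bounded_linear L ->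
  u t @[t --> F] --> l -> L (u t) @[t --> F] --> L l.
Proof. by move=> bL ul; apply: cvg_comp ul _; exact: blin_continuous. Qed.

Section Piece.
Context {R : realType} {X U : completeNormedModType R}.
Context (J : X -> (X -> R^o)) (dualJ : duality_map J) (sepX : separable X).
Context (T M Mt : R) (C0 F0 : R -> X -> X) (S : R -> R -> X -> X).
Hypothesis T_gt0 : 0 < T.
Hypothesis M_ge0 : 0 <= M.
Hypothesis Mt_ge0 : 0 <= Mt.
Hypothesis evolS : evolution_operator T M Mt C0 F0 S.
Context (dot : U -> U -> R) (hilbU : inner_product dot).
Context (B : U -> X) (MB : R) (linB : bounded_linear B) (B_le : opnorm B <= MB).
Context (Bs : (X -> R^o) -> U) (adjB : adjoint_to dot B Bs).
Context (Res : R -> R -> R -> X -> X) (resRes : resolvent T S B Bs J Res).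
Variables (a b lam : R).
Hypothesis a_ge0 : 0 <= a.
Hypothesis ab : a <= b.
Hypothesis bT : b <= T.
Hypothesis lam0 : 0 < lam.
Variables (P : Type) (K : set P) (A D : P -> X) (F : P -> R -> X) (xT : X).
Variables (p d : R) (gamma : R -> R).
Hypothesis A_le : forall x, K x -> `|A x| <= p.
Hypothesis D_le : forall x, K x -> `|D x| <= d.
Hypothesis F_dom : forall x, K x -> dominated a b gamma (F x).
Hypothesis gamma_int : leb.-integrable `[a, b] (EFin \o gamma).
Hypothesis gamma_ge0 : forall s, a <= s <= b -> 0 <= gamma s.
Notation I t := (0 <= t <= T).
Notation Cs := (cosop T S).

Let Ia : I a. Proof. by rewrite a_ge0 (le_trans ab). Qed.
Let Ib : I b. Proof. by rewrite bT (le_trans a_ge0). Qed.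
Let Isub t : a <= t <= b -> I t.
Proof. by move=> /andP[at_ tb]; rewrite (le_trans a_ge0 at_) (le_trans tb). Qed.
Let bI : a <= b <= b. Proof. by rewrite ab lexx. Qed.
Let MB0 : 0 <= MB := MB_ge0 linB B_le.

(** The initial value [A], the slope [D] and the force [F] are arbitrary functions of a parameter,
    so that nonlocal conditions and impulses are treated together. *)
Definition piece_target x : X :=
  xT - Cs b a (A x) - S b a (D x) - duhamel S a (F x) b.
Definition piece_ctrl x : R -> U := ctrl J S Bs Res a b lam (piece_target x).
Definition piece_force x (s : R) : X := B (piece_ctrl x s) + F x s.
(** These are the terms Lipschitz in [t] uniformly in [x]; the remaining term with [C] is only known
    to be continuous in [t]. *)
Definition piece_rest x (t : R) : X := S t a (D x) + duhamel S a (piece_force x) t.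
Definition piece x (t : R) : X := Cs t a (A x) + piece_rest x t.

Let W := \int[leb]_(s in `[a, b]) gamma s.
(** [E] bounds the uncontrolled solution, [ku] the control and [w] the total force. *)
Let E := M * p + Mt * d + Mt * W.
Let ku := MB * Mt / lam * (`|xT| + E).
Let w s := MB * ku + gamma s.

Lemma piece_target_le x : K x -> `|piece_target x| <= `|xT| + E.
Proof.
move=> Kx; have h1 := evol_C_le evolS (A x) Ib Ia.
have h2 := evol_S_le evolS (D x) Ib Ia.
have h3 := duhamel_le dualJ sepX T_gt0 Mt_ge0 evolS a_ge0 bT gamma_int gamma_ge0 (F_dom Kx) bI.
have h4 := ler_wpM2l M_ge0 (A_le Kx); have h5 := ler_wpM2l Mt_ge0 (D_le Kx).
rewrite /piece_target.
have n1 := ler_normB (xT - Cs b a (A x) - S b a (D x)) (duhamel S a (F x) b).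
have n2 := ler_normB (xT - Cs b a (A x)) (S b a (D x)).
have n3 := ler_normB xT (Cs b a (A x)).
rewrite /E; move: h3; rewrite -/W; lra.
Qed.

Lemma piece_ctrl_le x t : K x -> a <= t <= b -> `|piece_ctrl x t| <= ku.
Proof.
move=> Kx /Isub It.
apply: le_trans (ctrl_le dualJ sepX M_ge0 Mt_ge0 evolS hilbU linB B_le adjB resRes a_ge0 ab bT
  lam0 _ It) _.
by rewrite ler_wpM2l ?piece_target_le // !mulr_ge0 // invr_ge0 ltW.
Qed.

Let ku_ge0 x : K x -> 0 <= ku.
Proof. by move=> Kx; apply: le_trans (piece_ctrl_le Kx bI). Qed.

Lemma piece_ctrl_cont x : {within `[a, b], continuous (piece_ctrl x)}.
Proof. exact: (@ctrl_cont _ _ _ _ dualJ _ _ _ _ _ _ M_ge0 evolS _ hilbU _ _ linB B_le _ adjB). Qed.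

Let w_int : leb.-integrable `[a, b] (EFin \o w).
Proof. by apply: integrableDR => //; exact: integrable_cst_itv. Qed.

Let w_ge0 x : K x -> forall s, a <= s <= b -> 0 <= w s.
Proof. by move=> Kx s sI; rewrite addr_ge0 ?gamma_ge0 // mulr_ge0 // (ku_ge0 Kx). Qed.

Lemma piece_force_dom x : K x -> dominated a b w (piece_force x).
Proof.
move=> Kx; have [mF Fg] := F_dom Kx; split.
  apply: (smeasurableD sepX) => //; apply: within_smeasurable.
  apply/within_contP => t tI; apply/limatP.
  have /within_contP/(_ t tI)/limatP h := @piece_ctrl_cont x.
  exact: blin_cvg linB h.
apply: (ae_mono Fg) => t h tI; apply: le_trans (ler_normD _ _) _.
rewrite lerD ?h //; apply: le_trans (opnorm_leW linB _ B_le) _.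
by rewrite ler_wpM2l // piece_ctrl_le // -in_itv.
Qed.

Let int_w : \int[leb]_(s in `[a, b]) w s = MB * ku * (b - a) + W.
Proof. by rewrite RintegralD // ?Rintegral_cst_itv //; exact: integrable_cst_itv. Qed.

(** The integral of the control contributes Mt MB [ku] times the length of the interval. As [ku]
    itself carries MB Mt / lam and the length is at most [T], this is the origin of (Mt MB)^2 T /
    lam. *)
Lemma piece_le x t : K x -> a <= t <= b ->
  `|piece x t| <= E + (Mt * MB) ^+ 2 * T / lam * (`|xT| + E).
Proof.
move=> Kx tI; have It := Isub tI; have k0 := ku_ge0 Kx.
have h1 := evol_C_le evolS (A x) It Ia; have h2 := evol_S_le evolS (D x) It Ia.
have h3 := duhamel_le dualJ sepX T_gt0 Mt_ge0 evolS a_ge0 bT w_int (w_ge0 Kx) (piece_force_dom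
  Kx) tI.
have h4 := ler_wpM2l M_ge0 (A_le Kx); have h5 := ler_wpM2l Mt_ge0 (D_le Kx).
rewrite int_w in h3.
have h6 : Mt * (MB * ku * (b - a)) <= (Mt * MB) ^+ 2 * T / lam * (`|xT| + E).
  rewrite [leRHS](_ : _ = Mt * (MB * ku * T)); last by rewrite /ku; ring.
  rewrite ler_wpM2l // ler_wpM2l ?(mulr_ge0 MB0 k0) //.
  by rewrite lerBlDr (le_trans bT) // lerDl.
have n1 := ler_normD (Cs t a (A x)) (piece_rest x t).
have n2 := ler_normD (S t a (D x)) (duhamel S a (piece_force x) t).
move: h3; rewrite /piece mulrDr; move: n1 n2; rewrite /piece_rest /E; move: h6; rewrite /E; lra.
Qed.

Lemma piece_start x : K x -> piece x a = A x.
Proof.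
move=> Kx; rewrite /piece /piece_rest (evol_C_tt evolS) // (evol_S_tt evolS) //.
rewrite add0r /duhamel (bint_point dualJ sepX) ?addr0 //.
exact: sintegrableS (lexx a) ab (duhamel_sint sepX T_gt0 Mt_ge0 evolS a_ge0 bT w_int
  (piece_force_dom Kx) Ia).
Qed.

Lemma piece_sint x t : K x -> a <= t <= b ->
  sintegrable a t (fun s => S t s (piece_force x s)).
Proof.
move=> Kx tI; have /andP[at_ tb] := tI.
apply: sintegrableS (lexx a) tb _.
exact: (duhamel_sint sepX T_gt0 Mt_ge0 evolS a_ge0 bT w_int (piece_force_dom Kx) (Isub tI)).
Qed.

Lemma piece_rest_lip : exists2 k : R, 0 <= k & forall x, K x -> forall t t',
  a <= t <= b -> a <= t' <= b -> `|piece_rest x t - piece_rest x t'| <= k * `|t - t'|.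
Proof.
have [K0|] := pselect (K !=set0); last first.
  by move=> nK; exists 0 => // x Kx; case: nK; exists x.
have [x0 Kx0] := K0; have k0 := ku_ge0 Kx0.
have [L L0 HL] := evol_S_lip1 evolS.
have Iw : 0 <= \int[leb]_(s in `[a, b]) w s.
  by apply: Rintegral_ge0 => s; rewrite /= in_itv /=; apply: (w_ge0 Kx0).
have d0 : 0 <= d by apply: le_trans (D_le Kx0).
exists (L * d + L * \int[leb]_(s in `[a, b]) w s); first by rewrite addr_ge0 // mulr_ge0.
move=> x Kx t t' tI tI'; rewrite /piece_rest opprD addrACA mulrDl.
apply: le_trans (ler_normD _ _) _; apply: lerD.
  apply: le_trans (HL _ _ _ _ (Isub tI) (Isub tI') Ia) _.
  by rewrite mulrAC ler_wpM2r // ler_wpM2l // D_le.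
exact: (duhamel_lip dualJ sepX T_gt0 Mt_ge0 evolS a_ge0 bT L0 HL w_int (w_ge0 Kx)
  (piece_force_dom Kx)).
Qed.

Lemma piece_cont x : K x -> {within `[a, b], continuous (piece x)}.
Proof.
move=> Kx; apply/within_contP => t; rewrite /= in_itv /= => tI.
apply/limatP; apply: cvgD; apply/limatP.
  have /within_contP/(_ t) h := evol_C_cont (x := A x) evolS Ia.
  apply: limatS (h _); last by rewrite /= in_itv /= Isub.
  by move=> v; rewrite /= !in_itv /=; exact: Isub.
have [k k0 Hk] := piece_rest_lip; apply: (limat_lipschitz k0) => v.
by rewrite /= in_itv /= => vI; apply: Hk.
Qed.

(** [A] is carried by [C], so compactness of its values has to be supplied; [D] and the force stand
    behind the compact operators [S], where their bounds suffice. *)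
Lemma piece_ucolorable :
  (forall t s, 0 <= s -> s <= t -> t <= T -> compact_op (S t s)) ->
  colorable K (fun x y => `|A x - A y|) -> ucolorable K `[a, b]%classic piece.
Proof.
move=> compS colA; apply: ucolorableD.
  apply: (ucolorable_le (v' := fun x (_ : R) => A x) (D' := setT) M_ge0).
    move=> t; rewrite /= in_itv /= => /Isub It; exists 0 => // x y Kx Ky.
    by rewrite -(blin_B (evol_C_blin evolS It Ia)); exact: (evol_C_le evolS).
  exact: ucolorable_cst.
have [K0|nK] := pselect (K !=set0); last first.
  by move=> e e0; exists unit, (fun=> tt) => x y Kx; case: nK; exists x.
have [x0 Kx0] := K0.
have [k k0 Hk] := piece_rest_lip.
apply: (ucolorable_lipschitz ab k0) => [x s t Kx|t tI]; first exact: Hk.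
have It := Isub tI; have /andP[at_ tb] := tI.
apply: (colorable_le (d' := fun x y => `|S t a (D x) - S t a (D y)| +
    `|duhamel S a (piece_force x) t - duhamel S a (piece_force y) t|)).
  by move=> x y _ _; rewrite /piece_rest opprD addrACA ler_normD.
apply: colorable_add.
  exact: (colorable_evol compS a_ge0 at_ (le_trans tb bT) D_le).
exact: (colorable_duhamel dualJ sepX T_gt0 M_ge0 Mt_ge0 evolS a_ge0 bT compS w_int (w_ge0 Kx0)
  piece_force_dom tI).
Qed.

Lemma piece_cvg (x_ : nat -> P) (z : P) (v : nat -> R -> R) : K z -> (forall n, K (x_ n)) ->
  A (x_ n) @[n --> \oo] --> A z -> D (x_ n) @[n --> \oo] --> D z ->
  (forall n t, 0 <= v n t) -> (forall n, leb.-integrable `[a, b] (EFin \o v n)) ->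
  (forall n, {ae leb, forall t, `[a, b]%classic t -> `|F (x_ n) t - F z t| <= v n t}) ->
  \int[leb]_(t in `[a, b]) v n t @[n --> \oo] --> (0 : R) ->
  forall t, a <= t <= b -> piece (x_ n) t @[n --> \oo] --> piece z t.
Proof.
move=> Kz Kx cA cD v0 iv Fv cv t tI; have It := Isub tI.
have cy : piece_target (x_ n) @[n --> \oo] --> piece_target z.
  apply: cvgB; [apply: cvgB; [apply: cvgB; [exact: cvg_cst|]|]|].
  - by apply: blin_cvg cA; apply: (evol_C_blin evolS).
  - by apply: blin_cvg cD; apply: (evol_S_blin evolS).
  - apply: (@squeeze_norm _ _ _ _ _ _ _ (fun n => Mt * \int[leb]_(s in `[a, b]) v n s)).
      apply: nearW => n.
      exact: (duhamel_diff_le dualJ sepX T_gt0 Mt_ge0 evolS a_ge0 bT gamma_int (iv n)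
        (fun s _ => v0 n s) (F_dom (Kx n)) (F_dom Kz) (Fv n) bI).
    by rewrite -(mulr0 Mt); apply: cvgMr.
(* The controls converge in L^1. With the bounds [v n] on the nonlinear part, so do the forces,
   which is what [duhamel_diff_le] requires. *)
have cu := ctrl_cvg dualJ sepX M_ge0 Mt_ge0 evolS hilbU linB B_le adjB resRes a_ge0 ab bT lam0 cy.
apply: cvgD; [|apply: cvgD].
- by apply: blin_cvg cA; apply: (evol_C_blin evolS).
- by apply: blin_cvg cD; apply: (evol_S_blin evolS).
pose du n s := `|piece_ctrl (x_ n) s - piece_ctrl z s|.
have cdu n : {within `[a, b], continuous (du n : R -> R)}.
  apply/(@within_contP R R^o) => s sI; apply/limatP; apply: cvg_norm; apply/limatP.
  by apply: limatB; [have /within_contP := @piece_ctrl_cont (x_ n)|have /within_contP :=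
    @piece_ctrl_cont z]; apply.
have idu n := within_integrable (cdu n).
apply: (@squeeze_norm _ _ _ _ _ _ _ (fun n => Mt * \int[leb]_(s in `[a, b]) (MB * du n s + v n s))).
  apply: nearW => n.
  apply: (duhamel_diff_le dualJ sepX T_gt0 Mt_ge0 evolS a_ge0 bT w_int _ _
     (piece_force_dom (Kx n)) (piece_force_dom Kz) _ tI).
  - by apply: integrableDR => //; apply: integrableZR.
  - by move=> s _; rewrite addr_ge0 // mulr_ge0 // normr_ge0.
  - apply: (ae_mono (Fv n)) => s h sI; rewrite /piece_force opprD addrACA.
    apply: le_trans (ler_normD _ _) _; rewrite lerD ?h //.
    by rewrite -(blin_B linB); exact: opnorm_leW.
rewrite -(mulr0 Mt); apply: cvgMr.
have e n : \int[leb]_(s in `[a, b]) (MB * du n s + v n s) =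
    MB * \int[leb]_(s in `[a, b]) du n s + \int[leb]_(s in `[a, b]) v n s.
  by rewrite RintegralD // ?RintegralZl //; exact: integrableZR.
under eq_fun => n do rewrite e.
have h : MB * \int[leb]_(s in `[a, b]) du n s + \int[leb]_(s in `[a, b]) v n s
    @[n --> \oo] --> MB * 0 + 0 by apply: cvgD => //; apply: cvgMr; exact: cu.
by move: h; rewrite mulr0 addr0.
Qed.
End Piece.

(** * The impulsive system *)

Section Admissible.
Context {R : realType} {X : completeNormedModType R}.
Context (J : X -> (X -> R^o)) (dualJ : duality_map J).
Context (q T : R) (q_gt0 : 0 < q) (N : nat) (t_ s_ : nat -> R).
Hypothesis times : impulse_times T N t_ s_.
Context (rho drho : nat -> R -> X -> X) (d e : nat -> R).
Hypothesis rho_C1 : forall i x, (1 <= i <= N)%N ->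
  forall t, t \in `[t_ i, s_ i] ->
    is_derive_in `[t_ i, s_ i] (fun v => rho i v x) t (drho i t x).
Hypothesis rho_cont : forall i t, (1 <= i <= N)%N -> t \in `[t_ i, s_ i] ->
  completely_continuous (rho i t) /\ continuous (drho i t).
Hypothesis rho_le : forall i t x, (1 <= i <= N)%N -> t \in `[t_ i, s_ i] ->
  `|rho i t x| <= d i /\ `|drho i t x| <= e i.
Context (g h : (R -> X) -> X) (Mg Mh : R).
Hypothesis g_cc : fun_completely_continuous (PCq q T N t_) (norm_PCq q T) g.
Hypothesis h_cont : fun_continuous (PCq q T N t_) (norm_PCq q T) h.
Hypothesis g_le : forall x, PCq q T N t_ x -> `|g x| <= Mg * (norm_PCq q T x + 1).
Hypothesis h_le : forall x, PCq q T N t_ x -> `|h x| <= Mh * (norm_PCq q T x + 1).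
Context (phi : R -> X) (phi_D : in_D q phi) (eta : X).
Notation I t := (0 <= t <= T).

(** Equality with [phi] is imposed on the whole negative half-line, so that [xtilde phi x] and [x]
    are the same function. *)
Definition admissible (r : R) (x : R -> X) : Prop :=
  [/\ PC T N t_ x, forall t, t < 0 -> x t = phi t & forall t, I t -> `|x t| <= r].

(** For [i = 0] the value is constant in [t], because [t_ 0 = s_ 0]. In the other cases [x (t_ i)]
    stands for the left limit, equal to it on PC. *)
Definition initial_value (x : R -> X) (i : nat) (t : R) : X :=
  if i is 0%N then phi 0 + g x else rho i t (x (t_ i)).

Definition initial_slope (x : R -> X) (i : nat) : X :=
  if i is 0%N then eta + h x else drho i (s_ i) (x (t_ i)).

Let T_gt0 : 0 < T := times_T_gt0 times.
Let t0 : t_ 0%N = 0 := times_t0 times.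
Let s0 : s_ 0%N = 0 := times_s0 times.

Lemma admissible_pwc r x : admissible r x -> pwc (- q) T x.
Proof. by case=> PCx xphi _; exact: (PC_pwc times q_gt0 phi_D xphi PCx). Qed.

Lemma admissible_PCq r x : admissible r x -> PCq q T N t_ x.
Proof. by case=> PCx xphi _; split=> //; exists phi => // s /andP[_]; exact: xphi. Qed.

Lemma norm_PCq_le (x : R -> X) (c c' : R) : norm_D q x <= c -> (forall t, I t -> `|x t| <= c') ->
  norm_PCq q T x <= c + c'.
Proof. by move=> xc xc'; rewrite lerD // (norm_PC_le times). Qed.

Lemma norm_PCq_ge0 (x : R -> X) : 0 <= norm_PCq q T x.
Proof.
apply: addr_ge0; first by rewrite mulr_ge0 ?invr_ge0 ?(ltW q_gt0) //; apply: Rintegral_ge0.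
rewrite /norm_PC; set A := image _ _; have [sA|nA] := pselect (has_sup A).
  by have [[a Aa] ubA] := sA; apply: le_trans (ub_le_sup ubA Aa); case: Aa => t _ <-.
by rewrite sup_out.
Qed.

Lemma zero_PCq : PCq q T N t_ (fun=> 0 : X).
Proof.
split; last by apply: (PC_pieces times (c := fun _ _ => 0)) => // i _ t; exact: cvg_cst.
exists (fun=> 0) => //; apply/in_D_pwc; exists [::] => s _; split=> [_||].
- by apply: continuous_limat; exact: cvg_cst.
- by exists 0; apply: continuous_limat; exact: cvg_cst.
- by exists 0; apply: continuous_limat; exact: cvg_cst.
Qed.

(** The growth condition at the zero function bounds [m] times a positive number from below by a
    norm. *)
Let nonneg_slope (G : (R -> X) -> X) m :
  (forall x, PCq q T N t_ x -> `|G x| <= m * (norm_PCq q T x + 1)) -> 0 <= m.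
Proof.
move=> /(_ _ zero_PCq) /(le_trans (normr_ge0 _)).
by rewrite pmulr_lge0 // ltr_wpDl // norm_PCq_ge0.
Qed.

Lemma Mg_ge0 : 0 <= Mg. Proof. exact: nonneg_slope g_le. Qed.
Lemma Mh_ge0 : 0 <= Mh. Proof. exact: nonneg_slope h_le. Qed.

Lemma admissible_norm r x : admissible r x -> norm_PCq q T x <= norm_D q phi + r.
Proof. by case=> _ xphi xr; apply: norm_PCq_le => //; rewrite (norm_D_eq q xphi). Qed.

(** Only the index 0 depends on [r]; the impulses have absolute bounds, so the smallness condition
    concerns [g] and [h] alone. *)
Definition value_bound (r : R) (i : nat) : R :=
  if i is 0%N then `|phi 0| + Mg * (norm_D q phi + r + 1) else d i.

Definition slope_bound (r : R) (i : nat) : R :=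
  if i is 0%N then `|eta| + Mh * (norm_D q phi + r + 1) else e i.

Let s_in i : (i <= N)%N -> s_ i \in `[t_ i, s_ i].
Proof. by move=> iN; rewrite in_itv /= lexx; have [-> _] := times_s times iN. Qed.

Lemma initial_value_le r x i t : admissible r x -> (i <= N)%N -> t_ i <= t <= s_ i ->
  `|initial_value x i t| <= value_bound r i.
Proof.
case: i => [|i] Kx iN tI /=; last first.
  by have [] := @rho_le i.+1 t (x (t_ i.+1)) iN _; rewrite ?in_itv.
apply: le_trans (ler_normD _ _) _; rewrite lerD2l.
apply: le_trans (g_le (admissible_PCq Kx)) _.
by rewrite ler_wpM2l ?Mg_ge0 // lerD2r admissible_norm.
Qed.

Lemma initial_slope_le r x i : admissible r x -> (i <= N)%N ->
  `|initial_slope x i| <= slope_bound r i.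
Proof.
case: i => [|i] Kx iN /=; last first.
  by have [] := @rho_le i.+1 (s_ i.+1) (x (t_ i.+1)) iN (s_in iN).
apply: le_trans (ler_normD _ _) _; rewrite lerD2l.
apply: le_trans (h_le (admissible_PCq Kx)) _.
by rewrite ler_wpM2l ?Mh_ge0 // lerD2r admissible_norm.
Qed.

Lemma initial_value_lip i : (i <= N)%N -> exists2 k : R, 0 <= k & forall x s t,
  t_ i <= s <= s_ i -> t_ i <= t <= s_ i ->
  `|initial_value x i s - initial_value x i t| <= k * `|s - t|.
Proof.
case: i => [|i] iN /=.
  by exists 0 => // x s t _ _; rewrite subrr normr0 mul0r.
have e0 : 0 <= e i.+1.
  by have [_] := @rho_le i.+1 (s_ i.+1) 0 iN (s_in iN); exact: le_trans.
exists (e i.+1) => // x s t sI tI.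
have H v : t_ i.+1 <= v <= s_ i.+1 ->
    is_derive_in `[t_ i.+1, s_ i.+1] (fun v => rho i.+1 v (x (t_ i.+1))) v
      (drho i.+1 v (x (t_ i.+1))) /\ `|drho i.+1 v (x (t_ i.+1))| <= e i.+1.
  move=> vI; have vI' : v \in `[t_ i.+1, s_ i.+1] by rewrite in_itv.
  by split; [exact: rho_C1|have [] := @rho_le i.+1 v (x (t_ i.+1)) iN vI'].
exact: (mean_value_le dualJ e0 H sI tI).
Qed.

Lemma initial_value_colorable r i t : (i <= N)%N -> t_ i <= t <= s_ i ->
  colorable (admissible r) (fun x y => `|initial_value x i t - initial_value y i t|).
Proof.
case: i => [|i] iN tI /=.
  have [_ gK] := g_cc; apply: (colorable_le (d' := fun x y => `|g x - g y|)).
    by move=> x y _ _; rewrite opprD addrACA subrr add0r.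
  apply: colorable_precompact; apply: gK; first by move=> x; exact: admissible_PCq.
  by exists (norm_D q phi + r) => x; exact: admissible_norm.
have tI' : t \in `[t_ i.+1, s_ i.+1] by rewrite in_itv.
have [[_ rK] _] := @rho_cont i.+1 t iN tI'.
apply: (@colorable_precompact _ _ _ _ (fun x => rho i.+1 t (x (t_ i.+1)))).
rewrite -(image_comp (fun x : R -> X => x (t_ i.+1)) (rho i.+1 t)); apply: rK.
exists r; split; first exact: num_real.
move=> m rm _ [x [_ _ xr] <-]; apply: le_trans (ltW rm); apply: xr.
by apply: (times_in times); rewrite ltnS ltnW.
Qed.

Let fun_cvg (G : (R -> X) -> X) r (x_ : nat -> R -> X) z :
  fun_continuous (PCq q T N t_) (norm_PCq q T) G -> admissible r z ->
  (forall n, admissible r (x_ n)) -> unif_cvg `[0, T]%classic x_ z ->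
  G (x_ n) @[n --> \oo] --> G z.
Proof.
move=> Gc Kz Kx xz; apply/cvgrPdist_lt => eps e0.
have [del d0 Hd] := Gc _ (admissible_PCq Kz) _ e0.
have [n0 Hn] := xz _ (divr_gt0 d0 (ltr0n R 3)); exists n0 => // n nn.
rewrite distrC; apply: Hd; first exact: admissible_PCq (Kx n).
have le t : I t -> `|x_ n t - z t| <= del / 3 by move=> It; apply: Hn; rewrite //= in_itv.
have d3 : 0 <= del / 3 by rewrite divr_ge0 // ltW.
apply: (@le_lt_trans _ _ (del / 3 + del / 3)); last lra.
apply: norm_PCq_le => //; apply: (norm_D_le q_gt0) => // t /andP[_ tle0].
have [t_lt0|t_ge0] := ltP t 0.
  by have [_ xp _] := Kx n; have [_ zp _] := Kz; rewrite xp // zp // subrr normr0.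
by apply: le; rewrite t_ge0 (le_trans tle0) // ltW.
Qed.

Lemma unif_cvg_at (x_ : nat -> R -> X) z t : unif_cvg `[0, T]%classic x_ z -> I t ->
  x_ n t @[n --> \oo] --> z t.
Proof.
move=> xz It; apply/cvgrPdist_le => eps e0; have [n0 Hn] := xz _ e0.
by exists n0 => // n nn; rewrite distrC Hn //= in_itv.
Qed.

Lemma initial_value_cvg r (x_ : nat -> R -> X) z i t : admissible r z ->
  (forall n, admissible r (x_ n)) -> unif_cvg `[0, T]%classic x_ z ->
  (i <= N)%N -> t_ i <= t <= s_ i ->
  initial_value (x_ n) i t @[n --> \oo] --> initial_value z i t.
Proof.
move=> Kz Kx xz; case: i => [|i] iN tI /=.
  by apply: cvgD; [exact: cvg_cst|apply: fun_cvg Kz Kx xz; have [] := g_cc].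
have tI' : t \in `[t_ i.+1, s_ i.+1] by rewrite in_itv.
have [[rc _] _] := @rho_cont i.+1 t iN tI'.
have Iti : I (t_ i.+1) by apply: (times_in times); rewrite ltnS ltnW.
exact: (cvg_comp _ _ (unif_cvg_at xz Iti) (rc _)).
Qed.

Lemma initial_slope_cvg r (x_ : nat -> R -> X) z i : admissible r z ->
  (forall n, admissible r (x_ n)) -> unif_cvg `[0, T]%classic x_ z ->
  (i <= N)%N -> initial_slope (x_ n) i @[n --> \oo] --> initial_slope z i.
Proof.
move=> Kz Kx xz; case: i => [|i] iN /=.
  by apply: cvgD; [exact: cvg_cst|exact: fun_cvg Kz Kx xz].
have [_ dc] := @rho_cont i.+1 (s_ i.+1) iN (s_in iN).
have Iti : I (t_ i.+1) by apply: (times_in times); rewrite ltnS ltnW.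
exact: (cvg_comp _ _ (unif_cvg_at xz Iti) (dc _)).
Qed.

Lemma admissible_neq0 r : 0 <= r -> admissible r !=set0.
Proof.
move=> r0; exists (fun t => if t < 0 then phi t else 0); split.
- apply: (PC_pieces times (c := fun _ _ => 0)) => [i _ t|i t iN /andP[ti _]].
    exact: cvg_cst.
  have /andP[ti0 _] := times_in times (leqW iN).
  by rewrite ltNge (le_trans ti0 (ltW ti)).
- by move=> t ->.
- by move=> t /andP[t_ge0 _]; rewrite ltNge t_ge0 /= normr0.
Qed.

Lemma admissible_convex r (K : finType) (a : K -> R) (v : K -> R -> X) :
  simplex a -> (forall i, admissible r (v i)) ->
  admissible r (fun t => \sum_i a i *: v i t).
Proof.
move=> [a0 a1] Kv; split.
- by apply: (PC_sum times) => i; have [] := Kv i.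
- move=> t tlt; rewrite (eq_bigr (fun i => a i *: phi t)).
    by rewrite -scaler_suml a1 scale1r.
  by move=> i _; have [_ vp _] := Kv i; rewrite vp.
- move=> t It; apply: le_trans (ler_norm_sum _ _ _) _.
  apply: (@le_trans _ _ (\sum_i a i * r)); last by rewrite -mulr_suml a1 mul1r.
  apply: ler_sum => i _; rewrite normrZ ger0_norm // ler_wpM2l //.
  by have [_ _] := Kv i; apply.
Qed.

Lemma admissible_closed r (x_ : nat -> R -> X) z : (forall k, admissible r (x_ k)) ->
  unif_cvg `[0, T]%classic x_ z ->
  exists2 z', admissible r z' & forall t, `[0, T]%classic t -> z' t = z t.
Proof.
move=> Kx xz; pose z' t := if t < 0 then phi t else z t.
have zz' t : `[0, T]%classic t -> z' t = z t.
  by rewrite /= in_itv /= => /andP[t_ge0 _]; rewrite /z' ltNge t_ge0.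
exists z' => //; have xz' : unif_cvg `[0, T]%classic x_ z'.
  move=> eps e0; have [n0 Hn] := xz _ e0; exists n0 => n nn t tI.
  by rewrite zz' // Hn.
split.
- by apply: (PC_unif times _ xz') => n; have [] := Kx n.
- by move=> t tlt; rewrite /z' tlt.
- move=> t It; apply: (norm_cvg_le _ (unif_cvg_at xz' It)).
  by apply: nearW => n; have [_ _] := Kx n; apply.
Qed.
End Admissible.

Lemma ucolorable_glue (R : realType) (P W : Type) (X : normedModType R) (I : finType)
    (K : set P) (D : set W) (v : I -> P -> W -> X) (V : P -> W -> X) :
  (forall i, ucolorable K D (v i)) ->
  (forall t, D t -> exists i, forall x, K x -> V x t = v i x t) -> ucolorable K D V.
Proof.
move=> H HV e e0.
have /choice[Cc Hc] : forall i, exists Cc : {C : finType & P -> C},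
    forall x y, K x -> K y -> projT2 Cc x = projT2 Cc y ->
    forall t, D t -> `|v i x t - v i y t| <= e.
  by move=> i; have [C [c Hc]] := H i _ e0; exists (existT (fun C : finType => P -> C) C c).
exists {dffun forall i, projT1 (Cc i)}, (fun x => [ffun i => projT2 (Cc i) x]).
move=> x y Kx Ky /ffunP exy t Dt; have [i Hi] := HV t Dt.
by rewrite !Hi //; apply: Hc => //; have := exy i; rewrite !ffunE.
Qed.

(** * The fixed point map of the system *)

Section System.
Context {R : realType} {X U : completeNormedModType R} (sepX : separable X).
Hypothesis sepU : separable U.
Context (dot : U -> U -> R) (hilbU : inner_product dot).
Context (q T : R) (q_gt0 : 0 < q) (N : nat) (t_ s_ : nat -> R).
Hypothesis times : impulse_times T N t_ s_.
Context (B : U -> X) (MB : R) (linB : bounded_linear B) (B_le : opnorm B <= MB).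
Context (Bs : (X -> R^o) -> U) (adjB : adjoint_to dot B Bs).
Context (J : X -> (X -> R^o)) (dualJ : duality_map J).
Context (C0 F : R -> X -> X) (S : R -> R -> X -> X) (M Mt : R).
Hypothesis M_ge0 : 0 <= M.
Hypothesis Mt_ge0 : 0 <= Mt.
Hypothesis evolS : evolution_operator T M Mt C0 F S.
Context (Res : R -> R -> R -> X -> X) (resRes : resolvent T S B Bs J Res).
Hypothesis compS : forall t s, 0 <= s -> s <= t -> t <= T -> compact_op (S t s).
Context (f : R -> (R -> X) -> X).
Hypothesis f_meas : forall psi, in_D q psi ->
  strongly_measurable (active_times N t_ s_) (f ^~ psi).
Hypothesis f_cont : {ae leb, forall t : R, active_times N t_ s_ t ->
  fun_continuous (in_D q) (norm_D q) (f t)}.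
Context (gamma : R -> R).
Hypothesis gamma_ge0 : forall t, active_times N t_ s_ t -> 0 <= gamma t.
Hypothesis gamma_L1 : leb.-integrable (active_times N t_ s_) (EFin \o gamma).
Hypothesis f_le : {ae leb, forall t : R, active_times N t_ s_ t ->
  forall psi, in_D q psi -> `|f t psi| <= gamma t}.
Context (rho drho : nat -> R -> X -> X) (d e : nat -> R).
Hypothesis rho_C1 : forall i x, (1 <= i <= N)%N ->
  forall t, t \in `[t_ i, s_ i] ->
    is_derive_in `[t_ i, s_ i] (fun v => rho i v x) t (drho i t x).
Hypothesis rho_cont : forall i t, (1 <= i <= N)%N -> t \in `[t_ i, s_ i] ->
  completely_continuous (rho i t) /\ continuous (drho i t).
Hypothesis rho_le : forall i t x, (1 <= i <= N)%N -> t \in `[t_ i, s_ i] ->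
  `|rho i t x| <= d i /\ `|drho i t x| <= e i.
Context (g h : (R -> X) -> X) (Mg Mh : R).
Hypothesis g_cc : fun_completely_continuous (PCq q T N t_) (norm_PCq q T) g.
Hypothesis h_cont : fun_continuous (PCq q T N t_) (norm_PCq q T) h.
Hypothesis g_le : forall x, PCq q T N t_ x -> `|g x| <= Mg * (norm_PCq q T x + 1).
Hypothesis h_le : forall x, PCq q T N t_ x -> `|h x| <= Mh * (norm_PCq q T x + 1).
Context (phi : R -> X) (phi_D : in_D q phi) (eta : X) (lam : R) (xT : X).
Hypothesis lam0 : 0 < lam.
Notation I t := (0 <= t <= T).
Notation adm := (admissible T N t_ phi).
Notation iv := (initial_value t_ rho g phi).
Notation is_ := (initial_slope t_ s_ drho h eta).
Notation vb := (value_bound q d Mg phi).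
Notation sb := (slope_bound q e Mh phi eta).
Notation force := (fun (x : R -> X) (s : R) => f s (hist x s)).

Let T_gt0 : 0 < T := times_T_gt0 times.

Lemma active_measurable : measurable (active_times N t_ s_).
Proof.
rewrite (_ : active_times N t_ s_ = \bigcup_(i in [set i | (i <= N)%N]) `[s_ i, t_ i.+1]%classic).
  by apply: bigcup_measurable => i _; exact: measurable_itv.
by apply/seteqP; split=> t [i iN tI]; exists i.
Qed.

Definition sol_value x i t : X := piece J T S B Bs Res (s_ i) (t_ i.+1) lam
  (fun x => iv x i (s_ i)) (fun x => is_ x i) force xT x t.

Let kappa := (Mt * MB) ^+ 2 * T / lam.
Let W i := \int[leb]_(s in `[s_ i, t_ i.+1]) gamma s.
Let E r i := M * vb r i + Mt * sb r i + Mt * W i.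

Section Interval.
Variables (i : nat) (r : R).
Hypothesis iN : (i <= N)%N.

Lemma active_sub : (`[s_ i, t_ i.+1]%classic : set R) `<=` active_times N t_ s_.
Proof. by move=> t tI; exists i. Qed.

Let a_ge0 : 0 <= s_ i. Proof. by have /andP[] := times_s_in times iN. Qed.
Let ab : s_ i <= t_ i.+1. Proof. by have [] := times_s times iN. Qed.
Let ta : t_ i <= s_ i. Proof. by have [] := times_s times iN. Qed.
Let bT : t_ i.+1 <= T. Proof. by have /andP[] := times_in times (iN : (i.+1 <= N.+1)%N). Qed.
Let aI : t_ i <= s_ i <= s_ i. Proof. by rewrite ta lexx. Qed.

Let fi_meas psi : in_D q psi -> smeasurable `[s_ i, t_ i.+1] (f ^~ psi).
Proof.
move=> Dpsi; apply: (smeasurableS active_sub).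
exact: (strongly_measurable_smeasurable active_measurable (f_meas Dpsi)).
Qed.

Let fi_cont : {ae leb, forall t : R, `[s_ i, t_ i.+1]%classic t ->
  fun_continuous (in_D q) (norm_D q) (f t)}.
Proof. by apply: (ae_mono f_cont) => t H /active_sub/H. Qed.

Let fi_le : {ae leb, forall t : R, `[s_ i, t_ i.+1]%classic t ->
  forall psi, in_D q psi -> `|f t psi| <= gamma t}.
Proof. by apply: (ae_mono f_le) => t H /active_sub/H. Qed.

Let gi_int : leb.-integrable `[s_ i, t_ i.+1] (EFin \o gamma).
Proof. exact: (@integrableS _ _ _ leb _ _ _ active_measurable (measurable_itv _) active_sub
  gamma_L1). Qed.

Let gi_ge0 s : s_ i <= s <= t_ i.+1 -> 0 <= gamma s.
Proof. by move=> sI; apply: gamma_ge0; exists i => //; rewrite in_itv. Qed.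

Let force_dom x : adm r x -> dominated (s_ i) (t_ i.+1) gamma (force x).
Proof.
move=> Kx; have px := admissible_pwc q_gt0 times phi_D Kx; split.
  exact: (nemytskii_smeas T_gt0 a_ge0 bT fi_meas fi_cont px).
exact: (nemytskii_le a_ge0 bT fi_le px).
Qed.

Let A_le x : adm r x -> `|iv x i (s_ i)| <= vb r i.
Proof. by move=> Kx; exact: (initial_value_le q_gt0 times rho_le g_le phi_D Kx iN aI). Qed.

Let D_le x : adm r x -> `|is_ x i| <= sb r i.
Proof. by move=> Kx; exact: (initial_slope_le q_gt0 times rho_le h_le phi_D eta Kx iN). Qed.

Lemma sol_value_le x t : adm r x -> s_ i <= t <= t_ i.+1 ->
  `|sol_value x i t| <= E r i + kappa * (`|xT| + E r i).
Proof.
exact: (piece_le dualJ sepX T_gt0 M_ge0 Mt_ge0 evolS hilbU linB B_le adjB resRes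
  a_ge0 ab bT lam0 xT A_le D_le force_dom gi_int gi_ge0).
Qed.

Lemma sol_value_start x : adm r x -> sol_value x i (s_ i) = iv x i (s_ i).
Proof.
exact: (piece_start dualJ sepX T_gt0 M_ge0 Mt_ge0 evolS hilbU linB B_le adjB resRes
  a_ge0 ab bT lam0 xT A_le D_le force_dom gi_int gi_ge0).
Qed.

Lemma sol_value_cont x : adm r x -> {within `[s_ i, t_ i.+1], continuous (sol_value x i)}.
Proof.
exact: (@piece_cont _ _ _ _ dualJ sepX _ _ _ _ _ _ T_gt0 M_ge0 Mt_ge0 evolS _ hilbU _ _ linB
  B_le _ adjB _ resRes
  _ _ _ a_ge0 ab bT lam0 _ _ _ _ _ xT _ _ _ A_le D_le force_dom gi_int gi_ge0).
Qed.

Lemma sol_value_sint x t : adm r x -> s_ i <= t <= t_ i.+1 -> sintegrable (s_ i) t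
  (fun s => S t s (piece_force J T S B Bs Res (s_ i) (t_ i.+1) lam
    (fun x => iv x i (s_ i)) (fun x => is_ x i) force xT x s)).
Proof.
exact: (piece_sint dualJ sepX T_gt0 M_ge0 Mt_ge0 evolS hilbU linB B_le adjB resRes
  a_ge0 ab bT lam0 xT A_le D_le force_dom gi_int gi_ge0).
Qed.

Lemma sol_value_ucolorable : ucolorable (adm r) `[s_ i, t_ i.+1]%classic (fun x => sol_value x i).
Proof.
apply: (piece_ucolorable dualJ sepX T_gt0 M_ge0 Mt_ge0 evolS hilbU linB B_le adjB resRes
  a_ge0 ab bT lam0 xT A_le D_le force_dom gi_int gi_ge0) => //.
exact: (initial_value_colorable times rho_cont g_cc phi_D r iN aI).
Qed.

Lemma sol_value_cvg (x_ : nat -> R -> X) z t : adm r z -> (forall n, adm r (x_ n)) ->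
  unif_cvg `[0, T]%classic x_ z -> s_ i <= t <= t_ i.+1 ->
  sol_value (x_ n) i t @[n --> \oo] --> sol_value z i t.
Proof.
move=> Kz Kx xz tI.
have xneg n s : s < 0 -> x_ n s = z s.
  by move=> s_lt0; have [_ xp _] := Kx n; have [_ zp _] := Kz; rewrite xp // zp.
have [w [w0 iw Fw cw]] := nemytskii_cvg sepX q_gt0 T_gt0 a_ge0 bT fi_meas fi_cont gi_int fi_le
  (admissible_pwc q_gt0 times phi_D Kz) (fun n => admissible_pwc q_gt0 times phi_D (Kx n)) xneg xz.
exact: (piece_cvg dualJ sepX T_gt0 M_ge0 Mt_ge0 evolS hilbU linB B_le adjB resRes
  a_ge0 ab bT lam0 A_le D_le force_dom gi_int gi_ge0 Kz Kx
  (initial_value_cvg q_gt0 times rho_cont g_cc phi_D Kz Kx xz iN aI)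
  (initial_slope_cvg q_gt0 times rho_cont h_cont phi_D Kz Kx xz iN) w0 iw Fw cw tI).
Qed.

(* [iv x i] on [t_ i, s_ i] followed by [sol_value x i] on [s_ i, t_ i.+1];
   the two agree at [s_ i]. *)
Definition sol_piece x (t : R) : X :=
  iv x i (clamp (t_ i) (s_ i) t) + sol_value x i (clamp (s_ i) (t_ i.+1) t) - iv x i (s_ i).

Lemma sol_piece_left x t : adm r x -> t_ i <= t <= s_ i -> sol_piece x t = iv x i t.
Proof.
move=> Kx tI; have /andP[_ ts] := tI; rewrite /sol_piece clamp_id // (clamp_le ab ts).
by rewrite sol_value_start // addrK.
Qed.

Lemma sol_piece_right x t : s_ i <= t <= t_ i.+1 -> sol_piece x t = sol_value x i t.
Proof.
move=> tI; have /andP[st _] := tI; rewrite /sol_piece (clamp_id tI) (clamp_ge ta st).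
by rewrite addrAC subrr add0r.
Qed.

Lemma sol_piece_cont x : adm r x -> continuous (sol_piece x).
Proof.
move=> Kx t; apply: cvgB; last exact: cvg_cst.
apply: cvgD.
  have c1 : {within `[t_ i, s_ i], continuous (iv x i)}.
    have [k k0 Hk] := initial_value_lip dualJ times rho_C1 rho_le g phi iN.
    apply/within_contP => p; rewrite /= in_itv /= => pI; apply: (limat_lipschitz k0) => v.
    by rewrite /= in_itv /= => vI; exact: Hk.
  exact: (within_clamp ta c1).
exact: (within_clamp ab (sol_value_cont Kx)).
Qed.

Lemma sol_piece_ucolorable (D : set R) : ucolorable (adm r) D sol_piece.
Proof.
have c1 : ucolorable (adm r) `[t_ i, s_ i]%classic (fun x => iv x i).
  have [k k0 Hk] := initial_value_lip dualJ times rho_C1 rho_le g phi iN.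
  apply: (ucolorable_lipschitz ta k0) => [x s t _|t tI]; first exact: Hk.
  exact: (initial_value_colorable times rho_cont g_cc phi_D r iN tI).
apply: ucolorableD; first apply: ucolorableD.
- apply: (ucolorable_le ler01 _ c1) => t _; exists (clamp (t_ i) (s_ i) t).
    by rewrite /= in_itv /= clamp_in.
  by move=> x y _ _; rewrite mul1r.
- apply: (ucolorable_le ler01 _ sol_value_ucolorable) => t _; exists (clamp (s_ i) (t_ i.+1) t).
    by rewrite /= in_itv /= clamp_in.
  by move=> x y _ _; rewrite mul1r.
- apply: (ucolorable_le ler01 _ c1) => t _; exists (s_ i); first by rewrite /= in_itv.
  by move=> x y _ _; rewrite mul1r opprK addrC distrC.
Qed.

Lemma sol_piece_cvg (x_ : nat -> R -> X) z t : adm r z -> (forall n, adm r (x_ n)) ->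
  unif_cvg `[0, T]%classic x_ z -> sol_piece (x_ n) t @[n --> \oo] --> sol_piece z t.
Proof.
move=> Kz Kx xz; apply: cvgB; first apply: cvgD.
- by apply: (initial_value_cvg q_gt0 times rho_cont g_cc phi_D Kz Kx xz iN); exact: clamp_in.
- by apply: (sol_value_cvg Kz Kx xz); exact: clamp_in.
- exact: (initial_value_cvg q_gt0 times rho_cont g_cc phi_D Kz Kx xz iN aI).
Qed.

Lemma sol_piece_le x t : adm r x -> ((0 < i)%N -> d i <= r) ->
  E r i + kappa * (`|xT| + E r i) <= r -> t_ i <= t <= t_ i.+1 -> `|sol_piece x t| <= r.
Proof.
move=> Kx dr Er /andP[ti tt]; have [st|ts] := leP (s_ i) t.
  rewrite sol_piece_right ?st //; apply: le_trans Er.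
  by apply: sol_value_le => //; rewrite st.
have i0 : (0 < i)%N.
  rewrite lt0n; apply: contraTneq ts => i0.
  by move: ti; rewrite i0 (times_t0 times) (times_s0 times) -leNgt.
have tI : t_ i <= t <= s_ i by rewrite ti ltW.
rewrite sol_piece_left //; apply: le_trans (dr i0).
apply: le_trans (initial_value_le q_gt0 times rho_le g_le phi_D Kx iN tI) _.
by case: (i) i0.
Qed.
End Interval.

(** The time 0 lies in none of the half-open intervals; the default value of [xget] assigns it to
    the first piece. *)
Definition piece_index (t : R) : nat := xget 0%N [set i | (i <= N)%N /\ t_ i < t <= t_ i.+1].

Lemma piece_indexE i t : (i <= N)%N -> t_ i < t <= t_ i.+1 -> piece_index t = i.
Proof.
move=> iN tI; rewrite /piece_index; apply: xget_unique => // j [jN tJ].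
exact: (times_uniq times jN iN tJ tI).
Qed.

Lemma piece_index0 : piece_index 0 = 0%N.
Proof.
apply: xgetPN => i [iN /andP[ti _]].
have /andP[t_ge0 _] := times_in times (leqW iN).
by move: ti; rewrite ltNge t_ge0.
Qed.

Lemma piece_index_in t : I t ->
  (piece_index t <= N)%N /\ t_ (piece_index t) <= t <= t_ (piece_index t).+1.
Proof.
move=> /andP[t_ge0 tT]; have [t0|t0] := eqVneq t 0.
  rewrite t0 piece_index0 (times_t0 times) lexx ltW ?(times_t_gt0 times) //.
have [|i iN tI] := @times_cover_left _ _ _ _ _ times t.
  by rewrite lt_neqAle eq_sym t0 t_ge0.
by rewrite (piece_indexE iN tI); have /andP[ti ->] := tI; rewrite ltW.
Qed.

(** The data of each piece are read from [x], not from the piece computed before it. The pieces are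
    thus independent, without induction on the intervals, and consistency between them is restored
    at a fixed point. *)
Definition sol_map x t : X := if t < 0 then phi t else sol_piece (piece_index t) x t.

Lemma sol_map_left x t : t < 0 -> sol_map x t = phi t.
Proof. by rewrite /sol_map => ->. Qed.

Lemma sol_map_piece x t : I t -> sol_map x t = sol_piece (piece_index t) x t.
Proof. by move=> /andP[t_ge0 _]; rewrite /sol_map ltNge t_ge0. Qed.

Lemma sol_map_admissible r x : (forall i, (i <= N)%N -> ((0 < i)%N -> d i <= r) /\
    E r i + kappa * (`|xT| + E r i) <= r) -> adm r x -> adm r (sol_map x).
Proof.
move=> Hr Kx; split; last first.
- move=> t It; rewrite (sol_map_piece _ It); have [iN tI] := piece_index_in It.
  by have [h1 h2] := Hr _ iN; exact: (sol_piece_le iN Kx h1 h2 tI).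
- exact: sol_map_left.
apply: (PC_pieces times (c := fun i => sol_piece i x)) => [i iN|i t iN tI].
  exact: (sol_piece_cont iN Kx).
have /andP[ti tt] := tI; have /andP[ti0 _] := times_in times (leqW iN).
have /andP[_ tT] := times_in times (iN : (i.+1 <= N.+1)%N).
rewrite sol_map_piece ?(piece_indexE iN tI) //.
by rewrite (ltW (le_lt_trans ti0 ti)) (le_trans tt tT).
Qed.

Lemma sol_map_ucolorable r : ucolorable (adm r) `[0, T]%classic sol_map.
Proof.
apply: (ucolorable_glue (v := fun i : 'I_N.+1 => sol_piece i)) => [i|t].
  by apply: sol_piece_ucolorable; rewrite -ltnS.
rewrite /= in_itv /= => It; have [iN _] := piece_index_in It.
by exists (Ordinal (iN : (piece_index t < N.+1)%N)) => x _; exact: sol_map_piece.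
Qed.

Lemma sol_map_cvg r (x_ : nat -> R -> X) z : adm r z -> (forall n, adm r (x_ n)) ->
  unif_cvg `[0, T]%classic x_ z -> unif_cvg `[0, T]%classic (fun n => sol_map (x_ n)) (sol_map z).
Proof.
move=> Kz Kx xz; apply: (ucolorable_unif_cvg (@sol_map_ucolorable r) Kx) => t.
rewrite /= in_itv /= => It; have [iN _] := piece_index_in It.
rewrite sol_map_piece //; under eq_fun do rewrite sol_map_piece //.
exact: (sol_piece_cvg iN Kz Kx xz).
Qed.

Lemma invariant_radius : (M * Mg + Mt * Mh) * (1 + kappa) < 1 -> exists2 r : R, 0 <= r & forall
  i, (i <= N)%N ->
  ((0 < i)%N -> d i <= r) /\ E r i + kappa * (`|xT| + E r i) <= r.
Proof.
move=> contraction; pose K := M * Mg + Mt * Mh; pose n := norm_D q phi.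
(* [c0] collects the terms of the bound for the first interval that are free of [r]; the rest is
   [r * th] with [th < 1], so [r >= c0 / (1 - th)] is enough there. *)
pose c0 := (1 + kappa) * (K * (n + 1) + M * `|phi 0| + Mt * `|eta| + Mt * W 0%N) + kappa * `|xT|.
pose th := K * (1 + kappa).
have th1 : 0 < 1 - th by rewrite subr_gt0.
(* For [i > 0] the bound [E r i] does not depend on [r] and may be computed at 0; absolute values
   allow all indices to be summed. *)
pose b i := `|d i| + `|E 0 i + kappa * (`|xT| + E 0 i)|.
pose r := Num.max `|c0 / (1 - th)| (\sum_(i < N.+1) b i).
exists r; first by rewrite le_max normr_ge0.
have br i : (i <= N)%N -> b i <= r.
  move=> iN; rewrite le_max; apply/orP; right.
  rewrite (bigD1 (Ordinal (iN : (i < N.+1)%N))) //= lerDl.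
  by apply: sumr_ge0 => j _; rewrite addr_ge0.
have c0r : c0 <= r * (1 - th).
  rewrite -ler_pdivrMr // le_max; apply/orP; left; exact: ler_norm.
have leE i : (i <= N)%N -> `|E 0 i + kappa * (`|xT| + E 0 i)| <= r.
  by move=> /br; apply: le_trans; rewrite lerDr.
move=> [|i] iN; split=> //.
- have -> : E r 0%N + kappa * (`|xT| + E r 0%N) = c0 + r * th.
    by rewrite /E /c0 /th /K /n /=; ring.
  by move: c0r; rewrite mulrBr mulr1; lra.
- move=> _; apply: le_trans (br _ iN); apply: le_trans (ler_norm _) _.
  by rewrite lerDl.
- rewrite -[leLHS]/(E 0 i.+1 + kappa * (`|xT| + E 0 i.+1)).
  by apply: le_trans (leE _ iN); exact: ler_norm.
Qed.

Lemma sol_map_fixpoint : (M * Mg + Mt * Mh) * (1 + kappa) < 1 ->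
  exists r z, adm r z /\ forall t, I t -> sol_map z t = z t.
Proof.
move=> /invariant_radius[r r0 Hr].
have [z Kz Hz] : exists2 z, adm r z & forall t, `[0, T]%classic t -> sol_map z t = z t.
  apply: (@schauder _ _ _ _ (adm r) sol_map r).
  - exact: (admissible_neq0 times phi r0).
  - by move=> x [_ _ xr] t; rewrite /= in_itv; apply: xr.
  - by move=> K a v; exact: (admissible_convex times).
  - by move=> x z; exact: (admissible_closed times).
  - by move=> x; exact: sol_map_admissible.
  - by move=> x z Kx Kz; exact: (sol_map_cvg Kz Kx).
  - exact/ucolorable_udist/sol_map_ucolorable.
by exists r, z; split=> // t It; apply: Hz; rewrite /= in_itv.
Qed.

(** * From a fixed point to a mild solution *)

Notation control := (feedback T N t_ s_ S f rho drho g h phi eta xT Bs J Res lam).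
Notation target_ := (target T t_ s_ S f rho drho g h phi eta xT).

Lemma target_piece r z i : adm r z -> (i <= N)%N -> target_ z i =
  piece_target T S (s_ i) (t_ i.+1) (fun x => iv x i (s_ i)) (fun x => is_ x i) force xT z.
Proof.
move=> [PCz zphi _] iN; have xt : xtilde phi z = z.
  by apply/funext => t; rewrite /xtilde; case: ltP => // /zphi ->.
rewrite /target /piece_target xt; case: i iN => [|i] iN; first by rewrite (times_s0 times).
by rewrite (PC_left_lim (i := i.+1) _ PCz).
Qed.

(** Consecutive intervals may share an endpoint, where two terms of the sum are present. Away from
    the finitely many [t_ j] the intervals lie in disjoint sets ]t_j, t_{j+1}] and a single term
    remains. *)
Lemma feedback_ae z i : (i <= N)%N -> ae_on `[s_ i, t_ i.+1] (control z)
  (ctrl J S Bs Res (s_ i) (t_ i.+1) lam (target_ z i)).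
Proof.
move=> iN; apply: (ae_mono (ae_notin [seq t_ j | j <- iota 0 N.+2])) => t tl tI.
have lt j : (j <= N)%N -> `[s_ j, t_ j.+1]%classic t -> t_ j < t <= t_ j.+1.
  move=> jN; rewrite /= in_itv /= => /andP[sjt ->]; rewrite andbT lt_neqAle.
  rewrite (le_trans _ sjt) ?andbT; last by have [] := times_s times jN.
  by apply: contra tl => /eqP <-; apply/map_f; rewrite mem_iota; lia.
rewrite /feedback (bigD1 (Ordinal (iN : (i < N.+1)%N))) //= big1 => [|j ji].
  by rewrite addr0 indicE mem_set // scale1r.
rewrite indicE memNset ?scale0r // => tJ; case/eqP: ji; apply/val_inj => /=.
have jN : (j <= N)%N by rewrite -ltnS.
exact: (times_uniq times jN iN (lt _ jN tJ) (lt _ iN tI)).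
Qed.

Lemma mild_piece r z i t : adm r z -> (i <= N)%N -> s_ i <= t <= t_ i.+1 ->
  let k s := S t s (B (control z s) + f s (hist z s)) in
  bochner_integrable (s_ i) t k /\
  sol_value z i t = cosop T S t (s_ i) (iv z i (s_ i)) + S t (s_ i) (is_ z i) + bint (s_ i) t k.
Proof.
move=> Kz iN tI k; have si := sol_value_sint iN Kz tI.
set k' := fun s => _ in si; have kk : ae_on `[s_ i, t] k' k.
  apply: (ae_mono (feedback_ae z iN)) => s H sI; rewrite /k H.
    by rewrite (target_piece Kz iN).
  by apply: itvS sI => //; have /andP[] := tI.
split; first exact: (sintegrable_bochner dualJ sepX (sintegrable_ae kk si)).
by rewrite -(bint_ae dualJ sepX kk si) -addrA.
Qed.

Lemma nmeasurable_sum (K : finType) (v : K -> R -> U) : (forall j, nmeasurable (v j)) ->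
  nmeasurable (fun t => \sum_j v j t).
Proof.
move=> mv; elim: (index_enum K) => [|j l IHl].
  by under [X in nmeasurable X]eq_fun do rewrite big_nil; exact: nmeasurable_cst.
under [X in nmeasurable X]eq_fun do rewrite big_cons.
exact: nmeasurableD.
Qed.

Lemma feedback_L2 z : L2 0 T (control z).
Proof.
pose y j := target_ z j.
have jP (j : 'I_N.+1) : [/\ 0 <= s_ j, s_ j <= t_ j.+1 & t_ j.+1 <= T].
  have jN : (j <= N)%N by rewrite -ltnS.
  have /andP[-> _] := times_s_in times jN; have [_ ->] := times_s times jN.
  by have /andP[_ ->] := times_in times (jN : (j.+1 <= N.+1)%N).
pose c (j : 'I_N.+1) t := ctrl J S Bs Res (s_ j) (t_ j.+1) lam (y j) (clamp (s_ j) (t_ j.+1) t).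
have uE t : control z t = \sum_(j < N.+1) if t \in `[s_ j, t_ j.+1]%classic then c j t else 0.
  apply: eq_bigr => j _; rewrite indicE; case: ifPn => [/set_mem tI|_]; last by rewrite scale0r.
  by rewrite scale1r /c clamp_id //; move: tI; rewrite /= in_itv.
have mu : nmeasurable (control z).
  rewrite (funext uE); apply: nmeasurable_sum => j; have [j1 j2 j3] := jP j.
  apply: nmeasurable_if; [exact: measurable_itv| |exact: nmeasurable_cst].
  apply: continuous_nmeasurable; apply: (within_clamp j2).
  exact: (@ctrl_cont _ _ _ _ dualJ _ _ _ _ _ _ M_ge0 evolS _ hilbU _ _ linB B_le _ adjB).
(* Square integrability comes from boundedness: each term is bounded by [ctrl_le], whether or not
   its interval contains [t]. *)
pose k := \sum_(j < N.+1) MB * Mt / lam * `|y j|.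
have uk t : `|control z t| <= k.
  rewrite uE; apply: le_trans (ler_norm_sum _ _ _) _; apply: ler_sum => j _.
  have [j1 j2 j3] := jP j; case: ifPn => _; last first.
    rewrite normr0 !mulr_ge0 ?invr_ge0 ?(ltW lam0) //; exact: MB_ge0 linB B_le.
  apply: (ctrl_le dualJ sepX M_ge0 Mt_ge0 evolS hilbU linB B_le adjB resRes j1 j2 j3 lam0).
  have /andP[h1 h2] := clamp_in t j2.
  by rewrite (le_trans j1 h1) (le_trans h2 j3).
split.
  have [s [ss su _]] := nmeasurable_approx sepU mu.
  by exists s; split=> //; apply: ae_true => t _; exact: su.
have /integrableP[_] := integrable_cst_itv (k ^+ 2) 0 T; apply: le_lt_trans.
apply: le_integral_ae => //.
apply: ae_true => t _; rewrite /= lee_fin ger0_norm ?sqr_ge0 //.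
by rewrite ler_pXn2r ?nnegrE // (le_trans _ (uk t)).
Qed.

Lemma fixpoint_mild r z : adm r z -> (forall t, I t -> sol_map z t = z t) ->
  mild_solution q T N t_ s_ S B f rho drho g h phi eta (control z) z.
Proof.
move=> Kz fixz; have [PCz zphi _] := Kz.
have zE i t : (i <= N)%N -> t_ i < t <= t_ i.+1 -> z t = sol_piece i z t.
  move=> iN tI; have /andP[ti tt] := tI; have /andP[ti0 _] := times_in times (leqW iN).
  have /andP[_ tT] := times_in times (iN : (i.+1 <= N.+1)%N).
  have It : I t by rewrite (ltW (le_lt_trans ti0 ti)) (le_trans tt tT).
  by rewrite -fixz // sol_map_piece // (piece_indexE iN tI).
split.
- by split; [exact: feedback_L2|exact: (admissible_PCq phi_D Kz)].
- by move=> t /andP[_]; exact: zphi.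
- move=> t /andP[t_ge0 tt].
  have tI : s_ 0 <= t <= t_ 1%N by rewrite (times_s0 times) t_ge0.
  have -> : z t = sol_value z 0 t.
    (* The first formula is required on the closed interval, so [t = 0] is handled apart, through
       [piece_index0]. *)
    rewrite -sol_piece_right //; have [->|t0] := eqVneq t 0.
      rewrite -fixz ?lexx ?ltW // sol_map_piece ?piece_index0 // lexx ltW //.
    by apply: zE => //; rewrite (times_t0 times) lt_neqAle eq_sym t0 t_ge0.
  by have := mild_piece Kz (leq0n N) tI; rewrite /= (times_s0 times).
- move=> i t iN /andP[ti ts]; have /andP[i0 iN'] := iN.
  have [h1 h2] := times_s times iN'.
  have tI : t_ i <= t <= s_ i by rewrite ts ltW.
  rewrite (zE i) ?ti ?(le_trans ts) // (sol_piece_left iN' Kz tI).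
  by rewrite (PC_left_lim iN PCz); case: (i) i0.
- move=> i t iN /andP[st tt]; have /andP[i0 iN'] := iN.
  have [h1 h2] := times_s times iN'.
  have tI : s_ i <= t <= t_ i.+1 by rewrite (ltW st).
  rewrite (zE i) ?tt ?(le_lt_trans h1) // sol_piece_right //.
  rewrite (PC_left_lim iN PCz); have := mild_piece Kz iN' tI.
  by case: (i) i0.
Qed.
End System.

Theorem theorem3p2 (R : realType) (X U : completeNormedModType R)
  (sepX : separable X) (reflX : reflexive_space X)
  (convX : strictly_convex X) (convXs : strictly_convex_dual X)
  (sepU : separable U) (dot : U -> U -> R) (hilbU : inner_product dot)
  (q T : R) (q_gt0 : 0 < q) (N : nat) (t_ s_ : nat -> R)
  (times : impulse_times T N t_ s_)
  (B : U -> X) (MB : R) (linB : bounded_linear B) (B_le : opnorm B <= MB)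
  (Bs : (X -> R^o) -> U) (adjB : adjoint_to dot B Bs)
  (J : X -> (X -> R^o)) (dualJ : duality_map J)
  (C0 F : R -> X -> X) (cosC0 : cosine_family C0) (pertF : perturbation C0 F)
  (S : R -> R -> X -> X) (M Mt : R) (M_gt0 : 0 < M) (Mt_gt0 : 0 < Mt)
  (evolS : evolution_operator T M Mt C0 F S)
  (Res : R -> R -> R -> X -> X) (resRes : resolvent T S B Bs J Res)
  (compS0 : forall t, t \in `[0, T] -> compact_op (sine C0 t))
  (f : R -> (R -> X) -> X)
  (f_meas : forall psi, in_D q psi ->
     strongly_measurable (active_times N t_ s_) (f ^~ psi))
  (f_cont : {ae leb, forall t : R, active_times N t_ s_ t ->
     fun_continuous (in_D q) (norm_D q) (f t)})
  (gamma : R -> R)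
  (gamma_ge0 : forall t, active_times N t_ s_ t -> 0 <= gamma t)
  (gamma_L1 : leb.-integrable (active_times N t_ s_) (EFin \o gamma))
  (f_le : {ae leb, forall t : R, active_times N t_ s_ t ->
     forall psi, in_D q psi -> `|f t psi| <= gamma t})
  (rho drho : nat -> R -> X -> X) (d e : nat -> R)
  (rho_C1 : forall i x, (1 <= i <= N)%N ->
     (forall t, t \in `[t_ i, s_ i] ->
        is_derive_in `[t_ i, s_ i] (fun v => rho i v x) t (drho i t x)) /\
     {within `[t_ i, s_ i], continuous (fun v => rho i v x)} /\
     {within `[t_ i, s_ i], continuous (fun v => drho i v x)})
  (rho_cont : forall i t, (1 <= i <= N)%N -> t \in `[t_ i, s_ i] ->
     completely_continuous (rho i t) /\ continuous (drho i t))
  (de_gt0 : forall i, (1 <= i <= N)%N -> 0 < d i /\ 0 < e i)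
  (rho_le : forall i t x, (1 <= i <= N)%N -> t \in `[t_ i, s_ i] ->
     `|rho i t x| <= d i /\ `|drho i t x| <= e i)
  (g h : (R -> X) -> X) (Mg Mh : R)
  (g_cc : fun_completely_continuous (PCq q T N t_) (norm_PCq q T) g)
  (h_cont : fun_continuous (PCq q T N t_) (norm_PCq q T) h)
  (g_le : forall x, PCq q T N t_ x -> `|g x| <= Mg * (norm_PCq q T x + 1))
  (h_le : forall x, PCq q T N t_ x -> `|h x| <= Mh * (norm_PCq q T x + 1))
  (phi : R -> X) (phi_D : in_D q phi) (eta : X) :
  let K := M * Mg + Mt * Mh in
  forall (lam : R) (xT : X), 0 < lam ->
  K * (1 + (Mt * MB) ^+ 2 * T / lam) < 1 ->
  exists x : R -> X,
    mild_solution q T N t_ s_ S B f rho drho g h phi eta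
      (feedback T N t_ s_ S f rho drho g h phi eta xT Bs J Res lam x) x.
Proof.
move=> K lam xT lam0 contraction.
have compS t s : 0 <= s -> s <= t -> t <= T -> compact_op (S t s).
  exact: (evol_compact evolS compS0).
have rho_derive i x : (1 <= i <= N)%N -> forall t, t \in `[t_ i, s_ i] ->
    is_derive_in `[t_ i, s_ i] (fun v => rho i v x) t (drho i t x).
  by move=> iN; have [] := rho_C1 i x iN.
have [r [z [Kz fixz]]] := sol_map_fixpoint sepX hilbU q_gt0 times linB B_le adjB dualJ
  (ltW M_gt0) (ltW Mt_gt0) evolS resRes compS f_meas f_cont gamma_ge0 gamma_L1 f_le
  rho_derive rho_cont rho_le g_cc h_cont g_le h_le phi_D eta xT lam0 contraction.
exists z; exact: (fixpoint_mild sepX sepU hilbU q_gt0 times linB B_le adjB dualJ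
  (ltW M_gt0) (ltW Mt_gt0) evolS resRes f_meas f_cont gamma_ge0 gamma_L1 f_le
  rho_le g_le h_le phi_D lam0 Kz fixz).
Qed.
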